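(* Suppose that $g_0=g_0(t)$ and $g_1=g_1(t)$ depend only on $t\in[0,T]$. Then there exists a constant $c_T>0$, depending on $T$ but independent of $\varepsilon$, such that the following holds. Let $\varepsilon\in(0,\varepsilon_0)$ and $$\rho_0^\varepsilon\in C(\overline{\Omega_\varepsilon(0)}),\quad f^\varepsilon\in C(Q_{\varepsilon,T}),\quad \eta_0\in C(\Gamma(0)),\quad f\in C(S_T).$$ Let $\rho^\varepsilon$ be a classical solution to the thin domain problem $$\partial_t\rho^\varepsilon-k_d\Delta\rho^\varepsilon=f^\varepsilon \text{ in } Q_{\varepsilon,T},\qquad \partial_{\nu_\varepsilon}\rho^\varepsilon+k_d^{-1}V_\varepsilon\rho^\varepsilon=0 \text{ on } \partial_\ell Q_{\varepsilon,T},\qquad \rho^\varepsilon|_{t=0}=\rho_0^\varepsilon \text{ in } \Omega_\varepsilon(0),$$ and let $\eta$ be a classical solution to the limit problem $$\partial^\circ(g\eta)-gV_\Gamma H\eta-k_d\,\mathrm{div}_\Gamma(g\nabla_\Gamma\eta)=gf \text{ on } S_T,\qquad \eta|_{t=0}=\eta_0 \text{ on } \Gamma(0).$$ Then $$\|\rho^\varepsilon-\bar\eta\|_{C(\overline{Q_{\varepsilon,T}})}\le c_T\Bigl(\|\rho_0^\varepsilon-\bar\eta_0\|_{C(\overline{\Omega_\varepsilon(0)})}+\|f^\varepsilon-\bar f\|_{C(Q_{\varepsilon,T})}\Bigr)+\varepsilon c_T\Bigl(\|\eta_0\|_{C(\Gamma(0))}+\|\eta\|_{C^{2,1}(S_T)}\Bigr)$$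 provided that the right-hand side is finite.
   Context: Moving surface. Let $n\ge2$, $T>0$. For each $t\in[0,T]$, $\Gamma(t)\subset\mathbb{R}^n$ is a given closed (compact, without boundary), connected, oriented smooth hypersurface with unit outward normal vector field $\nu(\cdot,t)$. There is a smooth mapping $\Phi\colon\Gamma(0)\times[0,T]\to\mathbb{R}^n$ with $\Phi(\cdot,0)=\mathrm{Id}$ such that $\Phi(\cdot,t)$ is a diffeomorphism from $\Gamma(0)$ onto $\Gamma(t)$ for each $t$. Set $S_T=\bigcup_{t\in(0,T]}\Gamma(t)\times\{t\}$ and $\overline{S_T}=(\Gamma(0)\times\{0\})\cup S_T$. Let $d(\cdot,t)$ be the signed distance function from $\Gamma(t)$ increasing in the direction of $\nu(\cdot,t)$. Fix $\delta>0$ independent of $t$ such that, with $\overline{N(t)}=\{x\in\mathbb{R}^n: -\delta\le d(x,t)\le\delta\}$ and $\overline{N_T}=\bigcup_{t\in[0,T]}\overline{N(t)}\times\{t\}$, for each $(x,t)\in\overline{N_T}$ there is a unique $\pi(x,t)\in\Gamma(t)$ with $x=\pi(x,t)+d(x,t)\nu(\pi(x,t),t)$ and $\nabla d(x,t)=\nu(\pi(x,t),t)$, the maps $d,\pi$ are smooth on $\overline{N_T}$, and $c_0^{-1}\le1-r\kappa_\alpha(y,t)\le c_0$ for all $(y,t)\in\overline{S_T}$, $r\in[-\delta,\delta]$, $\alpha=1,\dots,n-1$ with some constant $c_0>0$, where $\kappa_1,\dots,\kappa_{n-1}$ are the principal curvatures of $\Gamma(t)$ (the eigenvalues of the Weingarten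 map $W=(-\underline{D}_i\nu_j)_{i,j}$ other than the eigenvalue $0$ in the direction $\nu$). For a function $\zeta$ on $\overline{S_T}$ (or on $S_T$, or on $\Gamma(0)$ at $t=0$), $\bar\zeta(x,t)=\zeta(\pi(x,t),t)$ denotes its constant extension in the normal direction of $\Gamma(t)$. Surface operators. $P=I_n-\nu\otimes\nu$; $\nabla_\Gamma\eta=P\nabla\tilde\eta=(\underline{D}_1\eta,\dots,\underline{D}_n\eta)^T$ on $\Gamma(t)$, i.e. $\underline{D}_i\eta=\sum_{j=1}^nP_{ij}\partial_j\tilde\eta$, for any extension $\tilde\eta$ of $\eta$ to a neighborhood (independent of the extension); $\mathrm{div}_\Gamma u=\sum_{i=1}^n\underline{D}_iu_i$; $H=-\mathrm{div}_\Gamma\nu$ (sum of principal curvatures). The scalar outer normal velocity $V_\Gamma$ of $\Gamma(t)$ is $V_\Gamma(\Phi(Y,t),t)=\partial_t\Phi(Y,t)\cdot\nu(\Phi(Y,t),t)$. Let $\Phi_\nu$ solve $\Phi_\nu(Y,0)=Y$, $\partial_t\Phi_\nu(Y,t)=(V_\Gamma\nu)(\Phi_\nu(Y,t),t)$ for $(Y,t)\in\Gamma(0)\times[0,T]$; $\Phi_\nu(\cdot,t)$ is a diffeomorphism from $\Gamma(0)$ onto $\Gamma(t)$. The normal time derivative is $\partial^\circ\eta(\Phi_\nu(Y,t),t)=\frac{\partial}{\partial t}\bigl(\eta(\Phi_\nu(Y,t),t)\bigr)$, equivalently $\partial^\circ\eta=\partial_t\tilde\eta+V_\Gamma\nu\cdot\nabla\tilde\eta$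 for any extension $\tilde\eta$. Moving thin domain. $g_0,g_1$ are smooth functions on $\overline{S_T}$ such that $g=g_1-g_0\ge c$ on $\overline{S_T}$ for some constant $c>0$. Fix $\varepsilon_0\in(0,1)$ with $\varepsilon|g_i|\le\delta$ on $\overline{S_T}$ for all $\varepsilon\in(0,\varepsilon_0)$, $i=0,1$. For $t\in[0,T]$ let $\Omega_\varepsilon(t)=\{y+r\nu(y,t): y\in\Gamma(t),\ \varepsilon g_0(y,t)<r<\varepsilon g_1(y,t)\}$, $Q_{\varepsilon,T}=\bigcup_{t\in(0,T]}\Omega_\varepsilon(t)\times\{t\}$, $\partial_\ell Q_{\varepsilon,T}=\bigcup_{t\in(0,T]}\partial\Omega_\varepsilon(t)\times\{t\}$, $\overline{Q_{\varepsilon,T}}=\bigcup_{t\in[0,T]}\overline{\Omega_\varepsilon(t)}\times\{t\}$. $\nu_\varepsilon$ and $V_\varepsilon$ are the unit outward normal vector field and the scalar outer normal velocity of $\partial\Omega_\varepsilon(t)$, and $\partial_{\nu_\varepsilon}=\nu_\varepsilon\cdot\nabla$. The diffusion coefficient $k_d>0$ is a constant independent of $\varepsilon$. Classical solutions. $\rho^\varepsilon$ is a classical solution to the thin domain problem if $\rho^\varepsilon\in C(\overline{Q_{\varepsilon,T}})$, $\partial_i\rho^\varepsilon\in C(Q_{\varepsilon,T}\cup\partial_\ell Q_{\varepsilon,T})$, $\partial_t\rho^\varepsilon,\partial_i\partial_j\rho^\varepsilon\in C(Q_{\varepsilon,T})$ for all $i,j=1,\dots,n$ and the problem is satisfied pointwise.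 $\eta$ is a classical solution to the limit problem if $\eta\in C(\overline{S_T})\cap C^{2,1}(S_T)$ and the problem is satisfied pointwise, where $C^{2,1}(S_T)=\{\zeta\in C(S_T): \partial^\circ\zeta,\underline{D}_i\zeta,\underline{D}_i\underline{D}_j\zeta\in C(S_T)\text{ for all }i,j\}$. Norms. $\|\cdot\|_{C(X)}$ is the supremum of the absolute value over $X$, and $\|\eta\|_{C^{2,1}(S_T)}=\|\eta\|_{C(S_T)}+\|\partial^\circ\eta\|_{C(S_T)}+\sum_i\|\underline{D}_i\eta\|_{C(S_T)}+\sum_{i,j}\|\underline{D}_i\underline{D}_j\eta\|_{C(S_T)}$. *)

(* Defs.v *)
From mathcomp Require Import all_boot all_order all_algebra.
From mathcomp Require Import all_classical all_reals all_analysis.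

Set Implicit Arguments.
Unset Strict Implicit.
Unset Printing Implicit Defensive.

Import Order.TTheory GRing.Theory Num.Theory.
Import numFieldNormedType.Exports.

Local Open Scope classical_set_scope.
Local Open Scope ring_scope.

(* Points of R^n are row vectors. The library norm `| _ | on 'rV[R]_n is the
   sup norm (it gives the usual topology); the Euclidean norm is [enorm]. *)
Notation space_time R n := ('rV[R]_n * R)%type.

Definition dot (R : realType) (n : nat) (u v : 'rV[R]_n) : R :=
  \sum_i u 0 i * v 0 i.

Definition enorm (R : realType) (n : nat) (u : 'rV[R]_n) : R :=
  Num.sqrt (dot u u).

Definition grad (R : realType) (n : nat) (f : 'rV[R]_n -> R) (x : 'rV[R]_n) :
    'rV[R]_n :=
  \row_i 'D_(delta_mx 0 i) f x.

Definition boundary (X : topologicalType) (A : set X) : set X :=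
  closure A `\` interior A.

Definition spread (R : realType) (n : nat) (I : set R)
    (A : R -> set 'rV[R]_n) : set (space_time R n) :=
  [set p | I p.2 /\ A p.2 p.1].

(* Derivative at t of a map known on I only, one-sided at the end points
   of an interval I. *)
Definition diff_quotient (R : realType) (W : normedModType R) (I : set R)
    (f : R -> W) (t : R) : set_system W :=
  (fun s : R => (s - t)^-1 *: (f s - f t)) @ within I (dnbhs t).

Definition derivable_in (R : realType) (W : normedModType R) (I : set R)
    (f : R -> W) (t : R) : Prop :=
  cvg (diff_quotient I f t).

Definition derive_in (R : realType) (W : normedModType R) (I : set R)
    (f : R -> W) (t : R) : W :=
  lim (diff_quotient I f t).

(* Directional derivatives along all vectors up to order k exist and are
   continuous on the open set U (class C^k in finite dimension). *)
Fixpoint class_C (R : realType) (V W : normedModType R) (k : nat) (U : set V)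
    (f : V -> W) : Prop :=
  (forall x, U x -> {for x, continuous f}) /\
  match k with
  | 0%N => True
  | k'.+1 => forall v : V, (forall x, U x -> derivable f x v) /\
                           class_C k' U (fun x => 'D_v f x)
  end.

(* Smoothness on an arbitrary set: local smooth extendability. *)
Definition smooth_on (R : realType) (V W : normedModType R) (A : set V)
    (f : V -> W) : Prop :=
  forall x, A x -> exists (U : set V) (h : V -> W),
    [/\ open U, U x, forall k, class_C k U h &
        forall y, U y -> A y -> h y = f y].

Definition diffeomorphism (R : realType) (V W : normedModType R) (A : set V)
    (B : set W) (f : V -> W) : Prop :=
  [/\ smooth_on A f, set_bij A B f &
      exists h : W -> V, smooth_on B h /\ (forall x, A x -> h (f x) = x)].

Definition smooth_hypersurface (R : realType) (n : nat) (M : set 'rV[R]_n) :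
    Prop :=
  forall y, M y -> exists (U : set 'rV[R]_n) (phi : 'rV[R]_n -> R),
    [/\ open U, U y, forall k, class_C k U phi, grad phi y != 0 &
        forall z, U z -> (M z <-> phi z = 0)].

Definition closed_hypersurface (R : realType) (n : nat) (M : set 'rV[R]_n) :
    Prop :=
  [/\ M !=set0, compact M, connected M & smooth_hypersurface M].

(* The region enclosed by M: the bounded components of the complement. *)
Definition enclosed (R : realType) (n : nat) (M : set 'rV[R]_n) :
    set 'rV[R]_n :=
  [set x | ~ M x /\ bounded_set (connected_component (~` M) x)].

Definition tangent (R : realType) (n : nat) (M : set 'rV[R]_n)
    (x v : 'rV[R]_n) : Prop :=
  exists xi : R -> 'rV[R]_n,
    [/\ xi 0 = x, \forall s \near (0 : R), M (xi s) &
        is_derive (0 : R) (1 : R) xi v].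

(* N is the unit normal at x of the hypersurface M bounding the open set Om,
   pointing out of Om. *)
Definition outward_unit_normal (R : realType) (n : nat)
    (M Om : set 'rV[R]_n) (x N : 'rV[R]_n) : Prop :=
  [/\ enorm N = 1,
      forall v, tangent M x v -> dot N v = 0 &
      \forall s \near (0 : R)^'+,
        Om (x - s *: N) /\ ~ closure Om (x + s *: N)].

Definition sdist (R : realType) (n : nat) (M : set 'rV[R]_n) (x : 'rV[R]_n) :
    R :=
  let r := inf [set enorm (x - y) | y in M] in
  if `[< enclosed M x >] then - r else r.

Definition velocity_in (R : realType) (n : nat) (I : set R)
    (B : R -> set 'rV[R]_n) (xi : R -> 'rV[R]_n) (t : R) (v : 'rV[R]_n) :
    Prop :=
  (forall s, I s -> B s (xi s)) /\ diff_quotient I xi t --> v.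

(* c is the normal velocity at (x, t), in the direction N, of the evolving
   hypersurface B: the normal component of the velocity of any point moving
   in B and passing through x at time t. *)
Definition normal_velocity (R : realType) (n : nat) (I : set R)
    (B : R -> set 'rV[R]_n) (x : 'rV[R]_n) (t : R) (N : 'rV[R]_n) (c : R) :
    Prop :=
  (exists xi v, xi t = x /\ velocity_in I B xi t v) /\
  (forall xi v, xi t = x -> velocity_in I B xi t v -> c = dot v N).

Definition tangential_projection (R : realType) (n : nat) (N : 'rV[R]_n) :
    'M[R]_n :=
  1%:M - N^T *m N.

(* G is the tangential gradient P(grad h) at y computed from some extension h
   of eta; P is symmetric, so that it may act on row vectors. *)
Definition is_tgrad (R : realType) (n : nat) (M : set 'rV[R]_n)
    (nu : 'rV[R]_n -> 'rV[R]_n) (eta : 'rV[R]_n -> R) (y G : 'rV[R]_n) : Prop :=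
  exists h : 'rV[R]_n -> R,
    [/\ \forall z \near y, M z -> h z = eta z,
        differentiable h y &
        G = grad h y *m tangential_projection (nu y)].

Definition tdifferentiable (R : realType) (n : nat) (Gamma : R -> set 'rV[R]_n)
    (nu : space_time R n -> 'rV[R]_n) (eta : space_time R n -> R)
    (p : space_time R n) : Prop :=
  exists G, is_tgrad (Gamma p.2) (fun y => nu (y, p.2))
                     (fun y => eta (y, p.2)) p.1 G.

Definition tgrad (R : realType) (n : nat) (Gamma : R -> set 'rV[R]_n)
    (nu : space_time R n -> 'rV[R]_n) (eta : space_time R n -> R)
    (p : space_time R n) : 'rV[R]_n :=
  xget 0 [set G | is_tgrad (Gamma p.2) (fun y => nu (y, p.2))
                           (fun y => eta (y, p.2)) p.1 G].

Definition tD (R : realType) (n : nat) (Gamma : R -> set 'rV[R]_n)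
    (nu : space_time R n -> 'rV[R]_n) (i : 'I_n) (eta : space_time R n -> R)
    (p : space_time R n) : R :=
  tgrad Gamma nu eta p 0 i.

Definition tdiv (R : realType) (n : nat) (Gamma : R -> set 'rV[R]_n)
    (nu : space_time R n -> 'rV[R]_n) (u : space_time R n -> 'rV[R]_n)
    (p : space_time R n) : R :=
  \sum_i tD Gamma nu i (fun q => u q 0 i) p.

Definition mean_curvature (R : realType) (n : nat) (Gamma : R -> set 'rV[R]_n)
    (nu : space_time R n -> 'rV[R]_n) (p : space_time R n) : R :=
  - tdiv Gamma nu nu p.

Definition weingarten (R : realType) (n : nat) (Gamma : R -> set 'rV[R]_n)
    (nu : space_time R n -> 'rV[R]_n) (p : space_time R n) : 'M[R]_n :=
  \matrix_(i, j) - tD Gamma nu i (fun q => nu q 0 j) p.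

(* Eigenvalues of the (symmetric) Weingarten map with an eigenvector
   orthogonal to nu: this leaves out the eigenvalue 0 in the direction nu. *)
Definition principal_curvature (R : realType) (n : nat)
    (Gamma : R -> set 'rV[R]_n) (nu : space_time R n -> 'rV[R]_n)
    (p : space_time R n) (kappa : R) : Prop :=
  exists v : 'rV[R]_n, [/\ v != 0, dot v (nu p) = 0 &
    v *m weingarten Gamma nu p = kappa *: v].

Record moving_surface (R : realType) (n : nat) (T : R)
    (Gamma : R -> set 'rV[R]_n) (nu : space_time R n -> 'rV[R]_n)
    (Phi : space_time R n -> 'rV[R]_n) : Prop := {
  moving_surface_closed : forall t, 0 <= t <= T -> closed_hypersurface (Gamma t);
  moving_surface_normal : forall y t, 0 <= t <= T -> Gamma t y ->
    outward_unit_normal (Gamma t) (enclosed (Gamma t)) y (nu (y, t));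
  moving_surface_smooth : smooth_on (Gamma 0 `*` `[0, T]) Phi;
  moving_surface_init : forall Y, Gamma 0 Y -> Phi (Y, 0) = Y;
  moving_surface_diffeo : forall t, 0 <= t <= T ->
    diffeomorphism (Gamma 0) (Gamma t) (fun Y => Phi (Y, t))
}.

Definition surface_normal_velocity (R : realType) (n : nat) (T : R)
    (Gamma : R -> set 'rV[R]_n) (nu : space_time R n -> 'rV[R]_n)
    (Phi : space_time R n -> 'rV[R]_n) (V : space_time R n -> R) : Prop :=
  forall Y t, Gamma 0 Y -> 0 <= t <= T ->
    V (Phi (Y, t), t) =
      dot (derive_in `[0, T] (fun s => Phi (Y, s)) t) (nu (Phi (Y, t), t)).

Record normal_flow (R : realType) (n : nat) (T : R)
    (Gamma : R -> set 'rV[R]_n) (nu : space_time R n -> 'rV[R]_n)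
    (V : space_time R n -> R) (Phinu : space_time R n -> 'rV[R]_n) : Prop := {
  normal_flow_init : forall Y, Gamma 0 Y -> Phinu (Y, 0) = Y;
  normal_flow_ode : forall Y t, Gamma 0 Y -> 0 <= t <= T ->
    diff_quotient `[0, T] (fun s => Phinu (Y, s)) t -->
      V (Phinu (Y, t), t) *: nu (Phinu (Y, t), t);
  normal_flow_diffeo : forall t, 0 <= t <= T ->
    diffeomorphism (Gamma 0) (Gamma t) (fun Y => Phinu (Y, t))
}.

(* The normal trajectory s |-> (Phinu(Y, s), s) passing through p. *)
Definition normal_trajectory (R : realType) (n : nat)
    (Gamma : R -> set 'rV[R]_n) (Phinu : space_time R n -> 'rV[R]_n)
    (p : space_time R n) (s : R) : space_time R n :=
  (Phinu (xget 0 [set Y | Gamma 0 Y /\ Phinu (Y, p.2) = p.1], s), s).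

Definition normal_dt (R : realType) (n : nat) (T : R)
    (Gamma : R -> set 'rV[R]_n) (Phinu : space_time R n -> 'rV[R]_n)
    (eta : space_time R n -> R) (p : space_time R n) : R :=
  derive_in `[0, T] (fun s => eta (normal_trajectory Gamma Phinu p s)) p.2.

Record tubular_neighborhood (R : realType) (n : nat) (T : R)
    (Gamma : R -> set 'rV[R]_n) (nu : space_time R n -> 'rV[R]_n)
    (delta c0 : R) (pi : space_time R n -> 'rV[R]_n) : Prop := {
  tube_width_gt0 : 0 < delta;
  tube_const_gt0 : 0 < c0;
  tube_proj : forall x t, 0 <= t <= T -> `|sdist (Gamma t) x| <= delta ->
    [/\ Gamma t (pi (x, t)),
        x = pi (x, t) + sdist (Gamma t) x *: nu (pi (x, t), t) &
        forall y, Gamma t y -> x = y + sdist (Gamma t) x *: nu (y, t) ->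
          y = pi (x, t)];
  tube_grad : forall x t, 0 <= t <= T -> `|sdist (Gamma t) x| <= delta ->
    differentiable (sdist (Gamma t)) x /\
    grad (sdist (Gamma t)) x = nu (pi (x, t), t);
  tube_sdist_smooth :
    smooth_on (spread `[0, T] (fun t => [set x | `|sdist (Gamma t) x| <= delta]))
      (fun p => sdist (Gamma p.2) p.1);
  tube_proj_smooth :
    smooth_on (spread `[0, T] (fun t => [set x | `|sdist (Gamma t) x| <= delta]))
      pi;
  tube_curvature : forall p r kappa, spread `[0, T] Gamma p ->
    - delta <= r <= delta -> principal_curvature Gamma nu p kappa ->
    c0^-1 <= 1 - r * kappa <= c0
}.

Record thin_width (R : realType) (n : nat) (T : R)
    (Gamma : R -> set 'rV[R]_n) (delta eps0 c : R)
    (g0 g1 : space_time R n -> R) : Prop := {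
  thin_width_g0_smooth : smooth_on (spread `[0, T] Gamma) g0;
  thin_width_g1_smooth : smooth_on (spread `[0, T] Gamma) g1;
  thin_width_const_gt0 : 0 < c;
  thin_width_lb : forall p, spread `[0, T] Gamma p -> c <= g1 p - g0 p;
  thin_width_eps0 : 0 < eps0 < 1;
  thin_width_in_tube : forall eps p, 0 < eps < eps0 ->
    spread `[0, T] Gamma p -> eps * `|g0 p| <= delta /\ eps * `|g1 p| <= delta
}.

Definition depends_only_on_time (R : realType) (n : nat) (T : R)
    (Gamma : R -> set 'rV[R]_n) (h : space_time R n -> R) : Prop :=
  forall t y z, 0 <= t <= T -> Gamma t y -> Gamma t z -> h (y, t) = h (z, t).

Definition thin_domain (R : realType) (n : nat) (Gamma : R -> set 'rV[R]_n)
    (nu : space_time R n -> 'rV[R]_n) (g0 g1 : space_time R n -> R)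
    (eps t : R) : set 'rV[R]_n :=
  [set x | exists y r, [/\ Gamma t y, eps * g0 (y, t) < r < eps * g1 (y, t) &
                           x = y + r *: nu (y, t)]].

(* Classical solution, on the noncylindrical domain with time slices Om(t), of
     d_t rho - kd Laplacian rho = f,
     d_nuO rho + kd^-1 VO rho = 0 on the lateral boundary,
     rho = rho0 at t = 0.
   The time derivative at (x, t) is taken within the domain, hence from the
   left when t = T; the first order space derivatives on the lateral boundary
   are the values there of the continuous extension of those inside. *)
Record thin_classical_solution (R : realType) (n : nat) (T kd : R)
    (Om : R -> set 'rV[R]_n) (nuO : space_time R n -> 'rV[R]_n)
    (VO : space_time R n -> R) (f : space_time R n -> R)
    (rho0 : 'rV[R]_n -> R) (rho : space_time R n -> R) : Prop := {
  thin_sol_cont :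
    {within spread `[0, T] (fun t => closure (Om t)), continuous rho};
  thin_sol_dt : forall x t, spread `]0, T] Om (x, t) ->
    derivable_in [set s | spread `]0, T] Om (x, s)] (fun s => rho (x, s)) t;
  thin_sol_dt_cont : {within spread `]0, T] Om, continuous (fun p =>
    derive_in [set s | spread `]0, T] Om (p.1, s)] (fun s => rho (p.1, s)) p.2)};
  thin_sol_D1 : forall x t i, spread `]0, T] Om (x, t) ->
    derivable (fun z => rho (z, t)) x (delta_mx 0 i);
  thin_sol_D2 : forall x t i j, spread `]0, T] Om (x, t) ->
    derivable (fun z => 'D_(delta_mx 0 j) (fun w => rho (w, t)) z) x
      (delta_mx 0 i);
  thin_sol_D2_cont : forall i j, {within spread `]0, T] Om,
    continuous (fun p => 'D_(delta_mx 0 i)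
      (fun z => 'D_(delta_mx 0 j) (fun w => rho (w, p.2)) z) p.1)};
  thin_sol_eq : forall x t, spread `]0, T] Om (x, t) ->
    derive_in [set s | spread `]0, T] Om (x, s)] (fun s => rho (x, s)) t
    - kd * (\sum_i 'D_(delta_mx 0 i)
              (fun z => 'D_(delta_mx 0 i) (fun w => rho (w, t)) z) x)
    = f (x, t);
  thin_sol_bc : exists Drho : space_time R n -> 'rV[R]_n,
    [/\ {within spread `]0, T] Om `|` spread `]0, T] (fun t => boundary (Om t)),
          continuous Drho},
        forall x t, spread `]0, T] Om (x, t) ->
          Drho (x, t) = grad (fun z => rho (z, t)) x &
        forall p, spread `]0, T] (fun t => boundary (Om t)) p ->
          dot (nuO p) (Drho p) + kd^-1 * VO p * rho p = 0];
  thin_sol_init : forall x, Om 0 x -> rho (x, 0) = rho0 x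
}.

Record class_C21 (R : realType) (n : nat) (T : R)
    (Gamma : R -> set 'rV[R]_n) (nu : space_time R n -> 'rV[R]_n)
    (Phinu : space_time R n -> 'rV[R]_n) (zeta : space_time R n -> R) :
    Prop := {
  C21_cont : {within spread `]0, T] Gamma, continuous zeta};
  C21_dt : forall p, spread `]0, T] Gamma p ->
    derivable_in `[0, T] (fun s => zeta (normal_trajectory Gamma Phinu p s)) p.2;
  C21_dt_cont : {within spread `]0, T] Gamma,
    continuous (normal_dt T Gamma Phinu zeta)};
  C21_D1 : forall p, spread `]0, T] Gamma p -> tdifferentiable Gamma nu zeta p;
  C21_D1_cont : forall i, {within spread `]0, T] Gamma,
    continuous (tD Gamma nu i zeta)};
  C21_D2 : forall p j, spread `]0, T] Gamma p ->
    tdifferentiable Gamma nu (tD Gamma nu j zeta) p;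
  C21_D2_cont : forall i j, {within spread `]0, T] Gamma,
    continuous (tD Gamma nu i (tD Gamma nu j zeta))}
}.

Record limit_classical_solution (R : realType) (n : nat) (T kd : R)
    (Gamma : R -> set 'rV[R]_n) (nu : space_time R n -> 'rV[R]_n)
    (V : space_time R n -> R) (Phinu : space_time R n -> 'rV[R]_n)
    (g f : space_time R n -> R) (eta0 : 'rV[R]_n -> R)
    (eta : space_time R n -> R) : Prop := {
  limit_sol_cont : {within spread `[0, T] Gamma, continuous eta};
  limit_sol_C21 : class_C21 T Gamma nu Phinu eta;
  limit_sol_eq : forall p, spread `]0, T] Gamma p ->
    normal_dt T Gamma Phinu (fun q => g q * eta q) p
    - g p * V p * mean_curvature Gamma nu p * eta p
    - kd * tdiv Gamma nu (fun q => g q *: tgrad Gamma nu eta q) p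
    = g p * f p;
  limit_sol_init : forall y, Gamma 0 y -> eta (y, 0) = eta0 y
}.

Definition sup_norm (R : realType) (X : Type) (A : set X) (f : X -> R) :
    \bar R :=
  ereal_sup [set `|f x|%:E | x in A].

Definition norm_C21 (R : realType) (n : nat) (T : R)
    (Gamma : R -> set 'rV[R]_n) (nu : space_time R n -> 'rV[R]_n)
    (Phinu : space_time R n -> 'rV[R]_n) (zeta : space_time R n -> R) :
    \bar R :=
  let S := spread `]0, T] Gamma in
  (sup_norm S zeta + sup_norm S (normal_dt T Gamma Phinu zeta)
   + \sum_(i < n) sup_norm S (tD Gamma nu i zeta)
   + \sum_(i < n) \sum_(j < n) sup_norm S (tD Gamma nu i (tD Gamma nu j zeta)))%E.

(* Main.v *)
Require Import Defs.
From mathcomp Require Import all_boot all_order all_algebra.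
From mathcomp Require Import all_classical all_reals all_analysis.
From mathcomp Require Import ring lra.
From HB Require Import structures.

(** Write d for the signed distance to the moving surface, h = d - eps g0 for
the height above the inner boundary of the thin domain, g = g1 - g0, and
eta-bar for the extension of eta that is constant along normals.

The estimate is a comparison between rho and eta-bar by the maximum principle,
and the obstacle is the Robin condition, whose zeroth order coefficient V / kd
is of order one on a domain of width eps.  It is removed by a conjugation.
With tau = d_t h and b = (d_t g) / g, put

  phi = - h tau + b h^2 / 2.

Since g0 and g1 depend on time only, both boundary components are level sets
of h, and the derivative b h - tau of phi along the normal field grad d equals
there the normal velocity of the boundary in that direction (boundary_velocity).
So z = rho exp(phi / kd) has vanishing normal derivative, and solves

  d_t z - kd Lap z + 2 grad phi . grad z + c z = exp(phi / kd) f_eps,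
  c = Lap phi - |grad phi|^2 / kd - (d_t phi) / kd

(conjugated_jet).  Here phi = O(eps) because h = O(eps), although its first
derivatives are not small, and the potential is c = b - tau Lap d + O(eps)
(weight_potentialE).  On the surface d_t d = - V and Lap d = - H, so c agrees
up to O(eps) with the potential b - V H obtained by dividing the limit
equation by g (limit_equation).

The lifted solution therefore satisfies the conjugated equation up to an error
O(eps) times the C^{2,1} norm of eta (consistency_error).  Its gradient is
orthogonal to grad d, hence the normal part of grad phi, which is of order one,
does not act on it; the error terms that remain carry a factor d, h or eps, or
compare a smooth function with its value at the foot of the normal.  All
these facts come from the eikonal equation |grad d| = 1: grad d is constant
along normal lines (normal_line_grad), and so is d_t d (time_level_normal).

It remains to bound y = z - eta-bar.  The function
exp(- lam t) (+-y) - kap beta, where beta = h^2 - eps g h has positive outward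
derivative on both boundary components, attains its maximum over the compact
closed thin domain.  That point is not on the lateral boundary, where the
function increases strictly inwards (lateral_increase); at t = 0 the initial
data give the bound; elsewhere first derivatives vanish, second ones are
nonpositive and the time derivative is nonnegative, so the equation and
lam > |c| bound the maximum (interior_inequality).  Letting kap tend to 0
gives two_sided_estimate.

As differentiability of eta in time is given along the normal flow only, time derivatives
at the maximum are taken along the curve which keeps its distance from the
surface while its foot follows the normal flow (normal_curve).  Constants do
not depend on eps or on the solutions because every bound is stated over a
single index set gathering eps, the point, eta and a bound for its norm
(thin_index, limit_index). *)

Set Implicit Arguments.
Unset Strict Implicit.
Unset Printing Implicit Defensive.

Import Order.TTheory GRing.Theory Num.Theory.
Import numFieldNormedType.Exports.

Local Open Scope classical_set_scope.
Local Open Scope ring_scope.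

(** * Difference quotients on an interval *)

Section line_derivative.
Context {R : realType} {V W : normedModType R}.

Lemma is_derive_line (f : V -> W) (w v : V) (s : R) (d : W) :
  is_derive (w + s *: v) v f d <->
  is_derive s (1 : R) (fun h => f (w + h *: v)) d.
Proof.
have E : (fun h : R => h^-1 *: (f (h *: v + (w + s *: v)) - f (w + s *: v))) =
  (fun h : R => h^-1 *: ((fun h => f (w + h *: v)) (h *: (1 : R) + s)
      - (fun h => f (w + h *: v)) s)).
  apply/funext => h; congr (_ *: (f _ - _)).
  by rewrite scalerDl addrCA /GRing.scale /= mulr1.
by split=> -[dx <-]; split; rewrite /derivable /derive ?E// -?E.
Qed.

End line_derivative.

Section diff_quotient.
Context {R : realType}.
Implicit Types (I : set R) (t : R).

(** Relational form of one-sided differentiability, which keeps the value of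
the limit explicit. *)
Definition has_dq (W : normedModType R) I (f : R -> W) t (v : W) : Prop :=
  diff_quotient I f t --> v.

Lemma within_dnbhs_neq I t : \forall s \near within I (dnbhs t), s - t != 0.
Proof.
apply: (@cvg_within _ (dnbhs t) _ I); near=> s; rewrite subr_eq0.
by near: s; exact: nbhs_dnbhs_neq.
Unshelve. all: by end_near. Qed.

Lemma within_dnbhs_cvg I t : within I (dnbhs t) `=>` nbhs t.
Proof. exact: cvg_trans (cvg_within _) (cvg_within _). Qed.

Lemma within_nbhs_dnbhs (P : R -> Prop) I t :
  (\forall s \near within I (nbhs t), P s) ->
  \forall s \near within I (dnbhs t), P s.
Proof.
rewrite /within /dnbhs /within /= => /nbhs_ballP[r r0 H].
by apply/nbhs_ballP; exists r => // s sr _ sI; exact: H.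
Qed.

Lemma dq_cvg (W : normedModType R) I (f : R -> W) t v :
  has_dq I f t (v) -> f s @[s --> within I (dnbhs t)] --> f t.
Proof.
move=> fv; rewrite -[X in _ --> X](_ : f t + (0 : R) *: v = _); last first.
  by rewrite scale0r addr0.
have : (f t + (s - t) *: ((s - t)^-1 *: (f s - f t)))
   @[s --> within I (dnbhs t)] --> f t + (0 : R) *: v.
  apply: cvgD; first exact: cvg_cst.
  apply: cvgZ => //; rewrite -[X in _ --> X](subrr t).
  by apply: cvgB; [exact: within_dnbhs_cvg|exact: cvg_cst].
apply: cvg_trans; apply: near_eq_cvg; near=> s.
rewrite scalerA divff ?scale1r; first by rewrite addrC subrK.
by near: s; exact: within_dnbhs_neq.
Unshelve. all: by end_near. Qed.

(** The base point is excluded from the filter, so agreement there is a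
separate hypothesis. *)
Lemma dq_near_eq (W : normedModType R) I (f g : R -> W) t v :
  f t = g t -> (\forall s \near within I (dnbhs t), f s = g s) ->
  has_dq I f t (v) -> has_dq I g t (v).
Proof.
move=> ft fg; apply: cvg_trans; apply: near_eq_cvg.
by near=> s; rewrite ft; congr (_ *: (_ - _)); near: s.
Unshelve. all: by end_near. Qed.

Lemma dq_cst (W : normedModType R) I (c : W) t :
  has_dq I (fun=> c) t ((0 : W)).
Proof.
apply: cvg_near_cst; near=> s; by rewrite subrr scaler0.
Unshelve. all: by end_near. Qed.

Lemma dqD (W : normedModType R) I (f g : R -> W) t u v :
  has_dq I f t (u) -> has_dq I g t (v) ->
  has_dq I (fun s => f s + g s) t (u + v).
Proof.
move=> fu gv; rewrite /has_dq /diff_quotient.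
rewrite (_ : (fun s => _) = (fun s => (s - t)^-1 *: (f s - f t)
   + (s - t)^-1 *: (g s - g t))); first exact: cvgD.
by apply/funext => s; rewrite -scalerDr opprD addrACA.
Qed.

Lemma dqZ (W : normedModType R) I (f : R -> R) (g : R -> W) t a b :
  has_dq I f t (a) -> has_dq I g t (b) ->
  has_dq I (fun s => f s *: g s) t (f t *: b + a *: g t).
Proof.
move=> fa gb; have fc := dq_cvg fa; have gc := dq_cvg gb.
rewrite /has_dq /diff_quotient.
rewrite (_ : (fun s => _) = (fun s => f s *: ((s - t)^-1 *: (g s - g t))
   + ((s - t)^-1 *: (f s - f t)) *: g t)).
  by apply: cvgD; [exact: cvgZ|apply: cvgZ => //; exact: cvg_cst].
apply/funext => s; rewrite scalerA [f s * _]mulrC -!scalerA -scalerDr.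
by congr (_ *: _); rewrite scalerBr scalerBl subrKA.
Qed.

Lemma dqM I (f g : R -> R) t a b :
  has_dq I f t (a) -> has_dq I g t (b) ->
  has_dq I (fun s => f s * g s) t (f t * b + a * g t).
Proof. by move=> fa gb; have /= := dqZ fa gb. Qed.

Lemma dqMl I (c : R) (f : R -> R) t a :
  has_dq I f t (a) -> has_dq I (fun s => c * f s) t (c * a).
Proof.
move=> fa; have := dqM (dq_cst (W := R) I c t) fa.
by rewrite mul0r addr0.
Qed.

Lemma dqN I (f : R -> R) t a :
  has_dq I f t (a) -> has_dq I (fun s => - f s) t (- a).
Proof.
move=> /(@dqMl _ (-1)); rewrite mulN1r; apply: dq_near_eq; rewrite ?mulN1r//.
by near=> s; rewrite mulN1r.
Unshelve. all: by end_near. Qed.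

Lemma dqB I (f g : R -> R) t u v :
  has_dq I f t (u) -> has_dq I g t (v) ->
  has_dq I (fun s => f s - g s) t (u - v).
Proof. by move=> fu /dqN; exact: dqD. Qed.

Lemma dq_sum n I (f : 'I_n -> R -> R) t (a : 'I_n -> R) :
  (forall i, has_dq I (f i) t (a i)) ->
  has_dq I (fun s => \sum_i f i s) t (\sum_i a i).
Proof.
move=> fa; rewrite (_ : (fun s => _) = \sum_i f i); last first.
  by apply/funext => s; rewrite fct_sumE.
elim/big_rec2: _ => [|i g b _ gb]; first exact: (@dq_cst R I 0).
exact: dqD.
Qed.

Lemma dq_small (W : normedModType R) I (f : R -> W) t :
  f t = 0 -> (forall e, 0 < e ->
     \forall s \near within I (dnbhs t), `|f s| <= e * `|s - t|) ->
  has_dq I f t 0.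
Proof.
move=> ft H; apply/cvgr0Pnorm_le => e e0; near=> s.
rewrite ft subr0 normrZ normfV ler_pdivrMl ?normr_gt0; last first.
  by near: s; exact: within_dnbhs_neq.
by rewrite mulrC; near: s; exact: H.
Unshelve. all: by end_near. Qed.

Lemma dq_lipschitz (W : normedModType R) I (f : R -> W) t v :
  has_dq I f t v ->
  \forall s \near within I (dnbhs t), `|f s - f t| <= (`|v| + 1) * `|s - t|.
Proof.
move=> fv; near=> s.
have st : s - t != 0 by near: s; exact: within_dnbhs_neq.
have : `|(s - t)^-1 *: (f s - f t)| <= `|v| + 1.
  near: s; apply: (cvgr_norm_le _ fv); by rewrite ltrDl.
by rewrite normrZ normfV ler_pdivrMl ?normr_gt0// mulrC.
Unshelve. all: by end_near. Qed.

Lemma dq_coord n I (f : R -> 'rV[R]_n) t (v : 'rV[R]_n) i :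
  has_dq I f t (v) -> has_dq I (fun s => f s 0 i) t (v 0 i).
Proof.
move=> fv; have := cvg_comp _ _ fv (@coord_continuous R 1 n 0 i v).
by apply: cvg_trans; apply: near_eq_cvg; near=> s; rewrite /= !mxE.
Unshelve. all: by end_near. Qed.

Lemma dq_comp I (f : R -> R) (g : R -> R) t a b :
  has_dq I f t (a) -> is_derive (f t) (1 : R) g b ->
  has_dq I (g \o f) t (a * b).
Proof.
move=> fa gb; have fc := dq_cvg fa.
pose k (y : R) := if y == f t then b else (y - f t)^-1 * (g y - g (f t)).
have kc : k y @[y --> f t] --> b.
  apply/cvgrPdist_lt => e e0.
  have [gd gE] := gb.
  have : (fun h : R => h^-1 *: (g (h *: (1 : R) + f t) - g (f t))) @ 0^' --> b.
    by rewrite -gE.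
  move/cvgrPdist_lt => /(_ e e0); rewrite /dnbhs /within /= => /nbhs_ballP[d d0 H].
  apply/nbhs_ballP; exists d => // y yd; rewrite /k.
  case: (eqVneq y (f t)) => [_|yf]; first by rewrite subrr normr0.
  have := H (y - f t); rewrite /ball /= sub0r opprB => /(_ yd).
  by rewrite subr_eq0 => /(_ yf); rewrite [_ *: 1]mulr1 subrK.
have -> : a * b = (b : R) * a by rewrite mulrC.
rewrite /has_dq /diff_quotient; apply: cvg_trans (cvgM (cvg_comp _ _ fc kc) fa).
apply: near_eq_cvg; near=> s; rewrite /= /k; case: eqVneq => [->|fsn].
  by rewrite !subrr !scaler0 mulr0.
rewrite /GRing.scale /= mulrCA; congr (_ * _).
by rewrite mulrAC mulVf ?mul1r// subr_eq0.
Unshelve. all: by end_near. Qed.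

(** Uniqueness of derivatives on [0, T] rests on each of its points being an
accumulation point, the two end points included. *)
Lemma within_itv_proper (T t : R) : 0 < T -> 0 <= t <= T ->
  ProperFilter (within `[0, T] (dnbhs t)).
Proof.
move=> T0 tT.
apply: Build_ProperFilter_ex => P; rewrite /within /dnbhs /within /=.
move=> /nbhs_ballP[d /= d0 H].
move: tT => /andP[t0 tT].
have [tT'|tT'] := ltP t T.
  pose s := t + Num.min (d / 2) (T - t).
  have m0 : 0 < Num.min (d / 2) (T - t) by rewrite lt_min divr_gt0//= subr_gt0.
  exists s; apply: H.
  - rewrite /ball /= /s opprD addNKr normrN gtr0_norm//.
    by rewrite gt_min; apply/orP; left; rewrite ltr_pdivrMr// ltr_pMr ?ltr1n.
  - by rewrite /s -subr_eq0 addrC addKr gt_eqF.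
  - rewrite in_itv /= /s; apply/andP; split; first by rewrite addr_ge0// ltW.
    by rewrite -lerBrDl ge_min lexx orbT.
have tE : t = T by apply/eqP; rewrite eq_le tT.
rewrite {}tE in H.
pose s := T - Num.min (d / 2) T.
have m0 : 0 < Num.min (d / 2) T by rewrite lt_min divr_gt0//=.
exists s; apply: H.
- rewrite /ball /= /s opprB addrC subrK gtr0_norm//.
  by rewrite gt_min; apply/orP; left; rewrite ltr_pdivrMr// ltr_pMr ?ltr1n.
- by rewrite /s -subr_eq0 addrAC subrr sub0r oppr_eq0 gt_eqF.
- rewrite in_itv /= /s; apply/andP; split.
    by rewrite subr_ge0 ge_min lexx orbT.
  by rewrite gerBl ltW.
Qed.

Lemma dq_unique (W : normedModType R) (T : R) (f : R -> W) t u v :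
  0 < T -> 0 <= t <= T ->
  has_dq `[0, T] f t (u) -> has_dq `[0, T] f t (v) -> u = v.
Proof.
move=> T0 tT fu fv; have := within_itv_proper T0 tT => FF.
exact: cvg_unique fu fv.
Qed.

Lemma derive_in_val (W : normedModType R) (T : R) (f : R -> W) t v :
  0 < T -> 0 <= t <= T -> has_dq `[0, T] f t v -> derive_in `[0, T] f t = v.
Proof.
move=> T0 tT fv; have := within_itv_proper T0 tT => FF.
exact: cvg_lim fv.
Qed.

Lemma is_derive_dq (W : normedModType R) I (f : R -> W) t v :
  is_derive t (1 : R) f v -> has_dq I f t v.
Proof.
move=> [fd fv].
have f0 : (fun h : R => h^-1 *: (f (h *: (1 : R) + t) - f t)) @ 0^' --> v.
  by rewrite -fv.
have st : s - t @[s --> within I (dnbhs t)] --> (0 : R)^'.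
  apply: (@cvg_trans _ ((fun s => s - t) @ dnbhs t)).
    by move=> P; exact: cvg_within.
  move=> P; rewrite /dnbhs /within /= => /nbhs_ballP[d /= d0 H].
  apply/nbhs_ballP; exists d => // s sd st; apply: H; last by rewrite subr_eq0.
  by rewrite /ball /= sub0r opprB.
apply: cvg_trans (cvg_comp _ _ st f0); apply: near_eq_cvg; near=> s.
by rewrite /= /GRing.scale /= mulr1 subrK.
Unshelve. all: by end_near. Qed.

(** A maximum over the past of t > 0 forces a nonnegative time derivative; for
t = T no later time is available, so only earlier times are used. *)
Lemma dq_ge0 (T : R) (f : R -> R) t a :
  0 < t <= T -> has_dq `[0, T] f t (a) ->
  (\forall s \near within `[0, T] (nbhs t), f s <= f t) -> 0 <= a.
Proof.
move=> /andP[t0 tT] fa fle; rewrite leNgt; apply/negP => a0.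
have : \forall s \near within `[0, T] (dnbhs t),
  (s - t)^-1 *: (f s - f t) < 0 by apply: (cvgr_lt _ fa).
rewrite /within /dnbhs /within /= => /nbhs_ballP[d /= d0 H].
move: fle; rewrite /within /= => /nbhs_ballP[d' /= d'0 H'].
pose m := Num.min (Num.min (d / 2) (d' / 2)) t.
have m0 : 0 < m by rewrite !lt_min !divr_gt0//=.
have sI : `[0, T]%classic (t - m).
  rewrite /= in_itv /= subr_ge0 ge_min lexx orbT /=.
  by rewrite (le_trans _ tT)// gerBl ltW.
have : (t - m - t)^-1 *: (f (t - m) - f t) < 0.
  apply: H => //.
    rewrite /ball /= opprB addrC subrK gtr0_norm//.
    by rewrite !gt_min; apply/orP; left; apply/orP; left;
      rewrite ltr_pdivrMr// ltr_pMr ?ltr1n.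
  by rewrite -subr_eq0 addrAC subrr sub0r oppr_eq0 gt_eqF.
have : f (t - m) <= f t.
  apply: H' => //.
  rewrite /ball /= opprB addrC subrK gtr0_norm//.
  by rewrite !gt_min; apply/orP; left; apply/orP; right;
      rewrite ltr_pdivrMr// ltr_pMr ?ltr1n.
move=> le; rewrite ltNge mulr_le0//; last by rewrite subr_le0.
by rewrite invr_le0 addrAC subrr sub0r oppr_le0 ltW.
Qed.

End diff_quotient.

Lemma cvg_sum_ord {R : realType} {T : Type} (F : set_system T) (FF : Filter F)
    n (f : 'I_n -> T -> R) (a : 'I_n -> R) :
  (forall i, f i x @[x --> F] --> a i) ->
  \sum_i f i x @[x --> F] --> \sum_i a i.
Proof.
move=> fa; rewrite (_ : (fun s => _) = \sum_i f i); last first.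
  by apply/funext => s; rewrite fct_sumE.
elim/big_rec2: _ => [|i g b _ gb]; first exact: cvg_cst.
exact: cvgD.
Qed.

Lemma cvg_to_within {T U : Type} (f : T -> U) (F : set_system T)
    (FF : Filter F) (B : set T) (C : set U) (G : set_system U) :
  f @ within B F --> G -> (forall x, B x -> C (f x)) ->
  f @ within B F --> within C G.
Proof.
move=> fG BC P /fG H; rewrite /nbhs /= /within /= in H *.
apply: (@filterS _ F _ _ _ _ H) => x H1 Bx; exact: H1 (BC _ Bx).
Qed.

(** * Partial derivatives and the chain rule *)

Section partial_derivatives.
Context {R : realType} {n : nat}.
Implicit Types (x y z : 'rV[R]_n).
Local Notation e_ i := (delta_mx 0 i : 'rV[R]_n).

(** The mean value theorem along s |-> s c for s in [0, 1], which treats both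
signs of c at once. *)
Lemma mvt_affine (F F' : R -> R) (c al e : R) :
  (forall s : R, 0 <= s <= 1 -> is_derive (s * c) (1 : R) F (F' (s * c))) ->
  (forall s : R, 0 <= s <= 1 -> `|F' (s * c) - al| <= e) ->
  `|F c - F 0 - c * al| <= e * `|c|.
Proof.
move=> dF bF; pose G (s : R) := F (s * c).
have dG (s : R) : 0 <= s <= 1 -> is_derive s (1 : R) G (F' (s * c) * c).
  move=> s01; have -> : G = F \o (fun s => s * c) by [].
  have Fs := dF _ s01; apply: is_derive1_comp; apply: is_derive_eq.
  by rewrite scaler0 add0r /GRing.scale /= mulr1.
have cG : {within `[0, 1], continuous G}.
  apply: derivable_within_continuous => s; rewrite in_itv/= => s01.
  by apply: ex_derive; exact: dG.
have dG' (s : R) : s \in `]0, 1[%R -> is_derive s (1 : R) G (F' (s * c) * c).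
  by rewrite in_itv/= => /andP[s0 s1]; apply: dG; rewrite !ltW.
have [s] := MVT_segment ler01 dG' cG.
rewrite in_itv/= subr0 mulr1 {1 2}/G mul1r mul0r => s01 ->.
rewrite [F' _ * c]mulrC -mulrBr normrM mulrC ler_wpM2r//.
exact: bF.
Qed.

Lemma coord_le_norm x i : `|x 0 i| <= `|x|.
Proof.
rewrite [leRHS]/Num.Def.normr /= mx_normrE.
exact: (@le_bigmax _ _ _ 0 (fun ij : 'I_1 * 'I_n => `|x ij.1 ij.2|) (0, i)).
Qed.

Lemma norm_le_coord x r : 0 <= r -> (forall i, `|x 0 i| <= r) -> `|x| <= r.
Proof.
move=> r0 H; rewrite [leLHS]/Num.Def.normr /= mx_normrE.
by apply: bigmax_le => // -[i j] _ /=; rewrite ord1.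
Qed.

Lemma cvg_row (T : Type) (F : set_system T) (FF : Filter F)
    (f : 'I_n -> T -> R) (a : 'I_n -> R) :
  (forall i, f i x @[x --> F] --> a i) ->
  (\row_i f i x : 'rV[R]_n) @[x --> F] --> (\row_i a i : 'rV[R]_n).
Proof.
move=> H; apply/cvgrPdist_le => e e0.
have H2 : \forall x \near F, forall i, `|a i - f i x| <= e.
  apply: filter_forall => i.
  by move/cvgrPdist_le: (H i) => /(_ _ e0).
apply: (@filterS _ F _ _ _ _ H2) => x Hx; apply: norm_le_coord; first exact: ltW.
by move=> i; rewrite !mxE; exact: Hx.
Qed.

(** Moving from y to z one coordinate at a time, the mean value theorem
applies on every edge of the path, and the path stays in the sup norm ball of
radius r because its vertices mix the coordinates of y and z. *)
Lemma increment_partial (f : 'rV[R]_n -> R) (df : 'I_n -> 'rV[R]_n -> R)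
    (a : 'rV[R]_n) x r e :
  (forall z i, `|z - x| <= r -> is_derive z (e_ i) f (df i z)) ->
  (forall z i, `|z - x| <= r -> `|df i z - a 0 i| <= e) ->
  forall y z, `|y - x| <= r -> `|z - x| <= r ->
  `|f z - f y - \sum_i (z 0 i - y 0 i) * a 0 i| <= (n%:R * e) * `|z - y|.
Proof.
move=> df_ dfe y z yr zr.
have r0 : 0 <= r by exact: le_trans yr.
(* the vertices of the coordinate path from y to z *)
pose w (k : nat) : 'rV[R]_n := \row_i if (i < k)%N then z 0 i else y 0 i.
suff H k : (k <= n)%N ->
   `|f (w k) - f y - \sum_(i < n | (i < k)%N) (z 0 i - y 0 i) * a 0 i| <=
     (k%:R * e) * `|z - y|.
  have := H n (leqnn n); rewrite (_ : w n = z); last first.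
    by apply/rowP => i; rewrite mxE ltn_ord.
  by congr (`|_ - _ - _| <= _); apply: eq_bigl => i; rewrite ltn_ord.
elim: k => [_|k IH kn].
  rewrite (_ : w 0 = y); last by apply/rowP => i; rewrite mxE.
  by rewrite big_pred0// subrr subr0 normr0 !mul0r.
pose j := Ordinal kn.
pose c := z 0 j - y 0 j.
have wE : w k.+1 = w k + c *: e_ j.
  apply/rowP => i; rewrite !mxE eqxx /= ltnS leq_eqVlt /c.
  have [ij|ij] := eqVneq (val i) k.
    have -> : i = j by apply: val_inj.
    by rewrite /= ltnn eqxx mulr1 subrKC.
  rewrite /= (_ : (i == j) = false) ?mulr0 ?addr0//.
  by apply/negbTE; apply: contraNN ij => /eqP ->.
have zwr s : 0 <= s <= 1 -> `|w k + (s * c) *: e_ j - x| <= r.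
  move=> /andP[s0 s1]; apply: norm_le_coord => // i; rewrite !mxE eqxx /=.
  have zi := le_trans (coord_le_norm (z - x) i) zr.
  have yi := le_trans (coord_le_norm (y - x) i) yr.
  rewrite !mxE in zi yi.
  have [ij|ij] := eqVneq i j; last first.
    by rewrite mulr0 addr0; case: ifP.
  rewrite ij /= ltnn mulr1; rewrite ij in zi yi.
  rewrite (_ : _ - _ = (1 - s) * (y 0 j - x 0 j) + s * (z 0 j - x 0 j)).
    rewrite (le_trans (ler_normD _ _))// !normrM (ger0_norm s0).
    rewrite ger0_norm ?subr_ge0//.
    rewrite (_ : r = (1 - s) * r + s * r); last by ring.
    by rewrite lerD// ler_wpM2l ?subr_ge0.
  by rewrite /c; ring.
have step : `|f (w k.+1) - f (w k) - c * a 0 j| <= e * `|c|.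
  pose F (s : R) := f (w k + s *: e_ j).
  have := @mvt_affine F (fun s => df j (w k + s *: e_ j)) c (a 0 j) e.
  rewrite /F /= scale0r addr0 -wE; apply.
  - move=> s s01; exact: (proj1 (is_derive_line f (w k) (e_ j) (s * c) _) (df_ _ j (zwr _ s01))).
  - by move=> s s01; apply: dfe; exact: zwr.
have SE (F : 'I_n -> R) :
    \sum_(i < n | (i < k.+1)%N) F i = F j + \sum_(i < n | (i < k)%N) F i.
  rewrite (bigD1 j)//=; congr (_ + _); apply: eq_bigl => i.
  rewrite ltnS leq_eqVlt -val_eqE /=.
  by case: eqVneq => [->|_]; rewrite ?ltnn ?andbF ?andbT//=.
rewrite SE.
set S := \sum_(i < n | _) _ in IH *.
rewrite (_ : _ - _ = (f (w k.+1) - f (w k) - c * a 0 j) + (f (w k) - f y - S)); last first.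
  by rewrite /c; ring.
rewrite (le_trans (ler_normD _ _))//.
rewrite (_ : _ * `|z - y| = e * `|z - y| + (k%:R * e) * `|z - y|); last first.
  by rewrite -addn1 natrD; ring.
rewrite lerD ?IH ?(ltnW kn)//.
rewrite (le_trans step)// ler_wpM2l//.
  by apply: le_trans (dfe x j _); rewrite ?subrr ?normr0.
by have := coord_le_norm (z - y) j; rewrite !mxE.
Qed.

(** The chain rule along a curve for a function which is differentiable in
space, with jointly continuous partial derivatives, but in time only along the
single line of the end point: the increment is split as f (xi s, s) - f (xi t,
s), controlled by increment_partial uniformly in s, plus f (xi t, s) - f (xi
t, t). This is how much is known of a classical solution. *)
Lemma dq_curve (I : set R) (f : 'rV[R]_n * R -> R)
    (df : 'I_n -> 'rV[R]_n * R -> R) (xi : R -> 'rV[R]_n) (t : R)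
    (v a : 'rV[R]_n) (b : R) :
  (\forall q \near within [set q : 'rV[R]_n * R | I q.2] (nbhs (xi t, t)),
     forall i, is_derive q.1 (e_ i) (fun z => f (z, q.2)) (df i q)) ->
  (forall i, df i q @[q --> within [set q : 'rV[R]_n * R | I q.2]
     (nbhs (xi t, t))] --> a 0 i) ->
  has_dq I (fun s => f (xi t, s)) t b -> has_dq I xi t v ->
  has_dq I (fun s => f (xi s, s)) t (b + \sum_i v 0 i * a 0 i).
Proof.
move=> dfq dfa fb xiv.
have xic := dq_cvg xiv.
have xis : has_dq I (fun s => \sum_i xi s 0 i * a 0 i) t (\sum_i v 0 i * a 0 i).
  apply: dq_sum => i; have := dqM (dq_coord (i := i) xiv) (@dq_cst R R I (a 0 i) t).
  by rewrite mulr0 add0r.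
pose h s := f (xi s, s) - f (xi t, s) - \sum_i (xi s 0 i - xi t 0 i) * a 0 i.
have h0 : has_dq I h t 0.
  apply: dq_small => [|e e0].
    rewrite /h subrr sub0r big1 ?oppr0// => i _; by rewrite subrr mul0r.
  pose K := n.+1%:R * (`|v| + 1).
  have K0 : 0 < K by rewrite mulr_gt0// ltr_pwDr.
  pose e' := e / K.
  have e'0 : 0 < e' by rewrite divr_gt0.
  have /nbhs_ballP[r /= r0 Hr] : \forall q \near nbhs (xi t, t), I q.2 ->
      (forall i, is_derive q.1 (e_ i) (fun z => f (z, q.2)) (df i q)) /\
      (forall i, `|df i q - a 0 i| <= e').
    have H2 : \forall q \near within [set q : 'rV[R]_n * R | I q.2]
         (nbhs (xi t, t)), forall i, `|df i q - a 0 i| <= e'.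
      apply: filter_forall => i; near do rewrite distrC.
      by move/cvgrPdist_le: (dfa i) => /(_ _ e'0).
    have H3 : \forall q \near within [set q : 'rV[R]_n * R | I q.2]
         (nbhs (xi t, t)), (forall i, is_derive q.1 (e_ i) (fun z => f (z, q.2)) (df i q)) /\ (forall i, `|df i q - a 0 i| <= e').
      by near=> q; split; near: q.
    exact: H3.
  near=> s.
  have Is : I s by near: s; exact: withinT.
  have sr : `|s - t| < r.
    near: s; apply: (@within_dnbhs_cvg R I t).
    by apply/nbhs_ballP; exists r => // y; rewrite /ball /= distrC.
  have xr : `|xi s - xi t| <= r / 2.
    rewrite distrC; near: s; move/cvgrPdist_le: xic; apply.
    by rewrite divr_gt0.
  have := @increment_partial (fun z => f (z, s)) (fun i z => df i (z, s)) a
     (xi t) (r / 2) e'.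
  have inb z : `|z - xi t| <= r / 2 -> ball (xi t, t) r (z, s).
    move=> zr; split => /=; last by rewrite /ball /= distrC.
    rewrite -ball_normE /= distrC (le_lt_trans zr)// ltr_pdivrMr//.
    by rewrite ltr_pMr// ltr1n.
  move=> /(_ (fun z i zr => (Hr _ (inb z zr) Is).1 i)).
  move=> /(_ (fun z i zr => (Hr _ (inb z zr) Is).2 i)).
  have r20 : `|xi t - xi t| <= r / 2 by rewrite subrr normr0 divr_ge0// ltW.
  move=> /(_ (xi t) (xi s) r20 xr) hs; rewrite (le_trans hs)//.
  have lip : `|xi s - xi t| <= (`|v| + 1) * `|s - t|.
    by near: s; exact: dq_lipschitz.
  rewrite (@le_trans _ _ (n%:R * e' * ((`|v| + 1) * `|s - t|)))//.
    by rewrite ler_wpM2l// mulr_ge0// ltW.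
  rewrite mulrA ler_wpM2r// -mulrA [e' * _]mulrC mulrA.
  rewrite /e' [_ * (e / K)]mulrCA -[leRHS]mulr1 ler_wpM2l ?(ltW e0)//.
  by rewrite ler_pdivrMr// mul1r /K ler_wpM2r ?addr_ge0// ler_nat.
have := dqD (dqD h0 fb) (dqB xis (@dq_cst R R I (\sum_i xi t 0 i * a 0 i) t)).
rewrite add0r subr0; apply: dq_near_eq; rewrite /h.
  rewrite !subrr addr0 big1 ?subrr ?add0r// => i _; by rewrite subrr mul0r.
near=> s.
have -> : \sum_i (xi s 0 i - xi t 0 i) * a 0 i =
    \sum_i xi s 0 i * a 0 i - \sum_i xi t 0 i * a 0 i.
  by rewrite -sumrB; apply: eq_bigr => i _; rewrite mulrBl.
by ring.
Unshelve. all: by end_near. Qed.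

End partial_derivatives.

Section differentiability_criteria.
Context {R : realType}.

Lemma is_diff_criterion (V W : normedModType R) (f : V -> W) (df : {linear V -> W}) x :
  continuous df ->
  (forall e, 0 < e -> \forall h \near (0 : V),
     `|f (h + x) - f x - df h| <= e * `|h|) ->
  is_diff x f df.
Proof.
move=> dfc H.
have E : f \o shift x = cst (f x) + df +o_ (0 : V) id.
  apply/eqaddoP => e e0; near=> h.
  rewrite /= -[(_ - _) h]/(f (h + x) - (f x + df h)) opprD addrA.
  by near: h; exact: H.
have dE := diff_unique dfc E.
by apply: DiffDef => //; apply/diff_locallyP; rewrite dE.
Unshelve. all: by end_near. Qed.

(** The space increment is controlled at the varying time, so one time
derivative at the point itself is enough. *)
Lemma is_diff_partial_prod n (f : 'rV[R]_n * R -> R)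
    (df : 'I_n -> 'rV[R]_n * R -> R) (x : 'rV[R]_n) (t : R)
    (a : 'rV[R]_n) (b : R) :
  (\forall q \near (x, t), forall i,
     is_derive q.1 (delta_mx 0 i : 'rV[R]_n) (fun z => f (z, q.2)) (df i q)) ->
  (forall i, df i q @[q --> (x, t)] --> a 0 i) ->
  is_derive t (1 : R) (fun s => f (x, s)) b ->
  is_diff (x, t) f (fun v => \sum_i v.1 0 i * a 0 i + v.2 * b).
Proof.
move=> dfq dfa fb.
pose d (v : 'rV[R]_n * R) := \sum_i v.1 0 i * a 0 i + v.2 * b.
have lin_d : linear d.
  move=> k u v; rewrite /d /= scalerDr scaler_sumr addrACA -big_split /=.
  by congr (_ + _); [apply: eq_bigr => i _; rewrite !mxE|]; rewrite /GRing.scale /=; ring.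
pose dM := GRing.isLinear.Build _ _ _ _ _ lin_d.
pose dL : {linear _ -> _} := HB.pack d dM.
rewrite -/d -[d]/(dL : _ -> _); apply: is_diff_criterion.
  move=> v; apply: cvgD; last by apply: cvgM; [exact: cvg_snd|exact: cvg_cst].
  apply: cvg_sum_ord => i; apply: cvgM; last exact: cvg_cst.
  apply: (@cvg_comp _ _ _ (fun x : 'rV[R]_n * R => x.1) (fun y => y 0 i) _ (nbhs v.1)).
    exact: cvg_fst.
  exact: coord_continuous.
move=> e e0.
have e2 : 0 < e / 2 by rewrite divr_gt0.
pose e' := (e / 2) / n.+1%:R.
have e'0 : 0 < e' by rewrite divr_gt0.
have /nbhs_ballP[r /= r0 Hr] : \forall q \near (x, t),
      (forall i, is_derive q.1 (delta_mx 0 i : 'rV[R]_n) (fun z => f (z, q.2)) (df i q)) /\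
      (forall i, `|df i q - a 0 i| <= e').
  have H2 : \forall q \near (x, t), forall i, `|df i q - a 0 i| <= e'.
    apply: (@filter_forall _ _ (fun i q => `|df i q - a 0 i| <= e') (nbhs (x, t))) => i; near do rewrite distrC.
    by move/cvgrPdist_le: (dfa i) => /(_ _ e'0).
  by near=> q; split; near: q.
have tq : \forall k \near (0 : R), `|f (x, k + t) - f (x, t) - k * b| <= (e / 2) * `|k|.
  have [fd fE] := fb.
  have /derivable1_diffP/diff_locally := fd.
  rewrite (deriv1E fd) derive1E fE => /eqaddoP /(_ _ e2).
  by apply: filterS => k /=; rewrite !fctE /= opprD addrA.
have N1 : \forall h \near (0 : 'rV[R]_n * R), `|h| < r / 2.
  by apply/nbhs_norm0P; exists (r / 2) => //=; exact: divr_gt0.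
have N2 : \forall h \near (0 : 'rV[R]_n * R),
    `|f (x, h.2 + t) - f (x, t) - h.2 * b| <= (e / 2) * `|h.2|.
  have /nbhs_norm0P[d0 /= d00 Hd] := tq.
  apply/nbhs_norm0P; exists d0 => //= k kd; apply: Hd; rewrite /= (le_lt_trans _ kd)//.
  by rewrite [leRHS]/Num.Def.normr /= le_max lexx orbT.
near=> h.
have hr : `|h| < r / 2 by near: h; exact: N1.
have h1 : `|h.1| <= `|h| by rewrite [leRHS]/Num.Def.normr /= le_max lexx.
have h2 : `|h.2| <= `|h| by rewrite [leRHS]/Num.Def.normr /= le_max lexx orbT.
have inb z : `|z - x| <= r / 2 -> ball (x, t) r (z, h.2 + t).
  move=> zr; split => /=.
    rewrite -ball_normE /= distrC (le_lt_trans zr)// ltr_pdivrMr//.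
    by rewrite ltr_pMr// ltr1n.
  by rewrite /ball /= opprD addrC subrK normrN (le_lt_trans h2)// (lt_trans hr)//.
have := @increment_partial R n (fun z => f (z, h.2 + t)) (fun i z => df i (z, h.2 + t)) a
     x (r / 2) e'.
move=> /(_ (fun z i zr => (Hr _ (inb z zr)).1 i)).
move=> /(_ (fun z i zr => (Hr _ (inb z zr)).2 i)).
have r20 : `|x - x| <= r / 2 by rewrite subrr normr0 divr_ge0// ltW.
have r21 : `|h.1 + x - x| <= r / 2 by rewrite addrK (le_trans h1)// ltW.
move=> /(_ x (h.1 + x) r20 r21); rewrite addrK => Hx.
have Ht : `|f (x, h.2 + t) - f (x, t) - h.2 * b| <= (e / 2) * `|h.2|.
  by near: h; exact: N2.
rewrite (_ : _ - _ = (f (h.1 + x, h.2 + t) - f (x, h.2 + t) - \sum_i h.1 0 i * a 0 i)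
   + (f (x, h.2 + t) - f (x, t) - h.2 * b)); last first.
  have -> : h + (x, t) = (h.1 + x, h.2 + t) by case: (h).
  by rewrite /= /d; ring.
rewrite (le_trans (ler_normD _ _))// (splitr e) mulrDl lerD//; last first.
  by rewrite (le_trans Ht)// ler_wpM2l// ltW.
rewrite (eq_bigr (fun i => ((h.1 + x) 0 i - x 0 i) * a 0 i)); last first.
  by move=> i _; rewrite !mxE addrK.
rewrite (le_trans Hx)// (@le_trans _ _ (e / 2 * `|h.1|))//; last first.
  by rewrite ler_wpM2l// ltW.
apply: ler_wpM2r => //.
have -> : n%:R * e' = (e / 2) * (n%:R / n.+1%:R) by rewrite /e' mulrCA.
by rewrite ler_piMr ?(ltW e2)// ler_pdivrMr// mul1r ler_nat.
Unshelve. all: by end_near. Qed.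

Lemma is_diff_partial n (f : 'rV[R]_n -> R)
    (df : 'I_n -> 'rV[R]_n -> R) (x : 'rV[R]_n) (a : 'rV[R]_n) :
  (\forall q \near x, forall i,
     is_derive q (delta_mx 0 i : 'rV[R]_n) f (df i q)) ->
  (forall i, df i q @[q --> x] --> a 0 i) ->
  is_diff x f (fun v => \sum_i v 0 i * a 0 i).
Proof.
move=> dfq dfa.
have H := @is_diff_partial_prod n (fun q => f q.1) (fun i q => df i q.1) x 0 a 0.
have {}H : is_diff (x, 0 : R) (fun q => f q.1) (fun v : 'rV[R]_n * R => \sum_i v.1 0 i * a 0 i + v.2 * 0).
  apply: H.
  - exact: (@cvg_fst _ _ (nbhs x) (nbhs (0 : R)) _ _ dfq).
  - by move=> i; apply: (cvg_comp _ _ cvg_fst (dfa i)).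
  - exact: (is_derive_cst (f x) (0 : R) (1 : R)).
have -> : f = (fun q => f q.1) \o (fun z => (z, 0 : R)) by [].
apply: is_diff_eq.
by apply/funext => v /=; rewrite mulr0 addr0.
Qed.

Lemma is_derive_comp_diff (V : normedModType R) (f : V -> R) (c : R -> V) s dc :
  is_derive s (1 : R) c dc -> differentiable f (c s) ->
  is_derive s (1 : R) (f \o c) ('d f (c s) dc).
Proof.
move=> [cd <-] fd; have cd' := cd; move/derivable1_diffP in cd'.
have fcd : differentiable (f \o c) s by exact: differentiable_comp.
split; first exact/derivable1_diffP.
by rewrite deriveE// diff_comp//= deriveE.
Qed.

End differentiability_criteria.

Lemma two_close {R : realType} (D a b e k : R) :
  0 < k -> `|D - k * a| <= e / 2 * k -> `|D - k * b| <= e / 2 * k ->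
  `|a - b| <= e.
Proof.
move=> k0 A1 A2; rewrite -(ler_pM2r k0) -[X in _ * X <= _](ger0_norm (ltW k0)) -normrM.
rewrite (_ : (a - b) * k = (D - k * b) - (D - k * a)); last by ring.
rewrite (le_trans (ler_normB _ _))// (_ : e * _ = e / 2 * k + e / 2 * k).
  by rewrite lerD.
by rewrite -mulrDl -splitr.
Qed.

(** * Functions of class C^k *)

Section class_C.
Context {R : realType}.
Implicit Types (V W : normedModType R) (k : nat).

(** Derivatives on an open set are local, so class C^k depends only on the
values taken there. *)
Lemma class_C_eq V W k (U : set V) (f g : V -> W) :
  open U -> (forall x, U x -> f x = g x) -> class_C k U f -> class_C k U g.
Proof.
move=> oU; elim: k f g => [|k IH] f g fg [cf].
  move=> _; split=> // x Ux; have := cf _ Ux.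
  rewrite /prop_for /continuous_at (fg _ Ux); apply: cvg_trans; apply: near_eq_cvg.
  by near do apply: fg; exact: open_nbhs_nbhs.
move=> df; split.
  move=> x Ux; have := cf _ Ux.
  rewrite /prop_for /continuous_at (fg _ Ux); apply: cvg_trans; apply: near_eq_cvg.
  by near do apply: fg; exact: open_nbhs_nbhs.
move=> v; have [dfv Cfv] := df v.
have E x : U x -> {near x, f =1 g}.
  by move=> Ux; near do apply: fg; exact: open_nbhs_nbhs.
split; first by move=> x Ux; apply: near_eq_derivable (dfv _ Ux); exact: E.
by apply: IH Cfv => x Ux; apply: near_eq_derive; exact: E.
Unshelve. all: by end_near. Qed.

Lemma class_C_cont V W k (U : set V) (f : V -> W) :
  class_C k U f -> forall x, U x -> {for x, continuous f}.
Proof. by case: k => [|k] []. Qed.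

Lemma class_CW V W k (U : set V) (f : V -> W) :
  class_C k.+1 U f -> class_C k U f.
Proof.
elim: k f => [|k IH] f; first by case.
move=> [cf df]; split=> // v; have [dfv Cfv] := df v.
by split => //; exact: IH.
Qed.

Lemma class_C_sub V W k (U U' : set V) (f : V -> W) :
  U' `<=` U -> class_C k U f -> class_C k U' f.
Proof.
move=> UU'; elim: k f => [|k IH] f [cf df].
  by split=> // x /UU'; exact: cf.
split=> [x /UU'|v]; first exact: cf.
have [dfv Cfv] := df v; split=> [x /UU'|]; first exact: dfv.
exact: IH.
Qed.

Lemma class_C_cst V W k (U : set V) (c : W) : class_C k U (fun=> c).
Proof.
elim: k c => [|k IH] c; first by split=> // x _; exact: cvg_cst.
split=> [x _|v]; first exact: cvg_cst.
split=> [x _|]; first exact: derivable_cst.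
rewrite (_ : (fun x => _) = (fun=> 0 : W)); first exact: IH.
by apply/funext => x; rewrite derive_cst.
Qed.

Lemma class_CD V W k (U : set V) (f g : V -> W) : open U ->
  class_C k U f -> class_C k U g -> class_C k U (fun x => f x + g x).
Proof.
move=> oU; elim: k f g => [|k IH] f g [cf df] [cg dg].
  by split=> // x Ux; apply: cvgD; [exact: cf|exact: cg].
split=> [x Ux|v]; first by apply: cvgD; [exact: cf|exact: cg].
have [dfv Cfv] := df v; have [dgv Cgv] := dg v.
split=> [x Ux|]; first by apply: derivableD; [exact: dfv|exact: dgv].
apply: class_C_eq oU _ (IH _ _ Cfv Cgv) => x Ux.
by rewrite -deriveD//; [exact: dfv|exact: dgv].
Qed.

Lemma class_C_sum V W k (U : set V) m (f : 'I_m -> V -> W) : open U ->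
  (forall i, class_C k U (f i)) -> class_C k U (fun x => \sum_i f i x).
Proof.
move=> oU Cf; rewrite (_ : (fun x => _) = \sum_i f i); last first.
  by apply/funext => x; rewrite fct_sumE.
elim/big_rec: _ => [|i g _ Cg]; first exact: class_C_cst.
exact: class_CD.
Qed.

Lemma class_CM V k (U : set V) (f g : V -> R) : open U ->
  class_C k U f -> class_C k U g -> class_C k U (fun x => f x * g x).
Proof.
move=> oU; elim: k f g => [|k IH] f g Cf Cg.
  split=> // x Ux; have [cf _] := Cf; have [cg _] := Cg.
  by apply: cvgM; [exact: cf|exact: cg].
have [cf df] := Cf; have [cg dg] := Cg.
split=> [x Ux|v]; first by apply: cvgM; [exact: cf|exact: cg].
have [dfv Cfv] := df v; have [dgv Cgv] := dg v.
split=> [x Ux|]; first by apply: derivableM; [exact: dfv|exact: dgv].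
have := class_CD oU (IH _ _ (class_CW Cf) Cgv) (IH _ _ (class_CW Cg) Cfv).
apply: class_C_eq => // x Ux.
by rewrite deriveM//; [exact: dfv|exact: dgv].
Qed.

Lemma class_C_coord V n k (U : set V) (f : V -> 'rV[R]_n) i : open U ->
  class_C k U f -> class_C k U (fun x => f x 0 i).
Proof.
move=> oU; elim: k f => [|k IH] f [cf df].
  by split=> // x Ux; exact: (cvg_comp _ _ (cf _ Ux) (@coord_continuous R 1 n 0 i (f x))).
split=> [x Ux|v].
  by exact: (cvg_comp _ _ (cf _ Ux) (@coord_continuous R 1 n 0 i (f x))).
have [dfv Cfv] := df v.
split=> [x Ux|]; first by apply: (proj1 (derivable_mxP _ _ _) (dfv _ Ux)).
apply: class_C_eq oU _ (IH _ Cfv) => x Ux.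
by rewrite derive_mx ?mxE//; exact: dfv.
Qed.

Lemma class_C_derive V W (U : set V) (f : V -> W) v :
  (forall k, class_C k U f) -> forall k, class_C k U (fun x => 'D_v f x).
Proof. by move=> Cf k; have [_ /(_ v)[]] := Cf k.+1. Qed.

Lemma class_C_derivable V W (U : set V) (f : V -> W) v x :
  (forall k, class_C k U f) -> U x -> derivable f x v.
Proof. by move=> Cf Ux; have [_ /(_ v)[df _]] := Cf 1%N; exact: df. Qed.

(** Two applications of the mean value theorem, first in direction v, then in
direction w, write the second difference as h^2 times a mixed derivative at a
nearby point. *)
Lemma second_difference V (U : set V) (f : V -> R) (p v w : V) (e : R) :
  open U -> U p -> (forall k, class_C k U f) -> 0 < e ->
  \forall h \near 0^'+,
    `|f (p + h *: v + h *: w) - f (p + h *: v) - (f (p + h *: w) - f p)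
      - h ^+ 2 * 'D_w (fun x => 'D_v f x) p| <= e * h ^+ 2.
Proof.
move=> oU Up Cf e0.
have Cvf := class_C_derive v Cf.
have Cwv := class_C_derive w Cvf.
have : \forall x \near p, U x /\
    `|'D_w (fun x => 'D_v f x) x - 'D_w (fun x => 'D_v f x) p| <= e.
  near=> x; split; first by near: x; exact: open_nbhs_nbhs.
  rewrite distrC; near: x; have := class_C_cont (Cwv 0%N) Up.
  by move/cvgrPdist_le => /(_ _ e0).
move=> /nbhs_ballP[r /= r0 Hr].
have K0 : 0 < `|v| + `|w| + 1 by rewrite ltr_wpDl// addr_ge0.
near=> h.
have h0 : 0 < h by near: h; exact: nbhs_right_gt.
have hr : h * (`|v| + `|w| + 1) < r.
  rewrite -ltr_pdivlMr//; near: h; apply: nbhs_right_lt; exact: divr_gt0.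
have inb a b : 0 <= a <= h -> 0 <= b <= h -> ball p r (p + a *: v + b *: w).
  move=> /andP[a0 ah] /andP[b0 bh]; rewrite -ball_normE /= -addrA opprD addNKr.
  rewrite normrN (le_lt_trans (ler_normD _ _))// !normrZ !ger0_norm//.
  rewrite (le_lt_trans _ hr)// mulrDr mulr1 mulrDr (@le_trans _ _ (h * `|v| + h * `|w|))//.
    by rewrite lerD// ler_wpM2r.
  by rewrite lerDl ltW.
pose F a := f (p + a *: v + h *: w) - f (p + a *: v).
pose F' a := 'D_v f (p + a *: v + h *: w) - 'D_v f (p + a *: v).
have hh : 0 <= h <= h by rewrite lexx ltW.
have z0 : 0 <= (0 : R) <= h by rewrite lexx ltW.
have dF a : 0 <= a <= h -> is_derive a (1 : R) F (F' a).
  move=> ah; apply: is_deriveB.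
    rewrite (_ : (fun a => _) = (fun a => f ((p + h *: w) + a *: v))); last first.
      by apply/funext => z; rewrite addrAC.
    apply: (proj1 (is_derive_line _ _ _ _ _)); rewrite addrAC.
    apply: derivableP; apply: (class_C_derivable Cf).
    by have [] := Hr _ (inb _ _ ah hh).
  apply: (proj1 (is_derive_line _ _ _ _ _)).
  apply: derivableP; apply: (class_C_derivable Cf).
  by have := Hr _ (inb _ _ ah z0); rewrite scale0r addr0 => -[].
have [a ah FE] : exists2 a, 0 <= a <= h & F h - F 0 = F' a * h.
  have [|a|a ah aE] := @MVT_segment R F F' 0 h (ltW h0).
  - move=> a; rewrite in_itv/= => /andP[a0 ah]; apply: dF; by rewrite !ltW.
  - by apply: derivable_within_continuous => z; rewrite in_itv/= => zh; apply: ex_derive; exact: dF.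
  - by exists a; [move: ah; rewrite in_itv|rewrite aE subr0].
pose G b := 'D_v f (p + a *: v + b *: w).
pose G' b := 'D_w (fun x => 'D_v f x) (p + a *: v + b *: w).
have dG b : 0 <= b <= h -> is_derive b (1 : R) G (G' b).
  move=> bh; apply: (proj1 (is_derive_line (fun x => 'D_v f x) _ _ _ _)).
  apply: derivableP; apply: (class_C_derivable Cvf).
  by have [] := Hr _ (inb _ _ ah bh).
have [b bh GE] : exists2 b, 0 <= b <= h & G h - G 0 = G' b * h.
  have [|b|b bh bE] := @MVT_segment R G G' 0 h (ltW h0).
  - move=> b; rewrite in_itv/= => /andP[b0 bh]; apply: dG; by rewrite !ltW.
  - by apply: derivable_within_continuous => z; rewrite in_itv/= => zh; apply: ex_derive; exact: dG.
  - by exists b; [move: bh; rewrite in_itv|rewrite bE subr0].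
have F'E : F' a = G' b * h by rewrite -GE /G /F' scale0r addr0.
have -> : f (p + h *: v + h *: w) - f (p + h *: v) - (f (p + h *: w) - f p) = G' b * h ^+ 2.
  by rewrite expr2 mulrA -F'E -FE /F scale0r addr0.
rewrite [h ^+ 2 * _]mulrC -mulrBl normrM [`|h ^+ 2|]ger0_norm ?sqr_ge0//.
rewrite ler_wpM2r ?sqr_ge0//.
by have [] := Hr _ (inb _ _ ah bh).
Unshelve. all: by end_near. Qed.

(** The second difference is symmetric in v and w, so both mixed derivatives
approximate it. *)
Lemma class_C_schwarz V (U : set V) (f : V -> R) (p v w : V) :
  open U -> U p -> (forall k, class_C k U f) ->
  'D_w (fun x => 'D_v f x) p = 'D_v (fun x => 'D_w f x) p.
Proof.
move=> oU Up Cf; apply/eqP; rewrite -subr_eq0 -normr_le0.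
apply/ler_addgt0Pl => e e0; rewrite addr0.
have e2 : 0 < e / 2 by rewrite divr_gt0.
have H1 := second_difference v w oU Up Cf e2.
have H2 := second_difference w v oU Up Cf e2.
have [h [[/= h0 A1] A2]] := filter_ex (filterI (filterI (nbhs_right_gt (0 : R)) H1) H2).
have {}A2 : `|f (p + h *: v + h *: w) - f (p + h *: v) - (f (p + h *: w) - f p)
      - h ^+ 2 * 'D_v (fun x => 'D_w f x) p| <= e / 2 * h ^+ 2.
  rewrite [p + h *: v + _]addrAC; move: A2; congr (`|_ - _| <= _); ring.
exact: (two_close (exprn_gt0 2 h0) A1 A2).
Qed.

End class_C.

Section class_C_space_time.
Context {R : realType} {n : nat}.
Local Notation e_ i := (delta_mx 0 i : 'rV[R]_n).

Lemma is_derive_space (W : normedModType R) (f : 'rV[R]_n * R -> W) q v d :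
  is_derive q (v, 0 : R) f d <-> is_derive q.1 v (fun z => f (z, q.2)) d.
Proof.
have E : (fun h : R => h^-1 *: (f (h *: (v, 0 : R) + q) - f q)) =
  (fun h : R => h^-1 *: (f (h *: v + q.1, q.2) - f (q.1, q.2))).
  apply/funext => h; congr (_ *: (f _ - f _)); case: q => //= x t.
  by congr (_, _); rewrite /= scaler0 add0r.
by split=> -[dx <-]; split; rewrite /derivable /derive ?E// -?E.
Qed.

Lemma is_derive_time (W : normedModType R) (f : 'rV[R]_n * R -> W) q d :
  is_derive q (0 : 'rV[R]_n, 1 : R) f d <->
  is_derive q.2 (1 : R) (fun s => f (q.1, s)) d.
Proof.
have E : (fun h : R => h^-1 *: (f (h *: (0 : 'rV[R]_n, 1 : R) + q) - f q)) =
  (fun h : R => h^-1 *: (f (q.1, h *: 1 + q.2) - f (q.1, q.2))).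
  apply/funext => h; congr (_ *: (f _ - f _)); case: q => //= x t.
  by congr (_, _); rewrite /= scaler0 add0r.
by split=> -[dx <-]; split; rewrite /derivable /derive ?E// -?E.
Qed.

(** Membership in class C^1 is stated with directional derivatives; continuity
of the partial derivatives upgrades it to Frechet differentiability, on which
the chain rule depends. *)
Lemma class_C_is_diff (U : set ('rV[R]_n * R)) (f : 'rV[R]_n * R -> R) q :
  open U -> U q -> (forall k, class_C k U f) ->
  is_diff q f (fun v => \sum_i v.1 0 i * 'D_(e_ i, 0 : R) f q +
                        v.2 * 'D_(0 : 'rV[R]_n, 1 : R) f q).
Proof.
move=> oU Uq Cf; case: q Uq => x t Uq.
have H := @is_diff_partial_prod R n f (fun i q => 'D_(e_ i, 0 : R) f q) x t
  (\row_i 'D_(e_ i, 0 : R) f (x, t)) ('D_(0 : 'rV[R]_n, 1 : R) f (x, t)).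
have {}H : is_diff (x, t) f (fun v : 'rV[R]_n * R => \sum_i v.1 0 i * (\row_i 'D_(e_ i, 0 : R) f (x, t)) 0 i + v.2 * ('D_(0 : 'rV[R]_n, 1 : R) f (x, t))).
  apply: H.
  - near=> q => i; apply/is_derive_space/derivableP/(class_C_derivable Cf).
    by near: q; exact: open_nbhs_nbhs.
  - move=> i; rewrite mxE; have := class_C_cont (class_C_derive (e_ i, 0 : R) Cf 0) Uq.
    by [].
  - by apply: (proj1 (is_derive_time f (x, t) _)); apply: derivableP; exact: (class_C_derivable Cf Uq).
apply: is_diff_eq; apply/funext => v; congr (_ + _).
by apply: eq_bigr => i _; rewrite mxE.
Unshelve. all: by end_near. Qed.

(** By the chain rule a directional derivative of the composite is a sum of
products of derivatives of f, composed with the same map, and derivatives of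
P, whence the induction on k. *)
Lemma class_C_comp (U U' : set ('rV[R]_n * R)) (f : 'rV[R]_n * R -> R)
    (P : 'rV[R]_n * R -> 'rV[R]_n) k :
  open U -> open U' -> (forall q, U q -> U' (P q, q.2)) ->
  (forall k, class_C k U' f) -> (forall k, class_C k U P) ->
  class_C k U (fun q => f (P q, q.2)).
Proof.
move=> oU oU' UU' + CP; elim: k f => [|k IH] f Cf.
all: have cfP x : U x -> {for x, continuous (fun q => f (P q, q.2))}.
1, 3: move=> Ux; apply: (@cvg_comp _ _ _ (fun q => (P q, q.2)) f _ (nbhs (P x, x.2))).
1, 3: by exact: (cvg_pair (class_C_cont (CP 0) Ux) cvg_snd).
1, 2: by apply: (class_C_cont (Cf 0)); exact: UU'.
  by [].
split=> // v.
have D x : U x -> is_derive x v (fun q => f (P q, q.2))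
    (\sum_i ('D_v P x) 0 i * 'D_(e_ i, 0 : R) f (P x, x.2) +
      v.2 * 'D_(0 : 'rV[R]_n, 1 : R) f (P x, x.2)).
  move=> Ux.
  have := class_C_is_diff oU' (UU' _ Ux) Cf.
  move=> [fd fE].
  pose c (h : R) := (P (x + h *: v), (x + h *: v).2).
  have dc : is_derive (0 : R) (1 : R) c ('D_v P x, v.2).
    have d1 : is_derive (0 : R) (1 : R) (fun h => P (x + h *: v)) ('D_v P x).
      apply: (proj1 (is_derive_line P x v 0 _)); rewrite scale0r addr0.
      by apply: derivableP; exact: class_C_derivable CP _.
    have d2 : is_derive (0 : R) (1 : R) (fun h => (x + h *: v).2) v.2.
      have -> : (fun h : R => (x + h *: v).2) = cst x.2 + id * cst v.2 by exact/funext.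
      have dd := is_deriveD (is_derive_cst x.2 (0 : R) (1 : R))
        (is_deriveM (is_derive_id (0 : R) (1 : R)) (is_derive_cst v.2 (0 : R) (1 : R))).
      apply: (is_derive_eq dd).
      by rewrite scaler0 add0r add0r /GRing.scale /= mulr1.
    have [e1 E1] := d1; have [e2 E2] := d2.
    move/derivable1_diffP in e1; move/derivable1_diffP in e2.
    have e3 : differentiable c 0 by exact: differentiable_pair.
    split; first exact/derivable1_diffP.
    by rewrite deriveE// diff_pair//= -!deriveE// E1 E2.
  have := is_derive_comp_diff dc.
  rewrite /c scale0r addr0 => /(_ f fd); rewrite fE /= => H.
  have := proj2 (is_derive_line (fun q => f (P q, q.2)) x v 0 _) H.
  by rewrite scale0r addr0.
split; first by move=> x /D[].
have : class_C k U (fun x => \sum_i ('D_v P x) 0 i * 'D_(e_ i, 0 : R) f (P x, x.2) +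
      v.2 * 'D_(0 : 'rV[R]_n, 1 : R) f (P x, x.2)).
  apply: class_CD => //.
    apply: class_C_sum => // i; apply: class_CM => //.
      by apply: class_C_coord => //; exact: class_C_derive.
    exact: (IH (fun y => 'D_(e_ i, 0 : R) f y) (class_C_derive _ Cf)).
  apply: class_CM => //; first exact: class_C_cst.
  exact: (IH (fun y => 'D_(0 : 'rV[R]_n, 1 : R) f y) (class_C_derive _ Cf)).
by apply: class_C_eq => // x /D[_ ->].
Qed.

End class_C_space_time.

(** * Functions smooth up to the edge of a space-time region *)

Definition partial {R : realType} {n : nat} (i : 'I_n)
    (f : space_time R n -> R) (p : space_time R n) : R :=
  'D_(delta_mx 0 i) (fun z => f (z, p.2)) p.1.

Definition time_derivative {R : realType} {n : nat} (T : R)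
    (f : space_time R n -> R) (p : space_time R n) : R :=
  derive_in `[0, T] (fun s => f (p.1, s)) p.2.

(** The functions used below are defined by the geometry on a closed region A,
but their partial derivatives can be computed only on the relatively open part
A0. A tame function agrees on A0, near every point of A, with a smooth
function: this passes to derivatives (tame_partial, tame_time), and implies
boundedness on A0 when A is compact. *)
Definition tame {R : realType} {n : nat} (A A0 : set (space_time R n))
    (f : space_time R n -> R) : Prop :=
  forall p, A p -> exists (U : set (space_time R n)) (h : space_time R n -> R),
    [/\ open U, U p, forall k, class_C k U h &
        forall q, U q -> A0 q -> h q = f q].

(** A0 is open in the slab 0 <= t <= T, so the time derivatives at t = 0 and t
= T are one-sided. *)
Record relatively_open_in {R : realType} {n : nat} (T : R)
    (A A0 : set (space_time R n)) : Prop := {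
  rop_T0 : 0 < T;
  rop_sub : A0 `<=` A;
  rop_time : forall p, A0 p -> 0 <= p.2 <= T;
  rop_open : forall p, A0 p -> \forall q \near p, 0 <= q.2 <= T -> A0 q
}.

Lemma cvg_slice {R : realType} {n : nat} (x : 'rV[R]_n) (s : R) :
  (z, s) @[z --> x] --> (x, s).
Proof.
move=> P [[P1 P2] /= [H1 H2] HP]; rewrite /nbhs /=; apply: filterS H1 => z Pz.
by apply: HP; split => //=; exact: nbhs_singleton.
Qed.

Section tame.
Context {R : realType} {n : nat} (T : R) (A A0 : set (space_time R n)).
Hypothesis AA : relatively_open_in T A A0.
Let T0 : 0 < T := rop_T0 AA.
Let A0A : A0 `<=` A := rop_sub AA.
Let A0T : forall p, A0 p -> 0 <= p.2 <= T := rop_time AA.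
Let A0open : forall p, A0 p -> \forall q \near p, 0 <= q.2 <= T -> A0 q := rop_open AA.
Local Notation e_ i := (delta_mx 0 i : 'rV[R]_n).
Local Notation Dt := (time_derivative T).
Local Notation tame := (tame A A0).
Implicit Types (f : space_time R n -> R) (p : space_time R n) (i : 'I_n).

(** At a point of A0 the smooth representative can be taken to agree with f on
a whole neighbourhood in the slab. *)
Lemma tame_local f p : tame f -> A0 p ->
  exists (U : set (space_time R n)) (h : space_time R n -> R),
    [/\ open U, U p, forall k, class_C k U h &
        forall q, U q -> 0 <= q.2 <= T -> A0 q /\ h q = f q].
Proof.
move=> tf Ap; have [U [h [oU Up Ch hf]]] := tf _ (A0A Ap).
pose B := interior [set q : space_time R n | 0 <= q.2 <= T -> A0 q].
have oB : open B by exact: open_interior.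
have Bp : B p by exact: A0open.
have BA : B `<=` [set q : space_time R n | 0 <= q.2 <= T -> A0 q].
  exact: interior_subset.
exists (U `&` B), h; split.
- exact: openI.
- by [].
- by move=> k; apply: class_C_sub (Ch k) => q [].
- move=> q [Uq Bq] qT; have Aq := BA _ Bq qT; split=> //; exact: hf.
Qed.

Lemma rop_near_space p : A0 p -> \forall z \near p.1, A0 (z, p.2).
Proof.
move=> Ap; have pT := A0T Ap; have /nbhs_ballP[r /= r0 Hr] := A0open Ap.
apply/nbhs_ballP; exists r => //= z zr; apply: (Hr (z, p.2)) => //.
by split => //=; exact: ballxx.
Qed.

Lemma rop_near_time p : A0 p ->
  \forall s \near within `[0, T] (nbhs p.2), A0 (p.1, s).
Proof.
move=> Ap; have /nbhs_ballP[r /= r0 Hr] := A0open Ap.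
rewrite /within /=; apply/nbhs_ballP; exists r => //= s sr sT.
apply: (Hr (p.1, s)); last by move: sT; rewrite in_itv.
by split => //=; exact: ballxx.
Qed.

Lemma local_partial (U : set (space_time R n)) (h f : space_time R n -> R) q i :
  open U -> (forall k, class_C k U h) ->
  (forall q, U q -> 0 <= q.2 <= T -> A0 q /\ h q = f q) ->
  U q -> 0 <= q.2 <= T ->
  is_derive q.1 (e_ i) (fun z => f (z, q.2)) ('D_(e_ i, 0 : R) h q).
Proof.
move=> oU Ch hf Uq qT.
have := proj1 (is_derive_space h q (e_ i) _)
  (derivableP (class_C_derivable (v := (e_ i, 0 : R)) Ch Uq)).
apply: near_eq_is_derive.
have : \forall z \near q.1, U (z, q.2).
  have /nbhs_ballP[r /= r0 Hr] := open_nbhs_nbhs (conj oU Uq).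
  apply/nbhs_ballP; exists r => //= z zr; apply: Hr; split => //=.
  exact: ballxx.
by apply: filterS => z Uz; have [] := hf _ Uz qT.
Qed.

(** The representative is smooth across t = 0 and t = T, so its full time
derivative is the one-sided derivative of f. *)
Lemma local_time (U : set (space_time R n)) (h f : space_time R n -> R) q :
  open U -> (forall k, class_C k U h) ->
  (forall q, U q -> 0 <= q.2 <= T -> A0 q /\ h q = f q) ->
  U q -> 0 <= q.2 <= T ->
  has_dq `[0, T] (fun s => f (q.1, s)) q.2 ('D_(0 : 'rV[R]_n, 1 : R) h q).
Proof.
move=> oU Ch hf Uq qT.
have := proj1 (is_derive_time h q _)
  (derivableP (class_C_derivable (v := (0 : 'rV[R]_n, 1 : R)) Ch Uq)).
move=> /(@is_derive_dq _ _ `[0, T]); apply: dq_near_eq.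
  by rewrite -!surjective_pairing; have [] := hf _ Uq qT.
near=> s.
have sT : 0 <= s <= T.
  have : (`[0, T]%classic : set R) s by near: s; exact: withinT.
  by rewrite /= in_itv.
suff Us : U (q.1, s) by have [] := hf _ Us sT.
near: s; apply: (@within_dnbhs_cvg R `[0, T] q.2).
have /nbhs_ballP[r /= r0 Hr] := open_nbhs_nbhs (conj oU Uq).
apply/nbhs_ballP; exists r => //= z zr; apply: Hr; split => //=.
exact: ballxx.
Unshelve. all: by end_near. Qed.

Lemma tame_is_derive f p i : tame f -> A0 p ->
  is_derive p.1 (e_ i) (fun z => f (z, p.2)) (partial i f p).
Proof.
move=> tf Ap; have [U [h [oU Up Ch hf]]] := tame_local tf Ap.
apply: derivableP.
by have [] := local_partial i oU Ch hf Up (A0T Ap).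
Qed.

Lemma local_partialE (U : set (space_time R n)) (h f : space_time R n -> R) q i :
  open U -> (forall k, class_C k U h) ->
  (forall q, U q -> 0 <= q.2 <= T -> A0 q /\ h q = f q) ->
  U q -> 0 <= q.2 <= T -> partial i f q = 'D_(e_ i, 0 : R) h q.
Proof.
by move=> oU Ch hf Uq qT; have [_ <-] := local_partial i oU Ch hf Uq qT.
Qed.

Lemma local_timeE (U : set (space_time R n)) (h f : space_time R n -> R) q :
  open U -> (forall k, class_C k U h) ->
  (forall q, U q -> 0 <= q.2 <= T -> A0 q /\ h q = f q) ->
  U q -> 0 <= q.2 <= T -> Dt f q = 'D_(0 : 'rV[R]_n, 1 : R) h q.
Proof.
move=> oU Ch hf Uq qT; apply: derive_in_val => //.
exact: local_time oU Ch hf Uq qT.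
Qed.

Lemma tame_dq f p : tame f -> A0 p ->
  has_dq `[0, T] (fun s => f (p.1, s)) p.2 (Dt f p).
Proof.
move=> tf Ap; have [U [h [oU Up Ch hf]]] := tame_local tf Ap.
rewrite (local_timeE oU Ch hf Up (A0T Ap)).
exact: local_time oU Ch hf Up (A0T Ap).
Qed.

(** Also at a point of A outside A0, a single smooth representative computes f
and all its first derivatives on the nearby part of A0. *)
Lemma tame_at f p : tame f -> A p ->
  exists (U : set (space_time R n)) (h : space_time R n -> R),
    [/\ open U, U p, forall k, class_C k U h &
        forall q, U q -> A0 q ->
          [/\ h q = f q, forall i, 'D_(e_ i, 0 : R) h q = partial i f q &
            'D_(0 : 'rV[R]_n, 1 : R) h q = Dt f q]].
Proof.
move=> tf Ap; have [U [h [oU Up Ch hf]]] := tf _ Ap.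
exists U, h; split => // q Uq Aq.
pose B := interior [set q : space_time R n | 0 <= q.2 <= T -> A0 q].
have oB : open B by exact: open_interior.
have Bq : B q by exact: A0open.
have BA : B `<=` [set q : space_time R n | 0 <= q.2 <= T -> A0 q].
  exact: interior_subset.
have oUB : open (U `&` B) by exact: openI.
have ChB k : class_C k (U `&` B) h by apply: class_C_sub (Ch k) => z [].
have hfB z : (U `&` B) z -> 0 <= z.2 <= T -> A0 z /\ h z = f z.
  by move=> [Uz Bz] zT; have Az := BA _ Bz zT; split => //; exact: hf.
have UBq : (U `&` B) q by [].
split; first exact: hf.
  by move=> i; rewrite (local_partialE i oUB ChB hfB UBq (A0T Aq)).
by rewrite (local_timeE oUB ChB hfB UBq (A0T Aq)).
Qed.

Lemma tame_partial i f : tame f -> tame (partial i f).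
Proof.
move=> tf p Ap; have [U [h [oU Up Ch hf]]] := tame_at tf Ap.
exists U, (fun q => 'D_(e_ i, 0 : R) h q); split => //.
  exact: class_C_derive.
by move=> q Uq Aq; have [_ + _] := hf q Uq Aq; apply.
Qed.

Lemma tame_time f : tame f -> tame (Dt f).
Proof.
move=> tf p Ap; have [U [h [oU Up Ch hf]]] := tame_at tf Ap.
exists U, (fun q => 'D_(0 : 'rV[R]_n, 1 : R) h q); split => //.
  exact: class_C_derive.
by move=> q Uq Aq; have [_ _] := hf q Uq Aq.
Qed.

(** Both sides are mixed derivatives of one smooth representative. *)
Lemma tame_partialC i j f p : tame f -> A0 p ->
  partial i (partial j f) p = partial j (partial i f) p.
Proof.
move=> tf Ap; have [U [h [oU Up Ch hf]]] := tame_local tf Ap.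
have pT := A0T Ap.
have E k q : U q -> 0 <= q.2 <= T ->
    A0 q /\ 'D_(e_ k, 0 : R) h q = partial k f q.
  move=> Uq qT; split; first by have [] := hf q Uq qT.
  by rewrite (local_partialE k oU Ch hf Uq qT).
rewrite (local_partialE i oU (class_C_derive _ Ch) (E j) Up pT).
rewrite (local_partialE j oU (class_C_derive _ Ch) (E i) Up pT).
exact: (class_C_schwarz _ _ oU Up Ch).
Qed.

(** Both sides are mixed derivatives of one smooth representative, also at the
end points of [0, T], where the time derivative of f is one-sided. *)
Lemma tame_timeC i f p : tame f -> A0 p ->
  partial i (Dt f) p = Dt (partial i f) p.
Proof.
move=> tf Ap; have [U [h [oU Up Ch hf]]] := tame_local tf Ap.
have pT := A0T Ap.
have E q : U q -> 0 <= q.2 <= T ->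
    A0 q /\ 'D_(e_ i, 0 : R) h q = partial i f q.
  move=> Uq qT; split; first by have [] := hf q Uq qT.
  by rewrite (local_partialE i oU Ch hf Uq qT).
have E' q : U q -> 0 <= q.2 <= T ->
    A0 q /\ 'D_(0 : 'rV[R]_n, 1 : R) h q = Dt f q.
  move=> Uq qT; split; first by have [] := hf q Uq qT.
  by rewrite (local_timeE oU Ch hf Uq qT).
rewrite (local_partialE i oU (class_C_derive _ Ch) E' Up pT).
rewrite (local_timeE oU (class_C_derive _ Ch) E Up pT).
exact: (class_C_schwarz _ _ oU Up Ch).
Qed.

Lemma tame_cvg f p : tame f -> A0 p ->
  f q @[q --> within [set q : 'rV[R]_n * R | (`[0, T]%classic : set R) q.2] (nbhs p)] --> f p.
Proof.
move=> tf Ap; have [U [h [oU Up Ch hf]]] := tame_local tf Ap.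
have [_ hp] := hf p Up (A0T Ap).
rewrite -hp; have ch := class_C_cont (Ch 0%N) Up.
apply: (@cvg_trans _ (h q @[q --> within [set q : 'rV[R]_n * R | (`[0, T]%classic : set R) q.2] (nbhs p)])).
  apply: near_eq_cvg; near=> q.
  have qT : (`[0, T]%classic : set R) q.2.
    near: q; exact: (@withinT _ (nbhs p) [set q : 'rV[R]_n * R | (`[0, T]%classic : set R) q.2]).
  have Uq : U q by near: q; apply: cvg_within; exact: open_nbhs_nbhs.
  by have [] := hf q Uq _; move: qT; rewrite //= in_itv.
by apply: cvg_trans ch; apply: cvg_app; exact: cvg_within.
Unshelve. all: by end_near. Qed.

Lemma tame_slice_diff f p : tame f -> A0 p ->
  is_diff (p.1) (fun z => f (z, p.2)) (fun v => \sum_i v 0 i * partial i f p).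
Proof.
move=> tf Ap; have [U [h [oU Up Ch hf]]] := tame_local tf Ap.
have pT := A0T Ap.
have nU : \forall z \near p.1, U (z, p.2).
  have /nbhs_ballP[r /= r0 Hr] := open_nbhs_nbhs (conj oU Up).
  apply/nbhs_ballP; exists r => //= z zr; apply: Hr; split => //=.
  exact: ballxx.
have H := @is_diff_partial R n (fun z => f (z, p.2))
  (fun i z => partial i f (z, p.2)) p.1 (\row_i partial i f p).
have {}H : is_diff (p.1) (fun z => f (z, p.2)) (fun v : 'rV[R]_n => \sum_i v 0 i * (\row_i partial i f p) 0 i).
  apply: H.
    near=> z => i.
    have Uz : U (z, p.2) by near: z.
    by apply: (@tame_is_derive f (z, p.2) i tf); have [] := hf _ Uz pT.
  move=> i; rewrite mxE.
  have tip := tame_cvg (tame_partial i tf) Ap.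
  have c : (z, p.2) @[z --> p.1] --> within [set q : 'rV[R]_n * R | (`[0, T]%classic : set R) q.2] (nbhs p).
    have c0 : (z, p.2) @[z --> p.1] --> nbhs p.
      by case: (p) => x s; exact: cvg_slice.
    move=> P /c0; apply: (@filterS _ (nbhs p.1)) => z; apply; by rewrite /= in_itv.
  exact: (cvg_comp _ _ c tip).
apply: is_diff_eq; apply/funext => v.
by apply: eq_bigr => i _; rewrite mxE.
Unshelve. all: by end_near. Qed.

Lemma tame_curve f (xi : R -> 'rV[R]_n) t v : tame f -> A0 (xi t, t) ->
  has_dq `[0, T] xi t v ->
  has_dq `[0, T] (fun s => f (xi s, s)) t
    (Dt f (xi t, t) + \sum_i v 0 i * partial i f (xi t, t)).
Proof.
move=> tf Ap xiv.
have := @dq_curve R n `[0, T] f (fun i q => partial i f q) xi t v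
  (\row_i partial i f (xi t, t)) (Dt f (xi t, t)).
rewrite (eq_bigr (fun i => v 0 i * partial i f (xi t, t))); last first.
  by move=> i _; rewrite mxE.
apply => //.
- rewrite /within /=; have := A0open Ap; apply: filterS => q Aq qT i.
  by apply: tame_is_derive => //; apply: Aq; move: qT; rewrite in_itv.
- by move=> i; rewrite mxE; exact: tame_cvg (tame_partial i tf) Ap.
- exact: (tame_dq tf Ap).
Qed.

End tame.

(** * Euclidean norm and signed distance *)

Section euclidean.
Context {R : realType} {n : nat}.
Implicit Types (u v w : 'rV[R]_n).

Lemma dotC u v : dot u v = dot v u.
Proof. by apply: eq_bigr => i _; rewrite mulrC. Qed.

Lemma dotDl u v w : dot (u + v) w = dot u w + dot v w.
Proof. by rewrite -big_split /=; apply: eq_bigr => i _; rewrite mxE mulrDl. Qed.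

Lemma dotZl k u v : dot (k *: u) v = k * dot u v.
Proof. by rewrite mulr_sumr; apply: eq_bigr => i _; rewrite mxE mulrA. Qed.

Lemma dotDr u v w : dot u (v + w) = dot u v + dot u w.
Proof. by rewrite dotC dotDl !(dotC u). Qed.

Lemma dotZr k u v : dot u (k *: v) = k * dot u v.
Proof. by rewrite dotC dotZl dotC. Qed.

Lemma dotNl u v : dot (- u) v = - dot u v.
Proof. by rewrite -scaleN1r dotZl mulN1r. Qed.

Lemma dotNr u v : dot u (- v) = - dot u v.
Proof. by rewrite dotC dotNl dotC. Qed.

Lemma dotBl u v w : dot (u - v) w = dot u w - dot v w.
Proof. by rewrite dotDl dotNl. Qed.

Lemma dotBr u v w : dot u (v - w) = dot u v - dot u w.
Proof. by rewrite dotDr dotNr. Qed.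

Lemma dot_ge0 u : 0 <= dot u u.
Proof. by apply: sumr_ge0 => i _; rewrite -expr2 sqr_ge0. Qed.

Lemma dot_eq0 u : dot u u = 0 -> u = 0.
Proof.
move=> /eqP; rewrite psumr_eq0 => [/allP H|i _]; last by rewrite -expr2 sqr_ge0.
apply/rowP => i; rewrite mxE; have := H i (mem_index_enum i).
by rewrite implyTb -expr2 sqrf_eq0 => /eqP.
Qed.

Lemma enorm_ge0 u : 0 <= enorm u. Proof. exact: sqrtr_ge0. Qed.

Lemma enorm_sqr u : enorm u ^+ 2 = dot u u.
Proof. by rewrite sqr_sqrtr// dot_ge0. Qed.

Lemma dot_unit u : enorm u = 1 -> dot u u = 1.
Proof. by rewrite -enorm_sqr => ->; rewrite expr1n. Qed.

Lemma enormZ k u : enorm (k *: u) = `|k| * enorm u.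
Proof.
by rewrite /enorm dotZl dotZr mulrA -expr2 sqrtrM ?sqr_ge0// sqrtr_sqr.
Qed.

(** The square norm of (v.v) u - (u.v) v is nonnegative. *)
Lemma cauchy_schwarz u v : dot u v ^+ 2 <= dot u u * dot v v.
Proof.
have [v0|v0] := eqVneq (dot v v) 0.
  by rewrite (dot_eq0 v0) -(scale0r 0) !dotZr !mul0r mulr0 expr0n.
have vp : 0 < dot v v by rewrite lt_def v0 dot_ge0.
have := dot_ge0 (dot v v *: u - dot u v *: v).
rewrite dotBl !dotBr !dotZl !dotZr (dotC v u).
rewrite (_ : _ - _ = dot v v * (dot u u * dot v v - dot u v ^+ 2)); last by ring.
by rewrite pmulr_rge0// subr_ge0.
Qed.

Lemma enormD u v : enorm (u + v) <= enorm u + enorm v.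
Proof.
rewrite -(ler_pXn2r (n := 2))// ?nnegrE ?addr_ge0 ?enorm_ge0//.
rewrite sqrrD !enorm_sqr dotDl !dotDr (dotC v u).
have : dot u v <= enorm u * enorm v.
  apply: (le_trans (ler_norm _)).
  rewrite -(ler_pXn2r (n := 2))// ?nnegrE ?mulr_ge0 ?enorm_ge0//.
  by rewrite exprMn !enorm_sqr real_normK ?num_real// cauchy_schwarz.
by move: (dot u v) (dot u u) (dot v v) (enorm u * enorm v) => a b c e; lra.
Qed.

Lemma enorm_cvg (T : Type) (F : set_system T) (FF : Filter F) (f : T -> 'rV[R]_n) u :
  f x @[x --> F] --> u -> enorm (f x) @[x --> F] --> enorm u.
Proof.
move=> fu; apply: (@cvg_comp _ _ _ (fun x => dot (f x) (f x)) Num.sqrt F (nbhs (dot u u))).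
  apply: cvg_sum_ord => i.
  have fi : f x 0 i @[x --> F] --> u 0 i by exact: (cvg_comp _ _ fu (@coord_continuous R 1 n 0 i u)).
  exact: cvgM.
exact: sqrt_continuous.
Qed.

Lemma sdist_abs (M : set 'rV[R]_n) x : M !=set0 ->
  `|sdist M x| = inf [set enorm (x - y) | y in M].
Proof.
move=> [y My].
have i0 : 0 <= inf [set enorm (x - y) | y in M].
  apply: lb_le_inf; first by exists (enorm (x - y)); exists y.
  by move=> _ [z _ <-]; exact: enorm_ge0.
by rewrite /sdist; case: asboolP => _ /=; [rewrite normrN|]; exact: ger0_norm.
Qed.

Lemma sdist_le (M : set 'rV[R]_n) x y : M y -> `|sdist M x| <= enorm (x - y).
Proof.
move=> My; have lb : has_lbound [set enorm (x - y) | y in M].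
  by exists 0 => _ [z _ <-]; exact: enorm_ge0.
rewrite sdist_abs; last by exists y.
by apply: ge_inf => //; exists y.
Qed.

(** The infimum need not be known to be attained: a point of M closer than r
is all that is used. *)
Lemma sdist_lt (M : set 'rV[R]_n) x r : M !=set0 -> `|sdist M x| < r ->
  exists2 y, M y & enorm (x - y) < r.
Proof.
move=> M0 xr; rewrite (sdist_abs _ M0) in xr; case: M0 => y0 My0.
have [|_ [y My <-] yr] := inf_lt _ xr.
  by exists (enorm (x - y0)); exists y0.
by exists y.
Qed.

End euclidean.

(** * Derivatives in coordinates *)

Section row_derivative.
Context {R : realType} {n : nat}.
Local Notation e_ i := (delta_mx 0 i : 'rV[R]_n).

Lemma is_derive_row (f : R -> 'rV[R]_n) (s : R) (a : 'I_n -> R) :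
  (forall i, is_derive s (1 : R) (fun s => f s 0 i) (a i)) ->
  is_derive s (1 : R) f (\row_i a i).
Proof.
move=> H; have df : derivable f s 1.
  by apply/derivable_mxP => i j; rewrite ord1; have [] := H j.
split => //; rewrite derive_mx//; apply/rowP => i; rewrite !mxE.
by have [_ ->] := H i.
Qed.

Lemma dq_row (I : set R) (f : 'I_n -> R -> R) t (a : 'I_n -> R) :
  (forall i, has_dq I (f i) t (a i)) ->
  has_dq I (fun s => \row_i f i s) t (\row_i a i).
Proof.
move=> H; have FF : Filter (within I (dnbhs t)) by exact: within_filter.
have H2 := @cvg_row R n R (within I (dnbhs t)) FF
  (fun i s => (s - t)^-1 *: (f i s - f i t)) a H.
rewrite /has_dq /diff_quotient; apply: cvg_trans H2; apply: near_eq_cvg.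
by near=> s; apply/rowP => i; rewrite !mxE.
Unshelve. all: by end_near. Qed.

Lemma diff_coord_sum (h : 'rV[R]_n -> R) y v : differentiable h y ->
  'd h y v = \sum_i v 0 i * 'D_(e_ i) h y.
Proof.
move=> dh; rewrite {1}(row_sum_delta v) linear_sum; apply: eq_bigr => i _.
by rewrite linearZ /= -deriveE.
Qed.

(** The projected gradient removes from grad h its component along nu; the
extension h is kept because the surface values alone do not determine grad h.
*)
Lemma tgradE (M : set 'rV[R]_n) (nu : 'rV[R]_n -> 'rV[R]_n) eta y G :
  is_tgrad M nu eta y G -> exists h : 'rV[R]_n -> R,
  [/\ \forall z \near y, M z -> h z = eta z, differentiable h y &
    forall j, G 0 j = 'D_(e_ j) h y -
       (\sum_i 'D_(e_ i) h y * nu y 0 i) * nu y 0 j].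
Proof.
move=> [h [hE dh ->]]; exists h; split => // j.
rewrite /tangential_projection mulmxBr mulmx1 mulmxA mxE; congr (_ + _).
  by rewrite mxE.
rewrite mxE; congr (- _); rewrite mxE big_ord1 !mxE; congr (_ * _).
by apply: eq_bigr => i _; rewrite !mxE.
Qed.

End row_derivative.

(** E exp(- C s) is nonincreasing and starts at 0. *)
Lemma gronwall_zero {R : realType} (E E' : R -> R) (C a : R) :
  0 <= a -> (forall s, 0 <= s <= a -> is_derive s (1 : R) E (E' s)) ->
  (forall s, 0 <= s <= a -> E' s <= C * E s) -> 0 <= E a -> E 0 = 0 -> E a = 0.
Proof.
move=> a0 dE EC Ea E0.
pose F s := E s * expR (- C * s).
pose F' s := E s * (expR (- C * s) * - C) + expR (- C * s) * E' s.
have dF s : 0 <= s <= a -> is_derive s (1 : R) F (F' s).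
  move=> sa; have d1 := dE s sa.
  have d2 : is_derive s (1 : R) (fun s => - C * s) (- C).
    have := is_deriveM (is_derive_cst (- C) s (1 : R)) (is_derive_id s (1 : R)).
    rewrite /= scaler0 addr0 /GRing.scale /= mulr1; exact.
  have d3 := is_derive1_comp (is_derive_expR (- C * s)) d2.
  by have := is_deriveM d1 d3.
have [||s sa FE] := @MVT_segment R F F' 0 a a0.
- move=> s; rewrite in_itv/= => /andP[s0 sa]; apply: dF; by rewrite !ltW.
- apply: derivable_within_continuous => s; rewrite in_itv/= => sa; apply: ex_derive; exact: dF.
rewrite in_itv /= in sa.
have : F a <= 0.
  have -> : F a = F' s * a by move: FE; rewrite /F E0 mul0r !subr0.
  rewrite mulr_le0_ge0// /F' (_ : _ + _ = expR (- C * s) * (E' s - C * E s)); last by ring.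
  by rewrite mulr_ge0_le0 ?expR_ge0// subr_le0 EC.
rewrite /F pmulr_lle0 ?expR_gt0// => Ea0.
by apply/eqP; rewrite eq_le Ea0.
Qed.

(** * Second order jets at a maximum *)

Section second_order_jets.
Context {R : realType}.
Implicit Types (F G : R -> R).

(** The derivative is assumed on the open side only, with a limit of F at the
end point, since this is applied at boundary points of a domain on which F is
merely continuous. *)
Lemma increase_right F F1 (r : R) : 0 < r ->
  (forall s, 0 < s < r -> is_derive s (1 : R) F (F1 s)) ->
  F s @[s --> (0 : R)^'+] --> F 0 ->
  (forall s, 0 < s < r -> 0 < F1 s) -> forall s, 0 < s < r -> F 0 < F s.
Proof.
move=> r0 dF cF F1p s /andP[s0 sr].
have dF' x : x \in `]0, s[ -> is_derive x (1 : R) F (F1 x).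
  by rewrite in_itv /= => /andP[x0 xs]; apply: dF; rewrite x0 (lt_trans xs).
have dc x : 0 < x < r -> {for x, continuous F}.
  move=> xr; apply: differentiable_continuous; apply/derivable1_diffP.
  by have [] := dF x xr.
have cts : {within `[0, s], continuous F}.
  apply/continuous_within_itvP => //; split => //.
    by move=> x; rewrite in_itv /= => /andP[x0 xs]; apply: dc; rewrite x0 (lt_trans xs).
  apply: cvg_at_left_filter; apply: dc; by rewrite s0.
have [z] := MVT s0 dF' cts; rewrite in_itv /= => /andP[z0 zs] E.
rewrite -subr_gt0 E mulr_gt0 ?subr_gt0//; apply: F1p.
by rewrite z0 (lt_trans zs).
Qed.

Lemma right_quotient F b : is_derive (0 : R) (1 : R) F b ->
  s^-1 * (F s - F 0) @[s --> (0 : R)^'+] --> b.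
Proof.
move=> [fd <-].
have H : (fun h : R => h^-1 *: (F (h *: (1 : R) + 0) - F 0)) @ 0^' --> 'D_1 F 0 by exact: fd.
have H2 : (fun h : R => h^-1 *: (F (h *: (1 : R) + 0) - F 0)) @ 0^'+ --> 'D_1 F 0.
  exact: cvg_dnbhs_at_right.
apply: cvg_trans H2; apply: near_eq_cvg; near=> s.
by rewrite addr0 /GRing.scale /= mulr1.
Unshelve. all: by end_near. Qed.

(** The 2-jet of F at 0, without continuity of the second derivative. *)
Definition jet2 F (b c : R) : Prop :=
  exists F1 : R -> R, [/\ \forall s \near (0 : R), is_derive s (1 : R) F (F1 s),
    F1 0 = b & is_derive (0 : R) (1 : R) F1 c].

Lemma jet2_near F G b c : (\forall s \near (0 : R), F s = G s) ->
  jet2 F b c -> jet2 G b c.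
Proof.
move=> /nbhs_interior FG [F1 [dF F1b dF1]]; exists F1; split => //.
near=> s; have dFs : is_derive s (1 : R) F (F1 s) by near: s.
apply: near_eq_is_derive dFs.
have : [set s | F s = G s]^° s by near: s.
by [].
Unshelve. all: by end_near. Qed.

Lemma jet2_cst (a : R) : jet2 (fun=> a) 0 0.
Proof.
exists (fun=> 0); split => //; last exact: is_derive_cst.
by near=> s; exact: is_derive_cst.
Unshelve. all: by end_near. Qed.

Lemma jet2D F G b c b' c' : jet2 F b c -> jet2 G b' c' ->
  jet2 (fun s => F s + G s) (b + b') (c + c').
Proof.
move=> [F1 [dF <- dF1]] [G1 [dG <- dG1]]; exists (fun s => F1 s + G1 s); split => //.
  near=> s; apply: is_deriveD; by near: s.
exact: is_deriveD.
Unshelve. all: by end_near. Qed.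

Lemma jet2M F G b c b' c' : jet2 F b c -> jet2 G b' c' ->
  jet2 (fun s => F s * G s) (F 0 * b' + b * G 0)
    (F 0 * c' + 2 * (b * b') + c * G 0).
Proof.
move=> [F1 [dF <- dF1]] [G1 [dG <- dG1]].
have dF0 := nbhs_singleton dF; have dG0 := nbhs_singleton dG.
exists (fun s => F s * G1 s + F1 s * G s); split => //.
  near=> s.
  have h1 : is_derive s (1 : R) F (F1 s) by near: s.
  have h2 : is_derive s (1 : R) G (G1 s) by near: s.
  by apply: (is_derive_eq (is_deriveM h1 h2)); rewrite /GRing.scale /=; ring.
apply: (is_derive_eq (is_deriveD (is_deriveM dF0 dG1) (is_deriveM dF1 dG0))).
by rewrite /GRing.scale /=; ring.
Unshelve. all: by end_near. Qed.

Lemma jet2_expR F b c : jet2 F b c ->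
  jet2 (fun s => expR (F s)) (expR (F 0) * b) (expR (F 0) * (c + b ^+ 2)).
Proof.
move=> [F1 [dF <- dF1]]; have dF0 := nbhs_singleton dF.
have dE s : is_derive s (1 : R) F (F1 s) ->
    is_derive s (1 : R) (fun s => expR (F s)) (expR (F s) * F1 s).
  move=> h; apply: (is_derive_eq (is_derive1_comp (is_derive_expR (F s)) h)).
  by rewrite /GRing.scale /= mulrC.
exists (fun s => expR (F s) * F1 s); split => //.
  near=> s; apply: dE; by near: s.
apply: (is_derive_eq (is_deriveM (dE _ dF0) dF1)).
by rewrite /GRing.scale /=; ring.
Unshelve. all: by end_near. Qed.

(** If c > 0, then the derivative F1, which vanishes at 0, is positive just to
the right, so F increases beyond its maximum. *)
Lemma jet2_max F b c : jet2 F b c -> (\forall s \near (0 : R), F s <= F 0) ->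
  b = 0 /\ c <= 0.
Proof.
move=> [F1 [dF F1b dF1]] Fm; have dF0 := nbhs_singleton dF.
have nH : \forall s \near (0 : R), is_derive s (1 : R) F (F1 s) /\ F s <= F 0.
  exact: filterI.
move: nH => /nbhs_ballP[r /= r0 H].
have Hr s : s \in `]- r, r[ -> is_derive s (1 : R) F (F1 s) /\ F s <= F 0.
  rewrite in_itv /= -ltr_norml => sr; apply: H.
  by rewrite /ball /= sub0r normrN.
have b0 : b = 0.
  rewrite -F1b; have [_ <-] := dF0.
  suff [_ ->] : is_derive (0 : R) (1 : R) F 0 by [].
  apply: (@derive1_at_max _ F (- r) r) => //.
  - by rewrite ge0_cp// ltW.
  - by move=> t /Hr[[]].
  - by rewrite in_itv /= oppr_lt0 r0.
  - by move=> t /Hr[].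
split=> //; rewrite leNgt; apply/negP => c0.
have n1 : \forall s \near (0 : R)^'+, 0 < s^-1 * (F1 s - F1 0).
  exact: (cvgr_gt _ (right_quotient dF1)).
move: n1; rewrite F1b b0 near_withinE => /nbhs_ballP[r' /= r'0 H'].
pose m := Num.min r r'.
have m0 : 0 < m by rewrite lt_min r0.
have mr s : 0 < s < m -> s \in `]- r, r[.
  rewrite in_itv /= lt_min => /andP[s0 /andP[sr _]].
  by rewrite sr andbT (lt_trans _ s0)// oppr_lt0.
have cF : F s @[s --> (0 : R)^'+] --> F 0.
  apply: cvg_at_right_filter; apply: differentiable_continuous.
  by apply/derivable1_diffP; have [] := dF0.
have hm : 0 < m / 2 < m by rewrite divr_gt0//= ltr_pdivrMr// ltr_pMr ?ltr1n.
have F1p s : 0 < s < m -> 0 < F1 s.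
  move=> /andP[s0 sm]; have := H' s; rewrite /ball /= sub0r normrN gtr0_norm//.
  move: (sm); rewrite lt_min => /andP[_ sr'] /(_ sr' s0).
  by rewrite subr0 pmulr_rgt0// invr_gt0.
have := increase_right m0 (fun s sm => (Hr _ (mr s sm)).1) cF F1p hm.
by rewrite ltNge; have [_ ->] := Hr _ (mr _ hm).
Qed.

End second_order_jets.

(** * Parabolic jets along a curve *)

Section parabolic_jets.
Context {R : realType} {n : nat}.
Variables (T : R) (xi : R -> 'rV[R]_n) (v : 'rV[R]_n) (p : space_time R n).
Hypotheses (xip : xi p.2 = p.1).
Local Notation e_ i := (delta_mx 0 i : 'rV[R]_n).
Implicit Types (f g : space_time R n -> R).

(** Values at p of the first (a1) and pure second (a2) space derivatives and
of the time derivative (a3) of f. The time derivative is defined through the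
derivative along the curve xi of velocity v, by subtracting the transport
term, so that it makes sense for functions that are differentiable in time
only along xi; for a smooth function it is the usual partial derivative. *)
Definition pjet f a1 a2 a3 : Prop :=
  (forall i, jet2 (fun s => f (p.1 + s *: e_ i, p.2)) (a1 i) (a2 i)) /\
  has_dq `[0, T] (fun s => f (xi s, s)) p.2 (a3 + \sum_i v 0 i * a1 i).

Lemma pjet_ext f a1 a2 a3 b1 b2 b3 : pjet f a1 a2 a3 ->
  a1 =1 b1 -> a2 =1 b2 -> a3 = b3 -> pjet f b1 b2 b3.
Proof.
move=> [H1 H2] E1 E2 E3; split; first by move=> i; rewrite -E1 -E2.
by rewrite -E3; under eq_bigr do rewrite -E1.
Qed.

Lemma pjet_fun_ext f g a1 a2 a3 : (forall q, f q = g q) -> pjet f a1 a2 a3 -> pjet g a1 a2 a3.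
Proof. by move=> /funext ->. Qed.

Lemma pjet_cst (a : R) : pjet (fun=> a) (fun=> 0) (fun=> 0) 0.
Proof.
split; first by move=> i; exact: jet2_cst.
rewrite big1 ?addr0; last by move=> i _; rewrite mulr0.
exact: (@dq_cst R R).
Qed.

Lemma pjet_time (f : R -> R) a3 : has_dq `[0, T] f p.2 a3 ->
  pjet (fun q => f q.2) (fun=> 0) (fun=> 0) a3.
Proof.
move=> H; split; first by move=> i; exact: (jet2_cst (f p.2)).
by rewrite big1 ?addr0// => i _; rewrite mulr0.
Qed.

Lemma pjetD f g a1 a2 a3 b1 b2 b3 : pjet f a1 a2 a3 -> pjet g b1 b2 b3 ->
  pjet (fun q => f q + g q) (fun i => a1 i + b1 i) (fun i => a2 i + b2 i) (a3 + b3).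
Proof.
move=> [Hf Hf'] [Hg Hg']; split; first by move=> i; exact: jet2D.
rewrite (eq_bigr (fun i => v 0 i * a1 i + v 0 i * b1 i)); last by move=> i _; rewrite mulrDr.
by rewrite big_split /= addrACA; exact: dqD.
Qed.

Lemma pjetM f g a1 a2 a3 b1 b2 b3 : pjet f a1 a2 a3 -> pjet g b1 b2 b3 ->
  pjet (fun q => f q * g q) (fun i => f p * b1 i + a1 i * g p)
   (fun i => f p * b2 i + 2 * (a1 i * b1 i) + a2 i * g p) (f p * b3 + a3 * g p).
Proof.
have p0 i : (p.1 + (0 : R) *: e_ i, p.2) = p by rewrite scale0r addr0 -surjective_pairing.
move=> [Hf Hf'] [Hg Hg']; split.
  by move=> i; have := jet2M (Hf i) (Hg i); rewrite p0.
have := dqM Hf' Hg'; rewrite xip -surjective_pairing.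
have -> : \sum_i v 0 i * (f p * b1 i + a1 i * g p) =
    f p * (\sum_i v 0 i * b1 i) + g p * (\sum_i v 0 i * a1 i).
  by rewrite !mulr_sumr -big_split /=; apply: eq_bigr => i _; ring.
by congr (has_dq _ _ _ _); ring.
Qed.

Lemma pjetZ (a : R) f a1 a2 a3 : pjet f a1 a2 a3 ->
  pjet (fun q => a * f q) (fun i => a * a1 i) (fun i => a * a2 i) (a * a3).
Proof.
move=> H; apply: (pjet_ext (pjetM (pjet_cst a) H)) => [i|i|]; by rewrite ?mul0r ?mulr0 ?addr0.
Qed.

Lemma pjetB f g a1 a2 a3 b1 b2 b3 : pjet f a1 a2 a3 -> pjet g b1 b2 b3 ->
  pjet (fun q => f q - g q) (fun i => a1 i - b1 i) (fun i => a2 i - b2 i) (a3 - b3).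
Proof.
move=> Hf /(pjetZ (-1)) Hg; have H := pjetD Hf Hg.
apply: (pjet_fun_ext (f := fun q => f q + -1 * g q)); first by move=> q; rewrite mulN1r.
by apply: (pjet_ext H) => [i|i|]; rewrite mulN1r.
Qed.

Lemma pjet_expR f a1 a2 a3 : pjet f a1 a2 a3 ->
  pjet (fun q => expR (f q)) (fun i => expR (f p) * a1 i)
   (fun i => expR (f p) * (a2 i + a1 i ^+ 2)) (expR (f p) * a3).
Proof.
have p0 i : (p.1 + (0 : R) *: e_ i, p.2) = p by rewrite scale0r addr0 -surjective_pairing.
move=> [Hf Hf']; split.
  by move=> i; have := jet2_expR (Hf i); rewrite p0.
have := dq_comp Hf' (is_derive_expR _); rewrite xip -surjective_pairing /comp.
have -> : \sum_i v 0 i * (expR (f p) * a1 i) = expR (f p) * (\sum_i v 0 i * a1 i).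
  by rewrite mulr_sumr; apply: eq_bigr => i _; ring.
by rewrite -mulrDr mulrC.
Qed.

(** As a1 = 0 at a maximum, the transport term vanishes and a3 is the
derivative along the curve. *)
Lemma pjet_max f a1 a2 a3 : 0 < p.2 <= T -> pjet f a1 a2 a3 ->
  (forall i, \forall s \near (0 : R), f (p.1 + s *: e_ i, p.2) <= f p) ->
  (\forall s \near within `[0, T] (nbhs p.2), f (xi s, s) <= f p) ->
  [/\ forall i, a1 i = 0, forall i, a2 i <= 0 & 0 <= a3].
Proof.
move=> pT [H1 H2] m1 m2.
have H i : a1 i = 0 /\ a2 i <= 0.
  apply: (jet2_max (H1 i)); have := m1 i.
  by rewrite scale0r addr0 -surjective_pairing.
split => [i|i|]; try by have [] := H i.
have := dq_ge0 pT H2; rewrite xip -surjective_pairing => /(_ m2).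
by rewrite big1 ?addr0// => i _; have [-> _] := H i; rewrite mulr0.
Qed.

End parabolic_jets.

(** * Conjugation and comparison at a maximum *)

Section comparison_at_maximum.
Context {R : realType} {n : nat}.
Variables (T : R) (xi : R -> 'rV[R]_n) (v : 'rV[R]_n) (p : space_time R n) (k : R).
Hypotheses (xip : xi p.2 = p.1) (k0 : 0 < k) (pT : 0 < p.2 <= T).
Local Notation e_ i := (delta_mx 0 i : 'rV[R]_n).
Local Notation pjet := (pjet T xi v p).

(** The zeroth order coefficient created by conjugating the heat operator with
exp (phi / k), in terms of the first and second space derivatives u1, u2 and
the time derivative u3 of phi. *)
Definition weight_potential (u1 u2 : 'I_n -> R) (u3 : R) : R :=
  \sum_i u2 i - (\sum_i u1 i ^+ 2) / k - u3 / k.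

(** The operator d_t - k Lap + 2 grad phi . grad + c evaluated on a jet. *)
Definition jet_operator (u1 : 'I_n -> R) (c : R) (a : R) (a1 a2 : 'I_n -> R) (a3 : R) : R :=
  a3 - k * (\sum_i a2 i) + 2 * (\sum_i u1 i * a1 i) + c * a.

(** Leibniz rule for rho exp (phi / k): the cross terms of the Laplacian give
the drift 2 grad phi, and the remaining ones the potential. *)
Lemma conjugated_jet rho phi r1 r2 r3 u1 u2 u3 :
  pjet rho r1 r2 r3 -> pjet phi u1 u2 u3 ->
  exists z1 z2 z3, pjet (fun q => rho q * expR (phi q / k)) z1 z2 z3 /\
    jet_operator u1 (weight_potential u1 u2 u3) (rho p * expR (phi p / k)) z1 z2 z3 =
    expR (phi p / k) * (r3 - k * \sum_i r2 i).
Proof.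
move=> Hr Hu.
have Hu' : pjet (fun q => phi q / k) (fun i => k^-1 * u1 i) (fun i => k^-1 * u2 i) (k^-1 * u3).
  by apply: pjet_fun_ext (pjetZ xip k^-1 Hu) => q; rewrite mulrC.
have HZ := pjetM xip Hr (pjet_expR xip Hu').
do 3!eexists; split; first exact: HZ.
rewrite /jet_operator /weight_potential.
set E := expR _; set a := rho p.
have kn : k != 0 by rewrite gt_eqF.
pose A := \sum_i r2 i; pose B := \sum_i u2 i; pose C := \sum_i u1 i ^+ 2; pose D := \sum_i u1 i * r1 i.
have -> : \sum_i u1 i * (a * (E * (k^-1 * u1 i)) + r1 i * E) = E * D + a * (E * (k^-1 * C)).
  rewrite /C /D !mulr_sumr -!big_split /=; apply: eq_bigr => i _.
  by move: (r2 i) (u2 i) (u1 i) (r1 i) => x1 x2 x3 x4; ring.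
rewrite [X in k * X](_ : _ = E * A + 2 * (E * (k^-1 * D)) + a * (E * (k^-1 * B)) + a * (E * (k^-1 ^+ 2 * C))); last first.
  rewrite /A /B /C /D !mulr_sumr -!big_split /=; apply: eq_bigr => i _.
  by move: (r2 i) (u2 i) (u1 i) (r1 i) => x1 x2 x3 x4; ring.
rewrite -/A -/B -/C.
by move: (A) (B) (C) (D) (E) (a) => x1 x2 x3 x4 x5 x6; field.
Qed.

(** At a maximum of F the gradient terms cancel up to that of beta, the
Laplacian of F is nonpositive and its time derivative nonnegative; the
exponential factor in time contributes lam. *)
Lemma max_inequality rho phi y beta r1 r2 r3 u1 u2 u3 y1 y2 y3 w1 w2 w3
    (lam sg kap f : R) :
  let c := weight_potential u1 u2 u3 in
  let F q := expR (- lam * q.2) * (sg * (rho q * expR (phi q / k) - y q)) - kap * beta q in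
  pjet rho r1 r2 r3 -> pjet phi u1 u2 u3 -> pjet y y1 y2 y3 -> pjet beta w1 w2 w3 ->
  r3 - k * (\sum_i r2 i) = f ->
  (forall i, \forall s \near (0 : R), F (p.1 + s *: e_ i, p.2) <= F p) ->
  (\forall s \near within `[0, T] (nbhs p.2), F (xi s, s) <= F p) ->
  (lam + c) * (expR (- lam * p.2) * (sg * (rho p * expR (phi p / k) - y p))) <=
  expR (- lam * p.2) * (sg * (f * expR (phi p / k) - jet_operator u1 c (y p) y1 y2 y3))
   - kap * (w3 - k * (\sum_i w2 i) + 2 * (\sum_i u1 i * w1 i)).
Proof.
move=> c F Hr Hu Hy Hw rf m1 m2.
have [z1 [z2 [z3 [HZ ZE]]]] := conjugated_jet Hr Hu.
rewrite rf in ZE; rewrite -/c in ZE.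
have He : pjet (fun q => expR (- lam * q.2)) (fun=> 0) (fun=> 0) (- lam * expR (- lam * p.2)).
  have H0 : has_dq `[0, T] (fun s => - lam * s) p.2 (- lam * 1).
    apply: (@dqMl R _ (- lam) id p.2 1); apply: is_derive_dq; exact: is_derive_id.
  apply: (@pjet_time R n T xi v p (fun s => expR (- lam * s))).
  have := dq_comp H0 (is_derive_expR _); rewrite /comp => H.
  by move: H; rewrite mulr1.
have HF := pjetB xip (pjetM xip He (pjetZ xip sg (pjetB xip HZ Hy))) (pjetZ xip kap Hw).
have [F1 F2 F3] := pjet_max xip pT HF m1 m2.
move: F3; set e := expR _; set E := expR _ in ZE *.
set zy := rho p * E - y p => F3.
have F1' : \sum_i u1 i * (e * (sg * (z1 i - y1 i)) - kap * w1 i) = 0.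
  by apply: big1 => i _; have := F1 i; rewrite mul0r addr0 => ->; rewrite mulr0.
have F2' : \sum_i (e * (sg * (z2 i - y2 i)) - kap * w2 i) <= 0.
  rewrite -oppr_ge0 -sumrN; apply: sumr_ge0 => i _; rewrite oppr_ge0.
  by have := F2 i; rewrite !mul0r mulr0 !addr0.
rewrite (_ : \sum_i _ = e * (sg * (\sum_i u1 i * z1 i - \sum_i u1 i * y1 i)) - kap * (\sum_i u1 i * w1 i)) in F1'; last first.
  rewrite -sumrB !mulr_sumr -sumrB; apply: eq_bigr => i _.
  by move: (z1 i) (y1 i) (w1 i) (u1 i) => x1 x2 x3 x4; ring.
rewrite (_ : \sum_i _ = e * (sg * (\sum_i z2 i - \sum_i y2 i)) - kap * (\sum_i w2 i)) in F2'; last first.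
  rewrite -sumrB !mulr_sumr -sumrB; apply: eq_bigr => i _.
  by move: (z1 i) (y1 i) (w1 i) (u1 i) => x1 x2 x3 x4; ring.
rewrite /jet_operator in ZE *.
move: F1' F2' F3 ZE; rewrite /zy.
move: (\sum_i u1 i * z1 i) (\sum_i u1 i * y1 i) (\sum_i u1 i * w1 i) (\sum_i z2 i) (\sum_i y2 i) (\sum_i w2 i) => s1 s2 s3 s4 s5 s6.
move: (rho p) (y p) (e) (E) => a b e' E' F1' F2' F3 ZE.
have kF2 := ler_wpM2l (ltW k0) F2'; rewrite mulr0 in kF2.
have -> : f * E' = z3 - k * s4 + 2 * s1 + c * (a * E') by rewrite ZE mulrC.
rewrite -subr_ge0 (_ : _ - _ = (e' * (sg * (z3 - y3)) + - lam * e' * (sg * (a * E' - b)) - kap * w3) - k * (e' * (sg * (s4 - s5)) - kap * s6) + 2 * (e' * (sg * (s1 - s2)) - kap * s3)); last by ring.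
by rewrite F1' mulr0 addr0 subr_ge0 (le_trans kF2).
Qed.

End comparison_at_maximum.

(** * Uniform bounds *)

Section domination.
Context {R : realType} {I : Type}.
Implicit Types (S : set I) (w X Y : I -> R).

(** The index gathers every parameter on which the constant must not depend,
so that uniformity in these parameters is part of the notion. *)
Definition dominated S w X : Prop :=
  exists2 C, 0 <= C & forall i, S i -> `|X i| <= C * w i.

Lemma dom_ext S w X Y : (forall i, S i -> X i = Y i) -> dominated S w X -> dominated S w Y.
Proof. by move=> XY [C C0 H]; exists C => // i Si; rewrite -XY//; exact: H. Qed.

Lemma dom_sub S S' w X : S `<=` S' -> dominated S' w X -> dominated S w X.
Proof. by move=> SS [C C0 H]; exists C => // i /SS; exact: H. Qed.

Lemma dom_weight S w w' X : (forall i, S i -> w i <= w' i) -> dominated S w X ->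
  dominated S w' X.
Proof.
move=> ww [C C0 H]; exists C => // i Si.
by rewrite (le_trans (H i Si))// ler_wpM2l// ww.
Qed.

Lemma dom_cst S a : dominated S (fun=> 1) (fun=> a).
Proof. by exists `|a| => // i _; rewrite mulr1. Qed.

Lemma domD S w X Y : dominated S w X -> dominated S w Y ->
  dominated S w (fun i => X i + Y i).
Proof.
move=> [C C0 HX] [D D0 HY]; exists (C + D); first exact: addr_ge0.
by move=> i Si; rewrite mulrDl (le_trans (ler_normD _ _))// lerD ?HX ?HY.
Qed.

Lemma dom_opp S w X : dominated S w X -> dominated S w (fun i => - X i).
Proof. by move=> [C C0 H]; exists C => // i Si; rewrite normrN; exact: H. Qed.

Lemma domB S w X Y : dominated S w X -> dominated S w Y ->
  dominated S w (fun i => X i - Y i).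
Proof. by move=> HX HY; apply: domD => //; exact: dom_opp. Qed.

Lemma domMl S w X Y : dominated S (fun=> 1) X -> dominated S w Y ->
  dominated S w (fun i => X i * Y i).
Proof.
move=> [C C0 HX] [D D0 HY]; exists (C * D); first exact: mulr_ge0.
move=> i Si; rewrite normrM -mulrA ler_pM//; last exact: HY.
by have := HX i Si; rewrite mulr1.
Qed.

Lemma domMr S w X Y : dominated S w X -> dominated S (fun=> 1) Y ->
  dominated S w (fun i => X i * Y i).
Proof.
move=> HX HY; apply: (dom_ext (X := fun i => Y i * X i)); last exact: domMl.
by move=> i _; rewrite mulrC.
Qed.

Lemma domM S w w' X Y : dominated S w X -> dominated S w' Y ->
  dominated S (fun i => w i * w' i) (fun i => X i * Y i).
Proof.
move=> [C C0 HX] [D D0 HY]; exists (C * D); first exact: mulr_ge0.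
by move=> i Si; rewrite normrM mulrACA ler_pM// ?HX// HY.
Qed.

Lemma dom_sum n S w (X : 'I_n -> I -> R) : (forall i, S i -> 0 <= w i) ->
  (forall j, dominated S w (X j)) -> dominated S w (fun i => \sum_j X j i).
Proof.
move=> w0 H; pose C j := s2val (cid2 (H j)).
have C0 j : 0 <= C j by exact: s2valP (cid2 (H j)).
have CP j i : S i -> `|X j i| <= C j * w i by exact: s2valP' (cid2 (H j)) i.
exists (\sum_j C j); first exact: sumr_ge0.
move=> i Si; rewrite (le_trans (ler_norm_sum _ _ _))// mulr_suml.
by apply: ler_sum => j _; exact: CP.
Qed.

End domination.

(** * Identities and elementary estimates *)

(** The expansion in powers of the height h of the potential of the weight - h
s + b h^2 / 2, where N = grad d, H i = d_ii d, S = grad (d_t d), S2 i = d_ii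
d_t d, s = d_t h, and st, bt are the time derivatives of s and b. The terms
free of h simplify through N.N = 1 and N.S = 0: the squares s^2 from |grad
phi|^2 and from d_t phi cancel. *)
Lemma potential_expansion {R : realType} {n : nat} (k : R) (N S H S2 : 'I_n -> R)
    (b h s st bt : R) : 0 < k ->
  \sum_i N i * N i = 1 -> \sum_i N i * S i = 0 ->
  weight_potential k (fun i => N i * (b * h - s) - h * S i)
    (fun i => - (h * S2 i + 2 * (N i * S i) + H i * s) + b * (h * H i + N i * N i))
    (- (h * st + s * s) + 2^-1 * (bt * (h * h)) + b * (h * s)) =
  b - s * (\sum_i H i) + h * (- (\sum_i S2 i) + b * (\sum_i H i)
  + k^-1 * (2 * (s * b) - h * (\sum_i S i ^+ 2) - b ^+ 2 * h + st
       - 2^-1 * (bt * h) - b * s)).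
Proof.
move=> k0 E1 E2; rewrite /weight_potential; have kn : k != 0 by rewrite gt_eqF.
have -> : \sum_i (- (h * S2 i + 2 * (N i * S i) + H i * s) + b * (h * H i + N i * N i)) =
    - (h * (\sum_i S2 i) + (\sum_i H i) * s) + b * (h * (\sum_i H i) + 1).
  rewrite big_split sumrN !big_split /= -!mulr_sumr !big_split /=.
  by rewrite -!mulr_sumr E1 E2 -mulr_suml mulr0 addr0.
have -> : \sum_i (N i * (b * h - s) - h * S i) ^+ 2 = (b * h - s) ^+ 2 +
    h ^+ 2 * (\sum_i S i ^+ 2).
  transitivity (\sum_i ((b * h - s) ^+ 2 * (N i * N i)
     + h ^+ 2 * (S i ^+ 2) - 2 * (b * h - s) * h * (N i * S i))).
    by apply: eq_bigr => i _; move: (N i) (S i) => x1 x2; ring.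
  by rewrite sumrB big_split /= -!mulr_sumr E1 E2 mulr0 subr0 mulr1.
move: (\sum_i S2 i) (\sum_i H i) (\sum_i S i ^+ 2) => x1 x2 x3.
by field.
Qed.

(** The terms of order one cancel: what is left vanishes with the factors dd
(distance), h (height) and e (thickness), or with the differences mL - m and
sL - L between a quantity at the foot of the normal and at the point. *)
Lemma residual_algebra {R : realType} (nd dd s1 k s2 h s3 s4 b m G e L X a mL sL : R) :
  nd - dd * s1 - k * (s4 - dd * s2) + 2 * - (h * s3) + (b - (m - e * G) * L + h * X) * a
   - (nd + b * a - mL * sL * a - k * s4) =
  - (dd * s1) + k * (dd * s2) - 2 * (h * s3) +
   ((mL - m) * sL + m * (sL - L) + e * (G * L) + h * X) * a.
Proof. by ring. Qed.

Lemma dq_sub {R : realType} (W : normedModType R) (I J : set R) (f : R -> W) t u :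
  (\forall s \near t, I s -> J s) -> has_dq J f t u -> has_dq I f t u.
Proof.
move=> IJ; apply: cvg_trans; apply: cvg_app => P.
rewrite /within /dnbhs /within /= => HP.
by apply: filterS (filterI IJ HP) => s [Is Js] sn /Is; exact: Js.
Qed.

Lemma expR_sub1 {R : realType} (u a : R) : `|u| <= a -> `|expR u - 1| <= a * expR a.
Proof.
move=> ua; have a0 : 0 <= a := le_trans (normr_ge0 u) ua.
have e1 : 1 <= expR a by rewrite -expR0 ler_expR.
move: ua; rewrite ler_norml => /andP[au ua].
have h1 := expR_ge1Dx u; have h2 := expR_ge1Dx (- u).
have h3 : expR u <= expR a by rewrite ler_expR.
have h4 : 0 < expR u by exact: expR_gt0.
have h5 : expR u * expR (- u) = 1 by rewrite -expRD subrr expR0.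
have h6 : expR u * (1 - expR (- u)) = expR u - 1 by rewrite mulrBr mulr1 h5.
have ae : a <= a * expR a by rewrite ler_peMr.
rewrite ler_norml; apply/andP; split; first by lra.
rewrite -h6 mulrC; have [u0|u0] := leP 0 u.
  rewrite (@le_trans _ _ (a * expR u))//; first by rewrite ler_wpM2r ?(ltW h4)//; lra.
  by rewrite ler_wpM2l.
rewrite (@le_trans _ _ 0)//; last by rewrite mulr_ge0// expR_ge0.
by rewrite mulr_le0_ge0 ?(ltW h4)//; lra.
Qed.

Section sup_norms.
Context {R : realType} {X : Type}.
Implicit Types (A : set X) (f : X -> R).

Lemma sup_norm_ge0 A f : A !=set0 -> (0 <= sup_norm A f)%E.
Proof.
move=> [x Ax]; apply: le_trans (ereal_sup_ubound _); last by exists x.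
by rewrite lee_fin.
Qed.

Lemma le_sup_norm A f (s : \bar R) x : (sup_norm A f <= s)%E -> s \is a fin_num ->
  A x -> `|f x| <= fine s.
Proof.
move=> As sf Ax; rewrite -lee_fin fineK//; apply: le_trans As.
by apply: ereal_sup_ubound; exists x.
Qed.

End sup_norms.

Lemma fin_num_pmul {R : realType} (a : R) (x : \bar R) : 0 < a ->
  (a%:E * x)%E \is a fin_num -> x \is a fin_num.
Proof.
move=> a0; case: x => [r||] //; first by rewrite gt0_muley ?lte_fin.
by rewrite gt0_muleNy ?lte_fin.
Qed.

(** * Tubes around a moving surface *)

Record tube_setting (R : realType) (n : nat) (T : R)
    (Gamma : R -> set 'rV[R]_n) (nu Phi : space_time R n -> 'rV[R]_n)
    (V : space_time R n -> R) (Phinu : space_time R n -> 'rV[R]_n)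
    (delta c0 : R) (pj : space_time R n -> 'rV[R]_n) : Prop := {
  ts_T : 0 < T;
  ts_surface : moving_surface T Gamma nu Phi;
  ts_flow : normal_flow T Gamma nu V Phinu;
  ts_tube : tubular_neighborhood T Gamma nu delta c0 pj
}.

Definition level {R : realType} {n : nat} (Gamma : R -> set 'rV[R]_n)
  (p : space_time R n) : R := sdist (Gamma p.2) p.1.

Definition closed_tube {R : realType} {n : nat} (T : R)
    (Gamma : R -> set 'rV[R]_n) (delta : R) : set (space_time R n) :=
  spread `[0, T] (fun t => [set x | `|sdist (Gamma t) x| <= delta]).

Definition open_tube {R : realType} {n : nat} (T : R)
    (Gamma : R -> set 'rV[R]_n) (delta : R) : set (space_time R n) :=
  [set p | 0 <= p.2 <= T /\ `|level Gamma p| < delta].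

Definition lift_normal {R : realType} {n : nat} (pj : space_time R n -> 'rV[R]_n)
  (g : space_time R n -> R) (p : space_time R n) : R := g (pj p, p.2).

(** Dependence on time alone, for a function that is meaningful on A0 only. *)
Definition timelike {R : realType} {n : nat} (A0 : set (space_time R n))
    (f : space_time R n -> R) : Prop :=
  forall p q, A0 p -> A0 q -> p.2 = q.2 -> f p = f q.

Section moving_surface_tube.
Context {R : realType} {n : nat} {T : R} {Gamma : R -> set 'rV[R]_n}
  {nu Phi : space_time R n -> 'rV[R]_n} {V : space_time R n -> R}
  {Phinu : space_time R n -> 'rV[R]_n} {delta c0 : R}
  {pj : space_time R n -> 'rV[R]_n}.
Hypothesis ts : tube_setting T Gamma nu Phi V Phinu delta c0 pj.
Let T0 := ts_T ts.
Let ms := ts_surface ts.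
Let nf := ts_flow ts.
Let tn := ts_tube ts.
Local Notation A := (closed_tube T Gamma delta).
Local Notation A0 := (open_tube T Gamma delta).
Local Notation d := (level Gamma).
Local Notation Dt := (time_derivative T).
Local Notation D i := (partial i).
Local Notation tame := (tame A A0).
Local Notation lift := (lift_normal pj).
Local Notation tD := (tD Gamma nu).
Local Notation e_ i := (delta_mx 0 i : 'rV[R]_n).

Lemma delta_gt0 : 0 < delta. Proof. exact: tube_width_gt0 tn. Qed.

Lemma surface_neq0 t : 0 <= t <= T -> Gamma t !=set0.
Proof. by move=> /(moving_surface_closed ms)[]. Qed.

Lemma open_tubeP p y : 0 <= p.2 <= T -> Gamma p.2 y -> enorm (p.1 - y) < delta ->
  A0 p.
Proof. by move=> pT Gy yd; split => //; exact: le_lt_trans (sdist_le _ Gy) yd. Qed.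

Lemma surface_open_tube t y : 0 <= t <= T -> Gamma t y -> A0 (y, t).
Proof.
move=> tT Gy; apply: (@open_tubeP (y, t) y) => //=.
by rewrite subrr /enorm -(scale0r 0) dotZl mul0r sqrtr0 delta_gt0.
Qed.

Lemma Phi_surface Y t : Gamma 0 Y -> 0 <= t <= T -> Gamma t (Phi (Y, t)).
Proof.
move=> GY tT; have [_ [fn _ _] _] := moving_surface_diffeo ms tT.
exact: fn.
Qed.

Lemma Phi_onto y t : 0 <= t <= T -> Gamma t y ->
  exists2 Y, Gamma 0 Y & Phi (Y, t) = y.
Proof.
move=> tT Gy; have [_ [_ _ sj] _] := moving_surface_diffeo ms tT.
by have [Y GY YE] := sj _ Gy; exists Y.
Qed.

(** Smoothness on a set that is not open means local extendability, so joint
continuity is obtained through the extension. *)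
Lemma Phi_cvg q : (Gamma 0 `*` `[0, T]) q ->
  Phi x @[x --> within (Gamma 0 `*` `[0, T]) (nbhs q)] --> Phi q.
Proof.
move=> Gq; have [U [h [oU Uq Ch hE]]] := moving_surface_smooth ms Gq.
have ch := class_C_cont (Ch 0%N) Uq.
rewrite -(hE _ Uq Gq).
apply: (@cvg_trans _ (h x @[x --> within (Gamma 0 `*` `[0, T]) (nbhs q)])).
  apply: near_eq_cvg; near=> x.
  apply: hE.
    by near: x; apply: cvg_within; exact: open_nbhs_nbhs.
  by near: x; exact: withinT.
by apply: cvg_trans ch; apply: cvg_app; exact: cvg_within.
Unshelve. all: by end_near. Qed.

(** A point of the open tube is closer than delta to some Phi (Y, t); this
inequality persists when the point and t vary, by continuity of Phi (Y, .). *)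
Lemma tube_rel_open : relatively_open_in T A A0.
Proof.
split => //.
- by move=> p [pT /ltW pd]; split; rewrite //= in_itv.
- by move=> p [].
move=> p [pT pd]; have [y Gy yd] := sdist_lt (surface_neq0 pT) pd.
have [Y GY YE] := Phi_onto pT Gy.
have GYp : (Gamma 0 `*` `[0, T]) (Y, p.2) by split; rewrite //= in_itv.
have c1 : Phi (Y, q.2) @[q --> within [set q : space_time R n | 0 <= q.2 <= T] (nbhs p)] --> Phi (Y, p.2).
  apply: (@cvg_comp _ _ _ (fun q : space_time R n => (Y, q.2)) Phi _ (within (Gamma 0 `*` `[0, T]) (nbhs (Y, p.2)))); last exact: Phi_cvg.
  have c0' : (Y, q.2) @[q --> nbhs p] --> nbhs (Y, p.2).
    exact: (cvg_pair (cvg_cst Y) cvg_snd).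
  move=> P /c0' H; rewrite /nbhs /= /within /=; apply: (@filterS _ (nbhs p)) H => q H qT.
  by apply: H; split; rewrite //= in_itv.
have c2 : enorm (q.1 - Phi (Y, q.2)) @[q --> within [set q : space_time R n | 0 <= q.2 <= T] (nbhs p)] --> enorm (p.1 - Phi (Y, p.2)).
  apply: enorm_cvg; apply: cvgB => //.
  have cf : q.1 @[q --> nbhs p] --> nbhs p.1 by exact: cvg_fst.
  by apply: cvg_trans cf; apply: cvg_app; exact: cvg_within.
rewrite YE in c2.
have H : \forall q \near within [set q : space_time R n | 0 <= q.2 <= T] (nbhs p),
  enorm (q.1 - Phi (Y, q.2)) < delta by apply: (cvgr_lt _ c2).
rewrite /within /= in H; apply: (@filterS _ (nbhs p) _ _ _ _ H) => {H} q H qT.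
apply: (@open_tubeP q (Phi (Y, q.2))) => //; last exact: H.
exact: Phi_surface.
Qed.

Let AA := tube_rel_open.

(** * The eikonal equation *)

Lemma level_tame : tame d.
Proof.
move=> p Ap; have [U [h [oU Up Ch hE]]] := tube_sdist_smooth tn Ap.
exists U, h; split => // q Uq Aq; apply: hE => //.
exact: (rop_sub AA).
Qed.

Lemma tubeE p : A0 p -> [/\ Gamma p.2 (pj p) & p.1 = pj p + d p *: nu (pj p, p.2)].
Proof.
case: p => x t [/= pT /ltW pd]; have [? ? _] := tube_proj tn pT pd; by split.
Qed.

Lemma partial_level p i : A0 p -> D i d p = nu (pj p, p.2) 0 i.
Proof.
case: p => x t [/= pT /ltW pd]; have [_ E] := tube_grad tn pT pd.
by rewrite /partial /= -E mxE.
Qed.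

Lemma normal_unit y t : 0 <= t <= T -> Gamma t y -> enorm (nu (y, t)) = 1.
Proof. by move=> tT Gy; have [] := moving_surface_normal ms tT Gy. Qed.

(** Throughout the tube, grad d is the unit normal at the foot of the point.
*)
Lemma eikonal p : A0 p -> \sum_i D i d p * D i d p = 1.
Proof.
move=> Ap; have [Gp _] := tubeE Ap.
rewrite -(dot_unit (normal_unit (rop_time AA Ap) Gp)).
by apply: eq_bigr => i _; rewrite partial_level.
Qed.

Lemma level_surface y t : 0 <= t <= T -> Gamma t y -> d (y, t) = 0.
Proof.
move=> tT Gy; apply/eqP; rewrite -normr_le0.
have := @sdist_le R n (Gamma t) y y Gy.
by rewrite subrr /enorm -(scale0r 0) dotZl mul0r sqrtr0.
Qed.

Lemma pi_surface y t : 0 <= t <= T -> Gamma t y -> pj (y, t) = y.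
Proof.
move=> tT Gy; have [_ /= E] := tubeE (surface_open_tube tT Gy).
by rewrite level_surface// scale0r addr0 in E.
Qed.

Lemma partial_level_surface y t i : 0 <= t <= T -> Gamma t y ->
  D i d (y, t) = nu (y, t) 0 i.
Proof.
by move=> tT Gy; rewrite partial_level ?pi_surface//; exact: surface_open_tube.
Qed.

(** Differentiating the eikonal equation: the Hessian of d annihilates grad d.
*)
Lemma level_hess_normal p j : A0 p -> \sum_i D i d p * D j (D i d) p = 0.
Proof.
move=> Ap.
have dd i : is_derive p.1 (delta_mx 0 j : 'rV[R]_n)
   (fun z => D i d (z, p.2)) (D j (D i d) p).
  exact: (tame_is_derive AA j (tame_partial AA i level_tame) Ap).
have H : is_derive p.1 (delta_mx 0 j : 'rV[R]_n)
    (\sum_i ((fun z => D i d (z, p.2)) * (fun z => D i d (z, p.2))))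
    (\sum_i (D i d p *: D j (D i d) p + D i d p *: D j (D i d) p)).
  by apply: is_derive_sum => i; have := is_deriveM (dd i) (dd i); rewrite -surjective_pairing.
have nA : \forall z \near p.1, A0 (z, p.2).
  exact: (rop_near_space AA Ap).
have : is_derive p.1 (delta_mx 0 j : 'rV[R]_n) (cst (1 : R))
    (\sum_i (D i d p *: D j (D i d) p + D i d p *: D j (D i d) p)).
  apply: near_eq_is_derive H; apply: filterS nA => z Az.
  by rewrite fct_sumE /= -(eikonal Az).
move=> [_]; rewrite derive_cst => /esym; rewrite -[RHS]addr0.
rewrite big_split /= => E.
by move: E; set S := \sum_i _; lra.
Qed.

(** The same fact with the indices of the Hessian exchanged, that is, grad d
is constant along itself. *)
Lemma level_hess_normal' p j : A0 p -> \sum_i D i d p * D i (D j d) p = 0.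
Proof.
move=> Ap; rewrite -[RHS](level_hess_normal j Ap).
by apply: eq_bigr => i _; rewrite (tame_partialC AA i j level_tame Ap).
Qed.

(** The time derivative of the eikonal equation. *)
Lemma level_time_normal p : A0 p -> \sum_i D i d p * D i (Dt d) p = 0.
Proof.
move=> Ap.
have dd i : has_dq `[0, T] (fun s => D i d (p.1, s)) p.2 (Dt (D i d) p).
  exact: (tame_dq AA (tame_partial AA i level_tame) Ap).
have H : has_dq `[0, T] (fun s => \sum_i D i d (p.1, s) * D i d (p.1, s)) p.2
    (\sum_i (D i d p * Dt (D i d) p + Dt (D i d) p * D i d p)).
  by apply: dq_sum => i; have := dqM (dd i) (dd i); rewrite -surjective_pairing.
have H1 : has_dq `[0, T] (fun s => 1 : R) p.2
    (\sum_i (D i d p * Dt (D i d) p + Dt (D i d) p * D i d p)).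
  apply: dq_near_eq H.
    by rewrite -(eikonal Ap) -surjective_pairing.
  near=> s.
  have sT : (`[0, T]%classic : set R) s by near: s; exact: withinT.
  rewrite /= in_itv in sT.
  suff As : A0 (p.1, s) by rewrite eikonal.
  near: s; apply: within_nbhs_dnbhs; exact: (rop_near_time AA Ap).
have := dq_unique T0 (rop_time AA Ap) H1 (@dq_cst R R _ 1 _).
rewrite big_split /= => E.
have E2 : \sum_i Dt (D i d) p * D i d p = \sum_i D i d p * Dt (D i d) p.
  by apply: eq_bigr => i _; rewrite mulrC.
rewrite E2 in E.
rewrite (eq_bigr (fun i => D i d p * Dt (D i d) p)); last first.
  by move=> i _; rewrite (tame_timeC AA i level_tame Ap).
by move: E; set S := \sum_i _; lra.
Unshelve. all: by end_near. Qed.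

(** * Boundedness on the tube *)

(** The normal coordinates of the tube, with the normal written as grad d,
which is jointly continuous in space and time. *)
Definition tube_param (q : space_time R n * R) : space_time R n :=
  (Phi q.1 + q.2 *: \row_i D i d (Phi q.1, q.1.2), q.1.2).

Lemma tube_param_cvg (B : set (space_time R n * R)) q :
  B `<=` [set q | (Gamma 0 `*` `[0, T]) q.1] -> B q ->
  tube_param x @[x --> within B (nbhs q)] --> tube_param q.
Proof.
move=> BG Bq; have Gq := BG _ Bq.
have c1 : x.1 @[x --> within B (nbhs q)] --> within (Gamma 0 `*` `[0, T]) (nbhs q.1).
  apply: cvg_to_within => //.
  have cf : x.1 @[x --> nbhs q] --> nbhs q.1 by exact: cvg_fst.
  by apply: cvg_trans cf; apply: cvg_app; exact: cvg_within.
have cP := cvg_comp _ _ c1 (Phi_cvg Gq).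
have ct : x.1.2 @[x --> within B (nbhs q)] --> q.1.2.
  apply: (cvg_comp _ _ c1); have cs : x.2 @[x --> nbhs q.1] --> nbhs q.1.2 by exact: cvg_snd.
  by apply: cvg_trans cs; apply: cvg_app; exact: cvg_within.
have qT : 0 <= q.1.2 <= T by move: Gq => [_]; rewrite /= in_itv.
have GP : Gamma q.1.2 (Phi q.1).
  by rewrite [q.1]surjective_pairing; apply: Phi_surface => //; case: Gq.
have AP := surface_open_tube qT GP.
have cN : (\row_i D i d (Phi x.1, x.1.2)) @[x --> within B (nbhs q)] --> (\row_i D i d (Phi q.1, q.1.2) : 'rV[R]_n).
  apply: cvg_row => i.
  have cD := tame_cvg AA (tame_partial AA i level_tame) AP.
  apply: (cvg_comp _ _ _ cD); apply: cvg_to_within.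
    exact: (cvg_pair cP ct).
  by move=> x /BG[].
have cr : x.2 @[x --> within B (nbhs q)] --> q.2.
  have cs : x.2 @[x --> nbhs q] --> nbhs q.2 by exact: cvg_snd.
  by apply: cvg_trans cs; apply: cvg_app; exact: cvg_within.
exact: (cvg_pair (cvgD cP (cvgZ cr cN)) ct).
Qed.

Lemma tube_param_in (q : space_time R n * R) : Gamma 0 q.1.1 -> 0 <= q.1.2 <= T ->
  `|q.2| <= delta -> A (tube_param q).
Proof.
case: q => -[Y t] r /= GY tT rd; split; first by rewrite /= in_itv.
have GP := Phi_surface GY tT.
apply: le_trans (sdist_le _ GP) _.
rewrite addrAC subrr add0r enormZ (_ : enorm _ = 1) ?mulr1//.
rewrite -(normal_unit tT GP); congr enorm; apply/rowP => i.
by rewrite mxE partial_level_surface.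
Qed.

Lemma open_tube_param p : A0 p -> exists q : space_time R n * R,
  [/\ Gamma 0 q.1.1, q.1.2 = p.2, q.2 = d p & tube_param q = p].
Proof.
move=> Ap; have [Gp pE] := tubeE Ap.
have pT := rop_time AA Ap.
have [Y GY YE] := Phi_onto pT Gp.
exists ((Y, p.2), d p); split => //; rewrite /tube_param /= YE.
rewrite [RHS]surjective_pairing [in RHS]pE; congr (_ + _ *: _, _).
by apply/rowP => i; rewrite mxE partial_level_surface.
Qed.

(** The closed tube lies in the image of a compact box, near each point of
which f agrees on the open tube with a continuous function. *)
Lemma tame_bounded f : tame f ->
  exists M, 0 <= M /\ forall p, A0 p -> `|f p| <= M.
Proof.
move=> tf.
pose B := (Gamma 0 `*` `[0, T]) `*` `[- delta, delta]%classic.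
have cK : compact (tube_param @` B).
  apply: continuous_compact.
    apply/subspace_continuousP => q Bq.
    by apply: tube_param_cvg => // x [].
  apply: compact_setX; last exact: segment_compact.
  apply: compact_setX; last exact: segment_compact.
  by have [] := moving_surface_closed ms (t := 0); rewrite ?lexx ?ltW.
move/compact_near_coveringP: cK => /(_ R (pinfty_nbhs R)
  (fun M q => A0 q -> `|f q| <= M)).
have H : forall x, (tube_param @` B) x ->
    \forall x' \near x & M \near pinfty_nbhs R, A0 x' -> `|f x'| <= M.
  move=> _ [q [[GY qT] qr] <-].
  have Aq : A (tube_param q).
    rewrite /= in_itv /= in qT; rewrite /= in_itv /= -ler_norml in qr.
    exact: tube_param_in.
  have [U [h [oU Up Ch hE]]] := tf _ Aq.
  have ch := class_C_cont (Ch 0%N) Up.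
  have nh : \forall x' \near tube_param q, U x' /\ `|h x'| <= `|h (tube_param q)| + 1.
    near=> x'; split; first by near: x'; exact: open_nbhs_nbhs.
    near: x'; apply: (cvgr_norm_le _ ch); by rewrite ltrDl.
  exists ([set x' | U x' /\ `|h x'| <= `|h (tube_param q)| + 1], [set M | `|h (tube_param q)| + 1 <= M]).
    split => //=; exact: nbhs_pinfty_ge.
  move=> [x' M] /= [[Ux hx] hM] Ax; rewrite -hE//.
  exact: le_trans hM.
move=> /(_ _ H) H2.
have := filter_ex (filterI H2 (nbhs_pinfty_ge (num_real 0))).
move=> [M [HM M0]]; exists M; split => // p Ap.
apply: HM => //; have [q [GY qt qd qE]] := open_tube_param Ap.
exists q => //; split; first split => //=.
  by rewrite qt in_itv; exact: (rop_time AA Ap).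
rewrite /= in_itv /= -ler_norml qd ltW//; by case: Ap.
Unshelve. all: by end_near. Qed.

Lemma tame_bounded_fam (I : finType) (f : I -> space_time R n -> R) :
  (forall i, tame (f i)) ->
  exists M, 0 <= M /\ forall i p, A0 p -> `|f i p| <= M.
Proof.
move=> tf; pose M i := sval (cid (tame_bounded (tf i))).
have MP i : 0 <= M i /\ forall p, A0 p -> `|f i p| <= M i := svalP (cid (tame_bounded (tf i))).
exists (\sum_i M i); split; first by apply: sumr_ge0 => i _; have [] := MP i.
move=> i p Ap; rewrite (bigD1 i)//= (le_trans ((MP i).2 p Ap))// lerDl.
by apply: sumr_ge0 => j _; have [] := MP j.
Qed.

Lemma tame_line f x v t s : tame f -> A0 (x + s *: v, t) ->
  is_derive s (1 : R) (fun s => f (x + s *: v, t))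
    (\sum_i v 0 i * D i f (x + s *: v, t)).
Proof.
move=> tf Ax; have [fd fE] := tame_slice_diff AA tf Ax.
apply: (proj1 (is_derive_line (fun z => f (z, t)) x v s _)).
split; first exact: diff_derivable.
by rewrite deriveE// fE.
Qed.

(** * The signed distance along normal lines *)

Lemma normal_line_tube (t : R) y (r : R) : 0 <= t <= T -> Gamma t y -> `|r| < delta ->
  A0 (y + r *: nu (y, t), t).
Proof.
move=> tT Gy rd; apply: (open_tubeP (y := y)) => //=.
by rewrite addrAC subrr add0r enormZ (normal_unit tT Gy) mulr1.
Qed.

(** Along the normal line through y the difference between grad d and nu (y)
solves a linear ordinary differential equation with zero initial value,
because the Hessian annihilates grad d. Gronwall's lemma is applied to its
square norm. *)
Lemma normal_line_grad (t : R) y (r : R) i : 0 <= t <= T -> Gamma t y -> `|r| < delta ->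
  D i d (y + r *: nu (y, t), t) = nu (y, t) 0 i.
Proof.
move=> tT Gy rd.
have [M [M0 HM]] := tame_bounded_fam (I := ('I_n * 'I_n)%type)
  (f := fun ij => D ij.1 (D ij.2 d))
  (fun ij => tame_partial AA ij.1 (tame_partial AA ij.2 (level_tame))).
pose N := nu (y, t).
(* the line is parametrised by [0, 1], which covers both signs of r *)
pose e (s : R) i := D i d (y + (s * r) *: N, t) - N 0 i.
have As (s : R) : 0 <= s <= 1 -> A0 (y + (s * r) *: N, t).
  move=> /andP[s0 s1]; apply: normal_line_tube => //.
  by rewrite (le_lt_trans _ rd)// normrM ger0_norm// ler_piMl.
pose e' (s : R) i := \sum_j (r * N 0 j) * D j (D i d) (y + (s * r) *: N, t).
have de (s : R) (j : 'I_n) : 0 <= s <= 1 -> is_derive s (1 : R) (fun s => e s j) (e' s j).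
  move=> s01; rewrite /e.
  have -> : (fun s => D j d (y + (s * r) *: N, t) - N 0 j) =
     (fun s => D j d (y + s *: (r *: N), t)) - cst (N 0 j).
    by apply/funext => z; rewrite -[RHS]/(D j d (y + z *: (r *: N), t) - N 0 j) scalerA.
  rewrite -[e' s j]subr0; apply: is_deriveB.
  have := @tame_line (D j d) y (r *: N) t s (tame_partial AA j (level_tame)).
  rewrite scalerA => /(_ (As _ s01)) H.
  apply: is_derive_eq H _; apply: eq_bigr => k _; by rewrite mxE.
pose E s := \sum_j e s j ^+ 2.
pose E' s := \sum_j (2 * e s j * e' s j).
have dE (s : R) : 0 <= s <= 1 -> is_derive s (1 : R) E (E' s).
  move=> s01; have -> : E = \sum_j (fun s => e s j) ^+ 2.
    by apply/funext => z; rewrite fct_sumE.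
  apply: is_derive_sum => j; have := @is_deriveX _ _ _ 2 _ _ _ (de s j s01).
  by rewrite /GRing.scale /= expr1.
have E0 : E 0 = 0.
  rewrite /E big1// => j _; rewrite /e mul0r scale0r addr0.
  by rewrite (partial_level_surface)// subrr expr0n.
have e'E (s : R) (j : 'I_n) : 0 <= s <= 1 -> e' s j = - r * \sum_k e s k * D k (D j d) (y + (s * r) *: N, t).
  move=> s01; have := level_hess_normal' j (As s s01).
  set q := (y + (s * r) *: N, t) => H.
  have -> : \sum_k e s k * D k (D j d) q =
      \sum_k D k d q * D k (D j d) q - \sum_k N 0 k * D k (D j d) q.
    by rewrite -sumrB; apply: eq_bigr => k _; rewrite -mulrBl.
  rewrite H sub0r mulrN mulNr opprK mulr_sumr.
  by apply: eq_bigr => k _; rewrite mulrA.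
have E1 : E 1 = 0.
  apply: (@gronwall_zero R E E' (2 * `|r| * M * n%:R) 1) => //.
  - move=> s s01; rewrite /E'.
    apply: (@le_trans _ _ (\sum_(j < n) \sum_(k < n) (`|r| * M) * (e s j ^+ 2 + e s k ^+ 2))).
      apply: ler_sum => j _; rewrite (e'E _ _ s01) mulr_sumr mulr_sumr.
      apply: ler_sum => k _.
      have HD := HM (k, j) _ (As s s01); rewrite /= in HD.
      set D1 := D k _ _ in HD *.
      apply: le_trans (ler_norm _) _.
      have -> : 2 * e s j * (- r * (e s k * D1)) = (- r * D1) * (2 * e s j * e s k).
        by ring.
      rewrite normrM normrM normrN ler_pM ?mulr_ge0//.
        by rewrite ler_wpM2l.
      rewrite ler_norml; apply/andP; split.
        by have := sqr_ge0 (e s j + e s k); rewrite sqrrD; lra.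
      by have := sqr_ge0 (e s j - e s k); rewrite sqrrB; lra.
    rewrite (eq_bigr (fun j => (`|r| * M) * (n%:R * e s j ^+ 2 + E s))); last first.
      move=> j _; rewrite -mulr_sumr; congr (_ * _).
      by rewrite big_split /= sumr_const card_ord mulr_natl.
    rewrite -mulr_sumr big_split /= -mulr_sumr sumr_const card_ord -/(E s).
    by rewrite -mulr_natl le_eqVlt; apply/orP; left; apply/eqP; ring.
  - by apply: sumr_ge0 => j _; exact: sqr_ge0.
move/eqP: E1; rewrite psumr_eq0 => [/allP H|j _]; last exact: sqr_ge0.
have := H i (mem_index_enum i); rewrite implyTb sqrf_eq0 /e mul1r subr_eq0.
by move/eqP.
Qed.

(** The derivative of d along the normal line is nu.nu = 1. *)
Lemma normal_line_level (t : R) y (r : R) : 0 <= t <= T -> Gamma t y -> `|r| < delta ->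
  d (y + r *: nu (y, t), t) = r.
Proof.
move=> tT Gy rd; pose N := nu (y, t).
have As (s : R) : 0 <= s <= 1 -> A0 (y + (s * r) *: N, t).
  move=> /andP[s0 s1]; apply: normal_line_tube => //.
  by rewrite (le_lt_trans _ rd)// normrM ger0_norm// ler_piMl.
have := @mvt_affine R (fun s => d (y + s *: N, t)) (fun=> 1) r 1 0.
rewrite mul0r scale0r addr0 (level_surface tT Gy) subr0 mulr1 => H.
apply/eqP; rewrite -subr_eq0 -normr_le0; apply: H; last first.
  by move=> s _; rewrite subrr normr0.
move=> s s01; have := tame_line (level_tame) (As s s01).
move=> H; apply: is_derive_eq H _.
rewrite -(dot_unit (normal_unit tT Gy)); apply: eq_bigr => i _.
rewrite normal_line_grad// (le_lt_trans _ rd)// normrM.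
by move: s01 => /andP[s0 s1]; rewrite ger0_norm// ler_piMl.
Qed.

(** The signed distance r of the point being known, uniqueness of the normal
representation identifies its foot. *)
Lemma normal_line_proj (t : R) y (r : R) : 0 <= t <= T -> Gamma t y -> `|r| < delta ->
  pj (y + r *: nu (y, t), t) = y.
Proof.
move=> tT Gy rd.
have [_ _ H] := tube_proj (ts_tube ts) tT (ltW (normal_line_tube tT Gy rd).2).
apply/esym/H => //; congr (_ + _ *: _).
exact: (esym (normal_line_level tT Gy rd)).
Qed.

(** * Functions lifted from the surface *)

Lemma lift_tame g : smooth_on (spread `[0, T] Gamma) g -> tame (lift g).
Proof.
move=> sg p Ap; have [U [P [oU Up CP PE]]] := tube_proj_smooth (ts_tube ts) Ap.
have pT : 0 <= p.2 <= T by move: Ap => [+ _]; rewrite /= in_itv.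
have [Gp _ _] : [/\ Gamma p.2 (pj p), p.1 = pj p + sdist (Gamma p.2) p.1 *: nu (pj p, p.2) & True].
  case: p Ap pT {Up} => x t [/= _ xd] tT.
  by have [] := tube_proj (ts_tube ts) tT xd.
have Sp : spread `[0, T] Gamma (pj p, p.2) by split; rewrite //= in_itv.
have [U' [h [oU' U'p Ch hE]]] := sg _ Sp.
pose W := interior [set q : space_time R n | U q /\ U' (P q, q.2)].
have WU q : W q -> U q /\ U' (P q, q.2) by exact: interior_subset.
exists W, (fun q => h (P q, q.2)); split.
- exact: open_interior.
- have PEp := PE _ Up Ap.
  have c1 : (P q, q.2) @[q --> nbhs p] --> (P p, p.2).
    exact: (cvg_pair (class_C_cont (CP 0%N) Up) cvg_snd).
  have n1 : \forall q \near p, U' (P q, q.2).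
    by apply: c1; apply: open_nbhs_nbhs; split => //; rewrite PEp.
  have n2 : \forall q \near p, U q by exact: open_nbhs_nbhs.
  exact: (filterI n2 n1).
- move=> k; apply: (@class_C_comp R n W U' h P k) => //.
  + exact: open_interior.
  + by move=> q /WU[].
  + by move=> m; apply: class_C_sub (CP m) => q /WU[].
- move=> q /WU[Uq U'q] Aq; rewrite /lift_normal.
  have Aq' := rop_sub AA Aq.
  rewrite (PE _ Uq Aq') in U'q *.
  apply: hE => //; have [Gq _] := tubeE Aq.
  by split; rewrite //= in_itv; exact: (rop_time AA Aq).
Qed.

Lemma lift_timelike g : depends_only_on_time T Gamma g -> timelike A0 (lift g).
Proof.
move=> dg p q Ap Aq pq; rewrite /lift_normal -pq.
have [Gp _] := tubeE Ap; have [Gq _] := tubeE Aq.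
by apply: dg => //; [exact: (rop_time AA Ap)|rewrite pq].
Qed.

Lemma lift_surface g t y : 0 <= t <= T -> Gamma t y -> lift g (y, t) = g (y, t).
Proof. by move=> tT Gy; rewrite /lift_normal (pi_surface). Qed.

Lemma timelike_partial f p i : timelike A0 f -> A0 p -> D i f p = 0.
Proof.
move=> tf Ap; rewrite /partial.
rewrite (near_eq_derive (g := cst (f p))) ?derive_cst//.
apply: filterS (rop_near_space AA Ap) => z Az /=; exact: tf.
Qed.

Lemma timelike_time f : tame f -> timelike A0 f -> timelike A0 (Dt f).
Proof.
move=> tf ctf p q Ap Aq pq.
have H1 := tame_dq AA tf Ap; have H2 := tame_dq AA tf Aq.
apply: (dq_unique (rop_T0 AA) (rop_time AA Ap) H1).
rewrite pq; apply: dq_near_eq H2.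
  have -> : (p.1, q.2) = p by rewrite -pq -surjective_pairing.
  by rewrite -surjective_pairing; apply/esym/ctf.
have n1 := within_nbhs_dnbhs (rop_near_time AA Ap).
have n2 := within_nbhs_dnbhs (rop_near_time AA Aq).
rewrite pq in n1; near=> s; apply: ctf => //=; near: s; [exact: n2|exact: n1].
Unshelve. all: by end_near. Qed.

Lemma tame_slice_cvg f p : tame f -> A0 p -> f (z, p.2) @[z --> p.1] --> f p.
Proof.
move=> tf Ap; have [fd _] := tame_slice_diff AA tf Ap.
by case: p Ap fd => x t Ap /differentiable_continuous.
Qed.

(** The gradient of the lift of zeta is (I - d D^2 d) applied to the
tangential gradient at the foot, since the projection x - d grad d has
differential P - d D^2 d. *)
Definition lift_grad (zeta : space_time R n -> R) (i : 'I_n) (p : space_time R n) : R :=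
  lift (tD i zeta) p -
  d p * \sum_l D i (D l d) p * lift (tD l zeta) p.

Lemma partial_level_proj p i : A0 p -> D i d p = nu (pj p, p.2) 0 i.
Proof. exact: (partial_level). Qed.

Lemma tgrad_is_tgrad zeta p : tdifferentiable Gamma nu zeta p ->
  is_tgrad (Gamma p.2) (fun y => nu (y, p.2)) (fun y => zeta (y, p.2)) p.1
    (tgrad Gamma nu zeta p).
Proof. by move=> [G HG]; rewrite /tgrad; case: xgetP => [G' _ //|/(_ G)]. Qed.

Lemma tD_normal zeta p : A0 p -> tdifferentiable Gamma nu zeta (pj p, p.2) ->
  \sum_i D i d p * lift (tD i zeta) p = 0.
Proof.
move=> Ap /tgrad_is_tgrad/tgradE[h [_ _ GE]] /=.
rewrite (eq_bigr (fun i => D i d p * 'D_(e_ i) h (pj p) -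
   (\sum_j 'D_(e_ j) h (pj p) * D j d p) * (D i d p * D i d p))); last first.
  move=> i _; rewrite /lift_normal /tD GE /= mulrBr.
  rewrite (eq_bigr (fun j => 'D_(e_ j) h (pj p) * D j d p)); last first.
    by move=> j _; rewrite partial_level_proj.
  by rewrite -partial_level_proj//; ring.
rewrite sumrB -mulr_sumr; have -> := eikonal Ap; rewrite mulr1.
by apply/eqP; rewrite subr_eq0; apply/eqP; apply: eq_bigr => i _; rewrite mulrC.
Qed.

Lemma tame_axis f x t s i : tame f -> A0 (x + s *: e_ i, t) ->
  is_derive s (1 : R) (fun s => f (x + s *: e_ i, t)) (D i f (x + s *: e_ i, t)).
Proof.
move=> tf Ax; apply: (proj1 (is_derive_line (fun z => f (z, t)) x (e_ i) s _)).
exact: (tame_is_derive AA i tf Ax).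
Qed.

Lemma near_axis x t i : A0 (x, t) -> \forall s \near (0 : R), A0 (x + s *: e_ i, t).
Proof.
move=> Ap; have Ap0 : A0 (x + (0 : R) *: e_ i, t) by rewrite scale0r addr0.
have nA : \forall z \near (x + (0 : R) *: e_ i), A0 (z, t) := rop_near_space AA Ap0.
have cs : x + s *: e_ i @[s --> 0] --> x + (0 : R) *: e_ i.
  by apply: cvgD; [exact: cvg_cst|apply: cvgZ; [exact: cvg_id|exact: cvg_cst]].
exact: (cs _ nA).
Qed.

(** The chain rule for an extension h of zeta composed with the projection,
written explicitly as x - d grad d. The tangential gradient differs from grad
h by a normal component, which the differential of the projection kills. *)
Lemma lift_partial zeta p i : A0 p ->
  tdifferentiable Gamma nu zeta (pj p, p.2) ->
  is_derive p.1 (e_ i) (fun z => lift zeta (z, p.2)) (lift_grad zeta i p).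
Proof.
case: p => x t Ap Tz; have tT := rop_time AA Ap; rewrite /= in tT Tz.
have [h [hE dh GE]] := tgradE (tgrad_is_tgrad Tz); rewrite /= in hE dh GE.
set y := pj (x, t) in Tz hE dh GE.
rewrite -[x in is_derive x](_ : x + 0 *: e_ i = _); last by rewrite scale0r addr0.
apply: (proj2 (is_derive_line (fun z => lift zeta (z, t)) x (e_ i) 0 _)).
(* the projection along the coordinate line through x *)
pose c (s : R) : 'rV[R]_n := \row_l ((x + s *: e_ i) 0 l - d (x + s *: e_ i, t) * D l d (x + s *: e_ i, t)).
have Ap0 : A0 (x + 0 *: e_ i, t) by rewrite scale0r addr0.
have nA := near_axis i Ap.
have cE s : A0 (x + s *: e_ i, t) -> pj (x + s *: e_ i, t) = c s.
  move=> As; have [_ E] := tubeE As; apply/rowP => l; rewrite mxE.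
  have El := congr1 (fun v : 'rV[R]_n => v 0 l) E.
  rewrite [X in X - _](_ : _ = pj (x + s *: e_ i, t) 0 l + d (x + s *: e_ i, t) * nu (pj (x + s *: e_ i, t), t) 0 l).
    by rewrite partial_level_proj// addrK.
  by rewrite -[LHS]/((x + s *: e_ i) 0 l) El mxE [X in _ + X]mxE.
have dc l : is_derive (0 : R) (1 : R) (fun s => c s 0 l)
   ((l == i)%:R - (d (x, t) * D i (D l d) (x, t) + D l d (x, t) * D i d (x, t))).
  have d1 := tame_axis (level_tame) Ap0.
  have d2 := tame_axis (tame_partial AA l (level_tame)) Ap0.
  have d0 : is_derive (0 : R) (1 : R) (fun s => (x + s *: e_ i) 0 l) ((l == i)%:R).
    have -> : (fun s : R => (x + s *: e_ i) 0 l) = cst (x 0 l) + id * cst ((l == i)%:R).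
      by apply/funext => s; rewrite !mxE eqxx.
    have dd := is_deriveD (is_derive_cst (x 0 l) (0 : R) (1 : R))
      (is_deriveM (is_derive_id (0 : R) (1 : R)) (is_derive_cst ((l == i)%:R : R) (0 : R) (1 : R))).
    by apply: (is_derive_eq dd); rewrite scaler0 add0r add0r /GRing.scale /= mulr1.
  have dm := is_deriveB d0 (is_deriveM d1 d2).
  have -> : (fun s => c s 0 l) = (fun s => (x + s *: e_ i) 0 l) -
      (fun s => d (x + s *: e_ i, t)) * (fun s => D l d (x + s *: e_ i, t)).
    by apply/funext => s; rewrite /c mxE.
  by apply: (is_derive_eq dm); rewrite scale0r addr0.
have dcv := is_derive_row dc.
have c0E : c 0 = y by rewrite -cE// scale0r addr0.
have := is_derive_comp_diff dcv (f := h); rewrite c0E => /(_ dh).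
rewrite diff_coord_sum// => H.
have {}H : is_derive (0 : R) (1 : R) (fun s => lift zeta (x + s *: e_ i, t))
   (\sum_l (\row_l ((l == i)%:R - (d (x, t) * D i (D l d) (x, t) + D l d (x, t) * D i d (x, t)))) 0 l * 'D_(e_ l) h y).
  apply: near_eq_is_derive H.
  have cc : {for 0, continuous c}.
    have [cd _] := dcv.
    by apply: differentiable_continuous; exact/derivable1_diffP.
  have nh : \forall s \near (0 : R), Gamma t (c s) -> h (c s) = zeta (c s, t).
    have cc' : c s @[s --> (0 : R)] --> y by rewrite -c0E; exact: cc.
    exact: (cc' _ hE).
  near=> s; have As : A0 (x + s *: e_ i, t) by near: s.
  rewrite /lift_normal /= cE//; have [Gs _] := tubeE As.
  by rewrite (near nh s)//= -cE.
apply: is_derive_eq H _; rewrite /lift_grad /lift_normal /=.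
rewrite -/y /tD !GE.
pose g l := 'D_(e_ l) h y; pose N l := D l d (x, t); pose H l := D i (D l d) (x, t).
pose ka := \sum_l g l * N l.
have NE l : nu (y, t) 0 l = N l by rewrite /N partial_level_proj.
have kaE : \sum_l 'D_(e_ l) h y * nu (y, t) 0 l = ka.
  by apply: eq_bigr => l _; rewrite NE.
have HN : \sum_l H l * N l = 0.
  rewrite -[RHS](level_hess_normal i Ap); apply: eq_bigr => l _.
  by rewrite mulrC.
rewrite (eq_bigr (fun l => (l == i)%:R * g l - d (x, t) * (H l * g l) - N i * (g l * N l))); last first.
  move=> l _; rewrite [X in X * _]mxE -/(g l) -/(H l) -/(N l) -/(N i).
  by move: (g l) (H l) (N l) (N i) (d (x, t)) ((l == i)%:R : R) => a1 a2 a3 a4 a5 a6; ring.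
rewrite !sumrB -!mulr_sumr -/ka (bigD1 i)//= eqxx mul1r big1 ?addr0; last first.
  by move=> l /negbTE ->; rewrite mul0r.
rewrite kaE NE [in RHS](eq_bigr (fun l => H l * g l - ka * (H l * N l))); last first.
  move=> l _; rewrite GE kaE NE -/(g l) -/(H l).
  by move: (g l) (H l) (N l) (ka) => a1 a2 a3 a4; ring.
rewrite sumrB -mulr_sumr HN -/(g i).
by move: (g i) (N i) (ka) (d (x, t)) (\sum_l H l * g l) => a1 a2 a3 a4 a5; ring.
Unshelve. all: by end_near. Qed.

Definition lift_second (zeta : space_time R n -> R) (i : 'I_n) (p : space_time R n) : R :=
  lift_grad (tD i zeta) i p -
  (d p * (\sum_l (D i (D l d) p * lift_grad (tD l zeta) i p +
                  lift (tD l zeta) p * D i (D i (D l d)) p)) +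
   (\sum_l D i (D l d) p * lift (tD l zeta) p) * D i d p).

Lemma lift_grad_partial zeta p i : A0 p ->
  (forall l, tdifferentiable Gamma nu (tD l zeta) (pj p, p.2)) ->
  is_derive p.1 (e_ i) (fun z => lift_grad zeta i (z, p.2)) (lift_second zeta i p).
Proof.
move=> Ap Tz.
have d0 := tame_is_derive AA i (level_tame) Ap.
have dH l := tame_is_derive AA i (tame_partial AA i (tame_partial AA l (level_tame))) Ap.
have dl l := lift_partial i Ap (Tz l).
have ds : is_derive p.1 (e_ i)
    (\sum_l (fun z => D i (D l d) (z, p.2)) * (fun z => lift (tD l zeta) (z, p.2)))
    (\sum_l (D i (D l d) p * lift_grad (tD l zeta) i p +
                  lift (tD l zeta) p * D i (D i (D l d)) p)).
  apply: is_derive_sum => l; have := is_deriveM (dH l) (dl l).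
  by rewrite -surjective_pairing.
have := is_deriveB (dl i) (is_deriveM d0 ds).
have -> : (fun z => lift_grad zeta i (z, p.2)) = (fun z => lift (tD i zeta) (z, p.2)) -
   (fun z => d (z, p.2)) * (\sum_l (fun z => D i (D l d) (z, p.2)) * (fun z => lift (tD l zeta) (z, p.2))).
  apply/funext => z; rewrite /lift_grad -[RHS]/(_ - _ * (\sum_l _) z) fct_sumE.
  by [].
move=> H; apply: is_derive_eq H _; rewrite /lift_second fct_sumE -surjective_pairing.
rewrite [X in X *: D i d p](_ : _ = \sum_l D i (D l d) p * lift (tD l zeta) p); last first.
  apply: eq_bigr => l _.
  by rewrite -[LHS]/(D i (D l d) (p.1, p.2) * lift _ (p.1, p.2)) -surjective_pairing.
by [].
Qed.

(** * Curves following the normal flow *)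

(** The signed distance vanishes along the normal flow, whose velocity is V
grad d. *)
Lemma velocity_level t y (Y : 'rV[R]_n) : 0 <= t <= T -> Gamma 0 Y -> Phinu (Y, t) = y ->
  V (y, t) = - Dt d (y, t).
Proof.
move=> tT GY YE.
have Gs s : 0 <= s <= T -> Gamma s (Phinu (Y, s)).
  by move=> sT; have [_ [fn _ _] _] := normal_flow_diffeo (ts_flow ts) sT; exact: fn.
have Gy : Gamma t y by rewrite -YE; exact: Gs.
have Ay := surface_open_tube tT Gy.
have dP : has_dq `[0, T] (fun s => Phinu (Y, s)) t (V (y, t) *: nu (y, t)).
  by have := normal_flow_ode (ts_flow ts) GY tT; rewrite YE.
have := @tame_curve _ _ _ _ _ AA d (fun s => Phinu (Y, s)) t (V (y, t) *: nu (y, t)) (level_tame).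
rewrite /= YE => /(_ Ay dP) H.
have H0 : has_dq `[0, T] (fun s => 0 : R) t (Dt d (y, t) + \sum_i (V (y, t) *: nu (y, t)) 0 i * D i d (y, t)).
  apply: dq_near_eq H; first by rewrite YE (level_surface tT Gy).
  near=> s; have sT : (`[0, T]%classic : set R) s by near: s; exact: withinT.
  rewrite /= in_itv /= in sT; exact: (level_surface sT (Gs _ sT)).
have := dq_unique (ts_T ts) tT H0 (@dq_cst R R _ 0 _).
rewrite (eq_bigr (fun i => V (y, t) * (D i d (y, t) * D i d (y, t)))); last first.
  by move=> i _; rewrite mxE -(partial_level_surface)//; ring.
rewrite -mulr_sumr (eikonal Ay) mulr1 => E.
by apply/eqP; rewrite -addr_eq0 addrC E.
Unshelve. all: by end_near. Qed.

Lemma foot_on_flow p : A0 p -> exists Y, [/\ Gamma 0 Y, Phinu (Y, p.2) = pj p &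
  Y = xget 0 [set Y | Gamma 0 Y /\ Phinu (Y, p.2) = pj p]].
Proof.
move=> Ap; have [Gp _] := tubeE Ap; have pT := rop_time AA Ap.
have [_ [_ _ sj] _] := normal_flow_diffeo (ts_flow ts) pT.
have [Y0 GY0 Y0E] := sj _ Gp.
exists (xget 0 [set Y | Gamma 0 Y /\ Phinu (Y, p.2) = pj p]).
by case: xgetP => [Y _ [GY YE]|/(_ Y0)]; [|case].
Qed.

Lemma surface_velocity t y : 0 <= t <= T -> Gamma t y -> V (y, t) = - Dt d (y, t).
Proof.
move=> tT Gy; have [_ [_ _ sj] _] := normal_flow_diffeo (ts_flow ts) tT.
by have [Y GY YE] := sj _ Gy; exact: velocity_level GY YE.
Qed.

(** The curve Phinu (Y, s) + d(p) nu (Phinu (Y, s), s), where Phinu (Y, .)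
passes through the foot of p. It stays at constant distance from the surface,
and lifted functions are evaluated along it on a normal trajectory, which is
where they have a time derivative. *)
Lemma normal_curve p : A0 p -> exists (xi : R -> 'rV[R]_n) (v : 'rV[R]_n),
  [/\ xi p.2 = p.1, has_dq `[0, T] xi p.2 v,
     forall i, v 0 i = - Dt d (pj p, p.2) * D i d p + d p * Dt (D i d) (pj p, p.2),
     forall s, 0 <= s <= T -> A0 (xi s, s) /\ d (xi s, s) = d p &
     forall f s, 0 <= s <= T ->
       lift f (xi s, s) = f (normal_trajectory Gamma Phinu (pj p, p.2) s)].
Proof.
move=> Ap; have [Gp pE] := tubeE Ap; have pT := rop_time AA Ap.
have [Y [GY YE YX]] := foot_on_flow Ap.
have Gs s : 0 <= s <= T -> Gamma s (Phinu (Y, s)).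
  by move=> sT; have [_ [fn _ _] _] := normal_flow_diffeo (ts_flow ts) sT; exact: fn.
have Ay := surface_open_tube pT Gp.
have rd : `|d p| < delta by case: Ap.
pose r := d p; pose y := pj p; pose t := p.2.
pose N s : 'rV[R]_n := \row_i D i d (Phinu (Y, s), s).
have NE s : 0 <= s <= T -> N s = nu (Phinu (Y, s), s).
  move=> sT; apply/rowP => i; rewrite mxE (partial_level_surface)//.
  exact: Gs.
pose xi s := Phinu (Y, s) + r *: N s.
have VE := surface_velocity pT Gp.
have dP : has_dq `[0, T] (fun s => Phinu (Y, s)) t (V (y, t) *: nu (y, t)).
  by have := normal_flow_ode (ts_flow ts) GY pT; rewrite YE.
have dN i : has_dq `[0, T] (fun s => D i d (Phinu (Y, s), s)) t (Dt (D i d) (y, t)).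
  have := @tame_curve _ _ _ _ _ AA (D i d) (fun s => Phinu (Y, s)) t (V (y, t) *: nu (y, t)) (tame_partial AA i (level_tame)).
  rewrite /= YE => /(_ Ay dP).
  rewrite (eq_bigr (fun j => V (y, t) * (D j d (y, t) * D j (D i d) (y, t)))); last first.
    by move=> j _; rewrite mxE -(partial_level_surface)//; ring.
  by rewrite -mulr_sumr (level_hess_normal' i Ay) mulr0 addr0.
have dxi : has_dq `[0, T] xi t (V (y, t) *: nu (y, t) + (r *: (\row_i Dt (D i d) (y, t)) + 0 *: N t)).
  by apply: dqD => //; apply: dqZ; [exact: dq_cst|exact: dq_row].
exists xi, (V (y, t) *: nu (y, t) + (r *: (\row_i Dt (D i d) (y, t)) + 0 *: N t)).
split => //.
- by rewrite /xi NE// -/t YE -/y [RHS]pE.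
- move=> i; rewrite !mxE mul0r addr0 VE; congr (_ * _ + _).
  by rewrite partial_level_proj.
- move=> s sT; rewrite /xi NE//; split.
    exact: (normal_line_tube sT (Gs _ sT) rd).
  exact: (normal_line_level sT (Gs _ sT) rd).
- move=> f s sT; rewrite /lift_normal /normal_trajectory /= -YX /xi NE//.
  by rewrite (normal_line_proj sT (Gs _ sT) rd).
Qed.

Let tdt : tame (Dt d) := tame_time AA level_tame.
Let tN j : tame (D j d) := tame_partial AA j level_tame.
Let tH j l : tame (D j (D l d)) := tame_partial AA j (tN l).

(** * The weight and the barrier *)

Context {eps0 c : R} {g0 g1 : space_time R n -> R}.
Hypothesis tw : thin_width T Gamma delta eps0 c g0 g1.
Hypothesis dg0 : depends_only_on_time T Gamma g0.
Hypothesis dg1 : depends_only_on_time T Gamma g1.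
Local Notation G0 := (lift g0).
Local Notation G1 := (lift g1).
Let tG0 : tame G0 := lift_tame (thin_width_g0_smooth tw).
Let tG1 : tame G1 := lift_tame (thin_width_g1_smooth tw).
Let cG0 : timelike A0 G0 := lift_timelike dg0.
Let cG1 : timelike A0 G1 := lift_timelike dg1.

Lemma lift_gap p : A0 p -> c <= G1 p - G0 p.
Proof.
move=> Ap; have [Gp _] := tubeE Ap; apply: (thin_width_lb tw (p := (pj p, p.2))).
by split; rewrite //= in_itv; exact: (rop_time AA Ap).
Qed.

(** Distance to the inner boundary component. *)
Definition height (eps : R) p : R := d p - eps * G0 p.
Definition gap p : R := G1 p - G0 p.
Definition gap_dt p : R := Dt G1 p - Dt G0 p.
(** Logarithmic time derivative of the width. *)
Definition gap_rate p : R := gap_dt p * (gap p)^-1.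
Definition gap_rate_dt p : R :=
  gap_dt p * (gap_dt p * - (gap p) ^- 2) + (Dt (Dt G1) p - Dt (Dt G0) p) * (gap p)^-1.
(** The time derivative of the height; on the inner boundary it is minus the
velocity in the direction grad d. *)
Definition slip (eps : R) p : R := Dt d p - eps * Dt G0 p.
Definition slip_dt (eps : R) p : R := Dt (Dt d) p - eps * Dt (Dt G0) p.
(** Chosen so that its derivative along grad d, which is gap_rate * height -
slip, is the velocity of each boundary component in that direction: at the
inner one the height is 0, and at the outer one it is eps times the width, so
that gap_rate * height is eps times the time derivative of the width. *)
Definition weight (eps : R) p : R :=
  - (height eps p * slip eps p) + 2^-1 * (gap_rate p * (height eps p * height eps p)).
(** The product of the heights above the inner and the outer boundary; it
increases outwards at both. *)
Definition barrier (eps : R) p : R := height eps p * height eps p - eps * (gap p * height eps p).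

Definition weight_grad (eps : R) i p : R :=
  partial i d p * (gap_rate p * height eps p - slip eps p) - height eps p * partial i (Dt d) p.
Definition weight_second (eps : R) i p : R :=
  - (height eps p * partial i (partial i (Dt d)) p
     + 2 * (partial i d p * partial i (Dt d) p) + partial i (partial i d) p * slip eps p)
  + gap_rate p * (height eps p * partial i (partial i d) p + partial i d p * partial i d p).
Definition weight_dt (eps : R) p : R :=
  - (height eps p * slip_dt eps p + slip eps p * slip eps p)
  + 2^-1 * (gap_rate_dt p * (height eps p * height eps p)) + gap_rate p * (height eps p * slip eps p).

Definition barrier_grad (eps : R) i p : R := (2 * height eps p - eps * gap p) * partial i d p.
Definition barrier_second (eps : R) i p : R :=
  (2 * height eps p - eps * gap p) * partial i (partial i d) p + 2 * (partial i d p * partial i d p).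
Definition barrier_dt (eps : R) p : R :=
  (2 * height eps p - eps * gap p) * slip eps p - eps * (gap_dt p * height eps p).

Section thin_jets.
Variables (eps : R) (xi : R -> 'rV[R]_n) (v : 'rV[R]_n) (p : space_time R n).
Hypotheses (Ap : A0 p) (xip : xi p.2 = p.1) (xiv : has_dq `[0, T] xi p.2 v).
Local Notation pjet := (pjet T xi v p).

Lemma near_axis_tube i : \forall s \near (0 : R), A0 (p.1 + s *: e_ i, p.2).
Proof. by apply: (near_axis); rewrite -surjective_pairing. Qed.

Lemma pjet_tame f : tame f -> pjet f (fun i => D i f p) (fun i => D i (D i f) p) (Dt f p).
Proof.
move=> tf; split=> [i|]; last first.
  by have := tame_curve AA (xi := xi) (t := p.2) (v := v) tf;
     rewrite xip -surjective_pairing; apply.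
exists (fun s => D i f (p.1 + s *: e_ i, p.2)); split.
- have := near_axis_tube i; apply: filterS => s As; exact: (tame_axis).
- by rewrite scale0r addr0 -surjective_pairing.
- have H := @tame_axis (D i f) p.1 p.2 0 i (tame_partial AA i tf).
  by move: H; rewrite scale0r addr0 -surjective_pairing; apply.
Qed.

Lemma timelike_axis f i : timelike A0 f ->
  \forall s \near (0 : R), f (p.1 + s *: e_ i, p.2) = f p.
Proof. by move=> tf; apply: filterS (near_axis_tube i) => s As; exact: tf. Qed.

Lemma pjet_timelike f : tame f -> timelike A0 f -> pjet f (fun=> 0) (fun=> 0) (Dt f p).
Proof.
move=> tf cf; split=> [i|].
  apply: jet2_near (jet2_cst (f p)).
  by apply: filterS (timelike_axis i cf) => s ->.
have [_] := pjet_tame tf.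
rewrite !big1// => i _; first by rewrite mulr0.
by rewrite (timelike_partial)// mulr0.
Qed.

Lemma gap_gt0 q : A0 q -> 0 < gap q.
Proof. move=> Aq; exact: lt_le_trans (thin_width_const_gt0 tw) (lift_gap Aq). Qed.

Lemma pjet_gap : pjet (gap) (fun=> 0) (fun=> 0) (gap_dt p).
Proof.
apply: (pjet_ext (pjetB xip (pjet_timelike tG1 cG1) (pjet_timelike tG0 cG0))) => //;
by move=> i; rewrite subr0.
Qed.

Lemma timelike_gap_rate : timelike A0 (gap_rate).
Proof.
move=> q r Aq Ar qr; rewrite /gap_rate /gap_dt /gap (cG0 Aq Ar qr) (cG1 Aq Ar qr).
by rewrite (timelike_time tG0 cG0 Aq Ar qr) (timelike_time tG1 cG1 Aq Ar qr).
Qed.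

Lemma pjet_gap_rate :
  pjet (gap_rate) (fun=> 0) (fun=> 0) (gap_rate_dt p).
Proof.
split=> [i|].
  apply: jet2_near (jet2_cst (gap_rate p)).
  by apply: filterS (timelike_axis i timelike_gap_rate) => s ->.
have gn : gap p != 0 by rewrite gt_eqF ?gap_gt0.
have [_ Hg] := pjet_gap.
have [_ Hd] := pjetB xip
  (pjet_timelike (tame_time AA tG1) (timelike_time tG1 cG1))
  (pjet_timelike (tame_time AA tG0) (timelike_time tG0 cG0)).
have dV : is_derive (gap (xi p.2, p.2)) (1 : R) (fun x : R => x^-1)
    (- (gap p) ^- 2).
  rewrite xip -surjective_pairing.
  have := @is_deriveV R id (gap p) 1 1 gn (is_derive_id _ _).
  by rewrite /GRing.scale /= mulr1.
have z1 : \sum_i v 0 i * (0 : R) = 0 by apply: big1 => i _; rewrite mulr0.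
have z2 : \sum_i v 0 i * ((0 : R) - 0) = 0 by apply: big1 => i _; rewrite subr0 mulr0.
have := dqM Hd (dq_comp Hg dV).
rewrite /comp z1 z2 !addr0 xip -surjective_pairing.
exact: id.
Qed.

Lemma pjet_height :
  pjet (height eps) (fun i => D i d p) (fun i => D i (D i d) p)
    (slip eps p).
Proof.
apply: (pjet_ext (pjetB xip (pjet_tame (level_tame)) (pjetZ xip eps (pjet_timelike tG0 cG0)))) => //;
by move=> i; rewrite mulr0 subr0.
Qed.

Lemma pjet_slip :
  pjet (slip eps) (fun i => D i (Dt d) p) (fun i => D i (D i (Dt d)) p)
    (slip_dt eps p).
Proof.
apply: (pjet_ext (pjetB xip (pjet_tame (tame_time AA (level_tame)))
  (pjetZ xip eps (pjet_timelike (tame_time AA tG0) (timelike_time tG0 cG0))))) => //;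
by move=> i; rewrite mulr0 subr0.
Qed.

Lemma pjet_weight : pjet (weight eps)
  (fun i => weight_grad eps i p)
  (fun i => weight_second eps i p)
  (weight_dt eps p).
Proof.
have H := pjetD (pjetZ xip (-1) (pjetM xip pjet_height pjet_slip))
  (pjetZ xip 2^-1 (pjetM xip pjet_gap_rate (pjetM xip pjet_height pjet_height))).
apply: (pjet_fun_ext (f := fun q => -1 * (height eps q * slip eps q) +
  2^-1 * (gap_rate q * (height eps q * height eps q)))).
  by move=> q; rewrite mulN1r.
apply: (pjet_ext H) => [i|i|].
- rewrite /weight_grad; move: (height _ _) (slip _ _) (gap_rate _) (D i d p) (D i _ p) => x1 x2 x3 x4 x5.
  by field.
- rewrite /weight_second; move: (height _ _) (slip _ _) (gap_rate _) (D i d p) (D i (Dt d) p) (D i (D i d) p) (D i (D i (Dt d)) p) => x1 x2 x3 x4 x5 x6 x7.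
  by field.
- rewrite /weight_dt; move: (height _ _) (slip _ _) (gap_rate _) (slip_dt _ _) (gap_rate_dt _) => x1 x2 x3 x4 x5.
  by field.
Qed.

Lemma pjet_barrier : pjet (barrier eps)
  (fun i => barrier_grad eps i p)
  (fun i => barrier_second eps i p)
  (barrier_dt eps p).
Proof.
have H := pjetB xip (pjetM xip pjet_height pjet_height)
  (pjetZ xip eps (pjetM xip pjet_gap pjet_height)).
apply: (pjet_ext H) => [i|i|].
- rewrite /barrier_grad; move: (height _ _) (gap _) (D i d p) => x1 x2 x3; ring.
- rewrite /barrier_second; move: (height _ _) (gap _) (D i d p) (D i (D i d) p) => x1 x2 x3 x4; ring.
- rewrite /barrier_dt; move: (height _ _) (gap _) (slip _ _) (gap_dt _) => x1 x2 x3 x4; ring.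
Qed.

(** The third component is imposed by the derivative along the curve, the only
one available in time. *)
Lemma pjet_lift eta (a3 : R) : 0 < p.2 ->
  (forall q, spread `]0, T] Gamma q -> tdifferentiable Gamma nu eta q) ->
  (forall j q, spread `]0, T] Gamma q -> tdifferentiable Gamma nu (tD j eta) q) ->
  has_dq `[0, T] (fun s => lift eta (xi s, s)) p.2 a3 ->
  pjet (lift eta) (fun i => lift_grad eta i p)
    (fun i => lift_second eta i p)
    (a3 - \sum_i v 0 i * lift_grad eta i p).
Proof.
move=> p0 d1 d2 Ha; split; last by rewrite subrK.
move=> i.
have S q : A0 q -> q.2 = p.2 -> spread `]0, T] Gamma (pj q, q.2).
  move=> Aq qp; have [Gq _] := tubeE Aq; split => //=.
  by rewrite in_itv /= qp p0; have /andP[_] := rop_time AA Ap.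
exists (fun s => lift_grad eta i (p.1 + s *: e_ i, p.2)); split.
- apply: filterS (near_axis_tube i) => s As.
  have := lift_partial i As (d1 _ (S _ As erefl)).
  by move=> H; exact: (proj1 (is_derive_line (fun z => lift eta (z, p.2)) p.1 (e_ i) s _)).
- by rewrite scale0r addr0 -surjective_pairing.
- have H := lift_grad_partial i Ap (fun l => d2 l _ (S _ Ap erefl)).
  apply: (proj1 (is_derive_line (fun z => lift_grad eta i (z, p.2)) p.1 (e_ i) 0 _)).
  by rewrite scale0r addr0.
Qed.

End thin_jets.

(** * Bounds uniform in the thickness *)

Local Notation index := ((R * space_time R n) * ((space_time R n -> R) * R))%type.
Local Notation ep i := (i.1.1).
Local Notation pt i := (i.1.2).
Local Notation et i := (i.2.1).
Local Notation Nn i := (i.2.2).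

(** An index is a pair ((eps, p), (eta, N)): a thickness and a point of the
corresponding closed thin domain, together with a function and a bound for its
norm, used in limit_index only. A single type for both keeps the bounds
composable. *)
Definition thin_index : set index :=
  [set i | [/\ 0 < ep i < eps0, A0 (pt i) & ep i * G0 (pt i) <= d (pt i) <= ep i * G1 (pt i)]].

Local Notation bd := (dominated thin_index (fun=> 1)).
Local Notation small := (dominated thin_index (fun i => ep i)).

Lemma index_eps i : thin_index i -> 0 < ep i <= 1.
Proof.
move=> [/andP[e0 e1] _ _]; rewrite e0 (le_trans (ltW e1))//.
by have /andP[_ /ltW] := thin_width_eps0 tw.
Qed.

Lemma small_bd X : small X -> bd X.
Proof. by apply: dom_weight => i /index_eps/andP[]. Qed.

Lemma tame_bd f : tame f -> bd (fun i => f (pt i)).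
Proof.
move=> /(tame_bounded)[M [M0 H]]; exists M => // i [_ Ai _].
by rewrite mulr1; exact: H.
Qed.

Lemma foot_tube p : A0 p -> A0 (pj p, p.2).
Proof.
move=> Ap; apply: (surface_open_tube); first exact: (rop_time AA Ap).
by have [] := tubeE Ap.
Qed.

Lemma tame_bd_foot f : tame f -> bd (fun i => f (pj (pt i), (pt i).2)).
Proof.
move=> /(tame_bounded)[M [M0 H]]; exists M => // i [_ Ai _].
by rewrite mulr1; apply/H/foot_tube.
Qed.

Lemma eps_small : small (fun i => ep i).
Proof. by exists 1 => // i /index_eps/andP[e0 _]; rewrite mul1r gtr0_norm. Qed.

(** In the closed thin domain eps g0 <= d <= eps g1. *)
Lemma level_small : small (fun i => d (pt i)).
Proof.
have [M [M0 H0]] := tame_bounded tG0; have [M' [M'0 H1]] := tame_bounded tG1.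
exists (M + M'); first exact: addr_ge0.
move=> i Si; have /andP[e0 _] := index_eps Si; have [_ Ai /andP[d0 d1]] := Si.
have h0 := ler_wpM2l (ltW e0) (H0 _ Ai); have h1 := ler_wpM2l (ltW e0) (H1 _ Ai).
have p0 := mulr_ge0 (ltW e0) M0; have p1 := mulr_ge0 (ltW e0) M'0.
have a0 := ler_wpM2l (ltW e0) (ler_norm (- G0 (pt i))).
have a1 := ler_wpM2l (ltW e0) (ler_norm (G1 (pt i))).
rewrite normrN in a0.
by rewrite ler_norml; apply/andP; split; lra.
Qed.

Lemma height_small : small (fun i => height (ep i) (pt i)).
Proof. by apply: domB level_small _; apply: domMr eps_small _; exact: tame_bd. Qed.

Lemma slip_bd : bd (fun i => slip (ep i) (pt i)).
Proof.
apply: domB (tame_bd tdt) _; apply: domMl (small_bd eps_small) _.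
exact: (tame_bd (tame_time AA tG0)).
Qed.

Lemma slip_dt_bd : bd (fun i => slip_dt (ep i) (pt i)).
Proof.
apply: domB (tame_bd (tame_time AA tdt)) _; apply: domMl (small_bd eps_small) _.
exact: (tame_bd (tame_time AA (tame_time AA tG0))).
Qed.

Lemma gap_bd : bd (fun i => gap (pt i)).
Proof. by apply: domB; exact: tame_bd. Qed.

Lemma gap_dt_bd : bd (fun i => gap_dt (pt i)).
Proof. by apply: domB; apply: tame_bd; exact: tame_time. Qed.

Lemma gap_inv_bd : bd (fun i => (gap (pt i))^-1).
Proof.
have cp := thin_width_const_gt0 tw.
exists c^-1; first by rewrite invr_ge0 ltW.
move=> i [_ Ai _]; have gp := gap_gt0 Ai.
rewrite mulr1 normfV gtr0_norm// lef_pV2 ?posrE//.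
exact: (lift_gap Ai).
Qed.

Lemma gap_rate_bd : bd (fun i => gap_rate (pt i)).
Proof. by apply: domMl; [exact: gap_dt_bd|exact: gap_inv_bd]. Qed.

Lemma gap_rate_dt_bd : bd (fun i => gap_rate_dt (pt i)).
Proof.
apply: domD; apply: domMl => //; try exact: gap_dt_bd; try exact: gap_inv_bd.
  apply: domMl; first exact: gap_dt_bd.
  apply: dom_opp; apply: (dom_ext (X := fun i => (gap (pt i))^-1 * (gap (pt i))^-1)).
    by move=> i _; rewrite -expr2 exprVn.
  by apply: domMl; exact: gap_inv_bd.
by apply: domB; apply: tame_bd; do 2 apply: tame_time => //.
Qed.

(** Each term of the weight has a factor height. *)
Lemma weight_small : small (fun i => weight (ep i) (pt i)).
Proof.
apply: domD.
  by apply: dom_opp; apply: domMr height_small slip_bd.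
apply: domMl; first exact: dom_cst.
apply: domMl; first exact: gap_rate_bd.
by apply: domMr height_small (small_bd height_small).
Qed.

Context {k : R}.
Hypothesis k0 : 0 < k.

(** The mean value theorem on the segment from the point to its foot, whose
length is |d| = O(eps). *)
Lemma lift_small m : tame m -> small (fun i => lift m (pt i) - m (pt i)).
Proof.
move=> tm.
have [M [M0 HM]] := tame_bounded_fam tN.
have [M' [M'0 HM']] := tame_bounded_fam (fun j => tame_partial AA j tm).
pose C := \sum_(j < n) M * M'.
have C0 : 0 <= C by apply: sumr_ge0 => j _; exact: mulr_ge0.
have [B B0 HB] := level_small.
exists (C * B); first exact: mulr_ge0.
move=> i Si; have [_ Ap _] := Si; move: (HB i Si) Ap.
move: (pt i) => -[x t] /= dB Ap; have tT := rop_time AA Ap; rewrite /= in tT.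
have [Gy xE] := tubeE Ap; rewrite /= in Gy xE.
set y := pj (x, t) in Gy xE; set N := nu (y, t) in xE; pose r := d (x, t).
have rd : `|r| < delta by case: Ap.
have As s : 0 <= s <= 1 -> A0 (y + (s * r) *: N, t).
  move=> /andP[s0 s1]; apply: (normal_line_tube) => //.
  by rewrite (le_lt_trans _ rd)// normrM ger0_norm// ler_piMl.
have := @mvt_affine R (fun s => m (y + s *: N, t))
  (fun s => \sum_i N 0 i * D i m (y + s *: N, t)) r 0 C.
have H1 (s : R) : 0 <= s <= 1 -> is_derive (s * r) (1 : R) (fun s => m (y + s *: N, t))
    (\sum_i N 0 i * D i m (y + (s * r) *: N, t)).
  by move=> s01; apply: (tame_line) => //; exact: As.
have H2 (s : R) : 0 <= s <= 1 -> `|\sum_i N 0 i * D i m (y + (s * r) *: N, t) - 0| <= C.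
  move=> s01; rewrite subr0 (le_trans (ler_norm_sum _ _ _))//.
  apply: ler_sum => j _; rewrite normrM ler_pM//; last exact: HM' (As _ s01).
  by rewrite /N -(partial_level_surface)//; apply: HM; exact: (surface_open_tube).
move=> /(_ H1 H2); rewrite mulr0 subr0 scale0r addr0 /r -/y -xE => H.
rewrite /lift_normal /= -/y distrC -mulrA (le_trans H)// ler_wpM2l//.
Qed.

(** The coefficient of the height in the expansion of the potential. *)
Definition weight_remainder (e : R) (p : space_time R n) : R :=
  - (\sum_i D i (D i (Dt d)) p) + gap_rate p * (\sum_i D i (D i d) p)
  + k^-1 * (2 * (slip e p * gap_rate p)
       - height e p * (\sum_i D i (Dt d) p ^+ 2)
       - gap_rate p ^+ 2 * height e p + slip_dt e p
       - 2^-1 * (gap_rate_dt p * height e p) - gap_rate p * slip e p).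

Lemma weight_potentialE (e : R) p : A0 p ->
  weight_potential k (fun i => weight_grad e i p) (fun i => weight_second e i p)
    (weight_dt e p) =
  gap_rate p - slip e p * (\sum_i D i (D i d) p) + height e p * weight_remainder e p.
Proof. by move=> Ap; apply: potential_expansion; [|exact: (eikonal)|exact: (level_time_normal)]. Qed.

Lemma weight_remainder_bd : bd (fun i => weight_remainder (ep i) (pt i)).
Proof.
have tL j : tame (D j (D j d)) := tame_partial AA j (tN j).
have tQ j : tame (D j (Dt d)) := tame_partial AA j tdt.
have p1 i : thin_index i -> (0 : R) <= 1 by rewrite ler01.
have hB : bd (fun i => height (ep i) (pt i)) by apply: (small_bd); exact: (height_small).
have sB : bd (fun i => slip (ep i) (pt i)) by exact: (slip_bd).
have bB : bd (fun i => gap_rate (pt i)) by exact: (gap_rate_bd).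
apply: domD; first apply: domD.
- by apply: dom_opp; apply: dom_sum => // j; apply: (tame_bd); exact: (tame_partial AA j (tQ j)).
- apply: domMl; first exact: (gap_rate_bd).
  by apply: dom_sum => // j; apply: (tame_bd).
- apply: domMl; first exact: dom_cst.
  apply: domB; last by apply: domMl.
  apply: domB; last first.
    apply: domMl; first exact: dom_cst.
    by apply: domMl; [exact: (gap_rate_dt_bd)|].
  apply: domD; last exact: (slip_dt_bd).
  apply: domB; last by apply: domMl => //; rewrite [X in bd X](_ : _ = fun i => gap_rate (pt i) * gap_rate (pt i))//; exact: domMl.
  apply: domB; first by apply: domMl; [exact: dom_cst|exact: domMl].
  apply: domMl => //; apply: dom_sum => // j.
  rewrite [X in bd X](_ : _ = fun i => D j (Dt d) (pt i) * D j (Dt d) (pt i))//.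
  by apply: domMl; exact: (tame_bd).
Qed.

(** * The lifted limit solution in the conjugated equation *)

Definition surface_regular (eta : space_time R n -> R) : Prop :=
  forall q, spread `]0, T] Gamma q ->
    tdifferentiable Gamma nu eta q /\ forall j, tdifferentiable Gamma nu (tD j eta) q.

(** The functions are those twice differentiable along the surface whose
lifted derivatives at the point are bounded by N. *)
Definition limit_index : set index :=
  [set i | [/\ thin_index i, 0 < (pt i).2, surface_regular (et i), `|lift (et i) (pt i)| <= Nn i &
    [/\ `|normal_dt T Gamma Phinu (et i) (pj (pt i), (pt i).2)| <= Nn i,
     forall j, `|lift (tD j (et i)) (pt i)| <= Nn i &
     forall j l, `|lift (tD j (tD l (et i))) (pt i)| <= Nn i]]].

Local Notation bd2 := (dominated limit_index (fun=> 1)).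
Local Notation domN := (dominated limit_index (fun i => Nn i)).
Local Notation small2 := (dominated limit_index (fun i => ep i)).

Lemma limit_thin : limit_index `<=` thin_index. Proof. by move=> i []. Qed.

Lemma limit_N0 i : limit_index i -> 0 <= Nn i.
Proof. by move=> [_ _ _ + _]; exact: le_trans. Qed.

Lemma foot_spread p : A0 p -> 0 < p.2 -> spread `]0, T] Gamma (pj p, p.2).
Proof.
move=> Ap p0; have [Gp _] := tubeE Ap; split => //=.
by rewrite in_itv /= p0; have /andP[] := rop_time AA Ap.
Qed.

Lemma normal_hess_sum p (a : 'I_n -> R) : A0 p ->
  \sum_i D i d p * (\sum_l D i (D l d) p * a l) = 0.
Proof.
move=> Ap; transitivity (\sum_l a l * (\sum_i D i d p * D i (D l d) p)).
  rewrite (eq_bigr (fun i => \sum_l a l * (D i d p * D i (D l d) p))); last first.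
    by move=> i _; rewrite mulr_sumr; apply: eq_bigr => l _; ring.
  by rewrite exchange_big; apply: eq_bigr => l _; rewrite mulr_sumr.
by apply: big1 => l _; rewrite (level_hess_normal' l Ap) mulr0.
Qed.

(** A lifted function is constant along normals. *)
Lemma lift_grad_normal eta p : A0 p -> tdifferentiable Gamma nu eta (pj p, p.2) ->
  \sum_i D i d p * lift_grad eta i p = 0.
Proof.
move=> Ap de; rewrite /lift_grad.
rewrite (eq_bigr (fun i => D i d p * lift (tD i eta) p -
   d p * (D i d p * \sum_l D i (D l d) p * lift (tD l eta) p))); last first.
  by move=> i _; rewrite mulrBr mulrCA.
by rewrite sumrB -mulr_sumr normal_hess_sum// mulr0 subr0; exact: (tD_normal).
Qed.

Definition second_remainder eta i p : R :=
  (\sum_l D i (D l d) p * lift (tD l (tD i eta)) p)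
  + (\sum_l (D i (D l d) p * lift_grad (tD l eta) i p +
                  lift (tD l eta) p * D i (D i (D l d)) p)).

(** The term without the factor d that distinguishes the Laplacian of the lift
from the sum of the second tangential derivatives is grad d . D^2 d, which
vanishes. *)
Lemma lift_second_sum eta p : A0 p ->
  \sum_i lift_second eta i p =
  \sum_i lift (tD i (tD i eta)) p - d p * \sum_i second_remainder eta i p.
Proof.
move=> Ap; rewrite /lift_second mulr_sumr -sumrB.
pose W i := \sum_l D i (D l d) p * lift (tD l eta) p.
have W0 : \sum_i D i d p * W i = 0 := normal_hess_sum (fun l => lift (tD l eta) p) Ap.
transitivity (\sum_i (lift (tD i (tD i eta)) p - d p * second_remainder eta i p) -
   \sum_i D i d p * W i); last by rewrite W0 subr0.
rewrite -sumrB.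
apply: eq_bigr => i _; rewrite {1}/lift_grad /second_remainder -/(W i).
move: (lift (tD i (tD i eta)) p) (d p) (D i d p) (W i) => x1 x2 x3 x4.
by move: (\sum_l _) (\sum_l _) => x5 x6; ring.
Qed.

(** The velocity at p of the curve of normal_curve. *)
Definition trajectory_velocity (i : 'I_n) (p : space_time R n) : R :=
  - Dt d (pj p, p.2) * D i d p + d p * Dt (D i d) (pj p, p.2).

(** The normal part of the velocity does not act on a lifted function, and the
tangential part has a factor d. *)
Lemma velocity_lift_grad eta p : A0 p -> tdifferentiable Gamma nu eta (pj p, p.2) ->
  \sum_i trajectory_velocity i p * lift_grad eta i p =
  d p * \sum_i Dt (D i d) (pj p, p.2) * lift_grad eta i p.
Proof.
move=> Ap de; transitivity (\sum_i (- Dt d (pj p, p.2) * (D i d p * lift_grad eta i p) +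
   d p * (Dt (D i d) (pj p, p.2) * lift_grad eta i p))).
  by apply: eq_bigr => i _; rewrite /trajectory_velocity mulrDl !mulrA.
by rewrite big_split /= -!mulr_sumr lift_grad_normal// mulr0 add0r.
Qed.

(** The part of the gradient of the weight that is not small is normal, hence
does not act on a lifted function. *)
Lemma weight_lift_grad (e : R) eta p : A0 p -> tdifferentiable Gamma nu eta (pj p, p.2) ->
  \sum_i weight_grad e i p * lift_grad eta i p =
  - (height e p * \sum_i D i (Dt d) p * lift_grad eta i p).
Proof.
move=> Ap de; transitivity (\sum_i ((gap_rate p * height e p - slip e p) * (D i d p * lift_grad eta i p) -
   height e p * (D i (Dt d) p * lift_grad eta i p))).
  apply: eq_bigr => i _; rewrite /weight_grad.
  by move: (gap_rate p) (height e p) (slip e p) (D i d p) (D i (Dt d) p) (lift_grad _ _ _) => x1 x2 x3 x4 x5 x6; ring.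
by rewrite sumrB -!mulr_sumr lift_grad_normal// mulr0 sub0r.
Qed.

(** The left-hand side of the limit equation divided by the width, at the foot
of p, with V and H expressed by - d_t d and - Lap d. *)
Definition limit_residual eta (p : space_time R n) : R :=
  normal_dt T Gamma Phinu eta (pj p, p.2) + gap_rate p * lift eta p
  - lift (Dt d) p * (\sum_i lift (D i (D i d)) p) * lift eta p
  - k * (\sum_i lift (tD i (tD i eta)) p).

(** The conjugated operator applied to the jet of the lift of eta, its time
derivative being recovered from the one along normal_curve. *)
Definition lifted_operator (e : R) eta (p : space_time R n) : R :=
  jet_operator k (fun i => weight_grad e i p)
    (weight_potential k (fun i => weight_grad e i p) (fun i => weight_second e i p)
      (weight_dt e p))
    (lift eta p) (fun i => lift_grad eta i p) (fun i => lift_second eta i p)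
    (normal_dt T Gamma Phinu eta (pj p, p.2)
     - \sum_i trajectory_velocity i p * lift_grad eta i p).

(** Substituting the identities for the lifted derivatives and for the
potential, everything of order one cancels. *)
Lemma lifted_operatorE (e : R) eta p : A0 p -> tdifferentiable Gamma nu eta (pj p, p.2) ->
  lifted_operator e eta p - limit_residual eta p =
  - (d p * \sum_i Dt (D i d) (pj p, p.2) * lift_grad eta i p)
  + k * (d p * \sum_i second_remainder eta i p)
  - 2 * (height e p * \sum_i D i (Dt d) p * lift_grad eta i p)
  + ((lift (Dt d) p - Dt d p) * (\sum_i lift (D i (D i d)) p)
     + Dt d p * (\sum_i (lift (D i (D i d)) p - D i (D i d) p))
     + e * (Dt G0 p * (\sum_i D i (D i d) p))
     + height e p * weight_remainder e p) * lift eta p.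
Proof.
move=> Ap de; rewrite /lifted_operator /jet_operator.
rewrite (weight_potentialE)//.
rewrite velocity_lift_grad// lift_second_sum// weight_lift_grad// sumrB.
rewrite /limit_residual /slip.
exact: residual_algebra.
Qed.

Local Notation prodN := (dominated limit_index (fun i => ep i * Nn i)).

Lemma restrict_bd (X : index -> R) : bd X -> bd2 X. Proof. exact: dom_sub limit_thin. Qed.

Lemma restrict_small (X : index -> R) : small X -> small2 X. Proof. exact: dom_sub limit_thin. Qed.

Lemma lift_domN : domN (fun i => lift (et i) (pt i)).
Proof. by exists 1 => // i [_ _ _ H _]; rewrite mul1r. Qed.

Lemma lift_tD_domN j : domN (fun i => lift (tD j (et i)) (pt i)).
Proof. by exists 1 => // i [_ _ _ _ [_ H _]]; rewrite mul1r. Qed.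

Lemma lift_tD2_domN j l : domN (fun i => lift (tD j (tD l (et i))) (pt i)).
Proof. by exists 1 => // i [_ _ _ _ [_ _ H]]; rewrite mul1r. Qed.

Lemma dt_domN : domN (fun i => normal_dt T Gamma Phinu (et i) (pj (pt i), (pt i).2)).
Proof. by exists 1 => // i [_ _ _ _ [H _ _]]; rewrite mul1r. Qed.

Lemma tame_bd2 f : tame f -> bd2 (fun i => f (pt i)).
Proof. by move=> tf; apply/restrict_bd/(tame_bd). Qed.

Lemma lift_bd2 f : tame f -> bd2 (fun i => lift f (pt i)).
Proof. by move=> tf; apply: restrict_bd; exact: (tame_bd_foot tf). Qed.

Lemma level_bd2 : bd2 (fun i => d (pt i)).
Proof. by apply: tame_bd2; exact: (level_tame). Qed.

Lemma lift_grad_domN j : domN (fun i => lift_grad (et i) j (pt i)).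
Proof.
apply: domB (lift_tD_domN j) _; apply: domMl level_bd2 _.
apply: dom_sum; first exact: limit_N0.
by move=> l; apply: domMl (lift_tD_domN l); exact: tame_bd2.
Qed.

Lemma lift_grad2_domN j l : domN (fun i => lift_grad (tD l (et i)) j (pt i)).
Proof.
apply: domB (lift_tD2_domN j l) _; apply: domMl level_bd2 _.
apply: dom_sum; first exact: limit_N0.
by move=> m; apply: domMl (lift_tD2_domN m l); exact: tame_bd2.
Qed.

Lemma second_remainder_domN j : domN (fun i => second_remainder (et i) j (pt i)).
Proof.
apply: domD; (apply: dom_sum; first exact: limit_N0) => l.
  by apply: domMl (lift_tD2_domN l j); exact: tame_bd2.
apply: domD.
  by apply: domMl (lift_grad2_domN j l); exact: tame_bd2.
by apply: domMr (lift_tD_domN l) _; apply: tame_bd2; exact: (tame_partial AA j (tH j l)).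
Qed.

Lemma eps0_2 i : limit_index i -> 0 <= ep i.
Proof. by move=> /limit_thin[/andP[/ltW]]. Qed.

(** Every term of lifted_operatorE has a factor d, height, eps, or a
difference lift m - m, each of order eps, times a quantity bounded by N. *)
Lemma consistency_error :
  prodN (fun i => lifted_operator (ep i) (et i) (pt i) - limit_residual (et i) (pt i)).
Proof.
have dS : small2 (fun i => d (pt i)) by apply: restrict_small; exact: (level_small).
have hS : small2 (fun i => height (ep i) (pt i)) by apply: restrict_small; exact: (height_small).
have eS : small2 (fun i => ep i) by apply: restrict_small; exact: (eps_small).
apply: dom_ext.
  move=> i [[_ Ai _] pi0 re _ _]; symmetry; apply: lifted_operatorE => //.
  by have [] := re _ (foot_spread Ai pi0).
apply: domD; first (apply: domB; first apply: domD).
- apply: dom_opp; apply: (domM dS); apply: dom_sum; first exact: limit_N0.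
  move=> j; apply: domMl (lift_grad_domN j); exact: (lift_bd2 (tame_time AA (tN j))).
- apply: domMl; first exact: dom_cst.
  apply: (domM dS); apply: dom_sum; first exact: limit_N0.
  by move=> j; exact: second_remainder_domN.
- apply: domMl; first exact: dom_cst.
  apply: (domM hS); apply: dom_sum; first exact: limit_N0.
  move=> j; apply: domMl (lift_grad_domN j); exact: (tame_bd2 (tame_partial AA j tdt)).
apply: domM lift_domN; apply: domD; first (apply: domD; first apply: domD).
- apply: domMr; first exact: (restrict_small (lift_small tdt)).
  by apply: dom_sum => // j; exact: lift_bd2.
- apply: domMl; first exact: tame_bd2.
  apply: dom_sum; first exact: eps0_2.
  move=> j; exact: (restrict_small (lift_small (tH j j))).
- apply: domMr eS _; apply: domMl.
    apply: tame_bd2; apply: (tame_time AA).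
    exact: (lift_tame (thin_width_g0_smooth tw)).
  by apply: dom_sum => // j; exact: tame_bd2.
- apply: domMr hS _; apply: restrict_bd; exact: (weight_remainder_bd).
Qed.

(** The limit equation turns this into a bound for its source term by the norm
of the solution. *)
Lemma residual_domN : domN (fun i => limit_residual (et i) (pt i)).
Proof.
apply: domB; first (apply: domB; first apply: domD).
- exact: dt_domN.
- by apply: domMl lift_domN; apply: restrict_bd; exact: (gap_rate_bd).
- apply: domMl lift_domN; apply: domMl; first exact: lift_bd2.
  by apply: dom_sum => // j; exact: lift_bd2.
- apply: domMl; first exact: dom_cst.
  by apply: dom_sum; [exact: limit_N0|move=> j; exact: lift_tD2_domN].
Qed.

Lemma height_bd : bd (fun i => height (ep i) (pt i)).
Proof. by apply: (small_bd); exact: (height_small). Qed.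

Lemma weight_grad_bd j : bd (fun i => weight_grad (ep i) j (pt i)).
Proof.
apply: domB.
  apply: domMl; first exact: (tame_bd (tN j)).
  apply: domB; last exact: (slip_bd).
  by apply: domMl height_bd; exact: (gap_rate_bd).
by apply: domMl; [exact: height_bd|exact: (tame_bd (tame_partial AA j tdt))].
Qed.

Lemma barrier_slope_bd : bd (fun i => 2 * height (ep i) (pt i) - ep i * gap (pt i)).
Proof.
apply: domB; first by apply: domMl height_bd; exact: dom_cst.
apply: domMl; last exact: (gap_bd).
by apply: (small_bd); exact: (eps_small).
Qed.

(** Boundedness suffices, because the barrier enters with a factor that tends
to 0. *)
Lemma barrier_operator_bd : bd (fun i => barrier_dt (ep i) (pt i)
  - k * (\sum_j barrier_second (ep i) j (pt i))
  + 2 * (\sum_j weight_grad (ep i) j (pt i) * barrier_grad (ep i) j (pt i))).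
Proof.
apply: domD; first apply: domB.
- apply: domB; first by apply: domMl barrier_slope_bd _; exact: (slip_bd).
  apply: domMl; first by apply: (small_bd); exact: (eps_small).
  by apply: domMl height_bd; exact: (gap_dt_bd).
- apply: domMl; first exact: dom_cst.
  apply: dom_sum => // j; apply: domD.
    by apply: domMl barrier_slope_bd _; exact: (tame_bd (tH j j)).
  apply: domMl; first exact: dom_cst.
  by apply: domMl; exact: (tame_bd (tN j)).
- apply: domMl; first exact: dom_cst.
  apply: dom_sum => // j; apply: domMl; first exact: weight_grad_bd.
  by apply: domMl barrier_slope_bd _; exact: (tame_bd (tN j)).
Qed.

Lemma barrier_bd : bd (fun i => barrier (ep i) (pt i)).
Proof.
apply: domB; first by apply: domMl; exact: height_bd.
apply: domMl; first by apply: (small_bd); exact: (eps_small).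
by apply: domMl height_bd; exact: (gap_bd).
Qed.

Lemma potential_bd : bd (fun i => weight_potential k
  (fun j => weight_grad (ep i) j (pt i)) (fun j => weight_second (ep i) j (pt i))
  (weight_dt (ep i) (pt i))).
Proof.
apply: dom_ext; first by move=> i [_ Ai _]; symmetry; exact: (weight_potentialE).
apply: domD; last by apply: domMl height_bd _; exact: (weight_remainder_bd).
apply: domB; first exact: (gap_rate_bd).
apply: domMl; first exact: (slip_bd).
by apply: dom_sum => // j; exact: (tame_bd (tH j j)).
Qed.

(** * The limit equation divided by the width *)

(** On the surface d = 0, so the gradient of the lift is the tangential
gradient. *)
Lemma tD_surface zeta t y i (a : R) : 0 <= t <= T -> Gamma t y ->
  tdifferentiable Gamma nu zeta (y, t) ->
  is_derive y (e_ i) (fun z => lift zeta (z, t)) a -> tD i zeta (y, t) = a.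
Proof.
move=> tT Gy dz [_ <-].
have Ay := surface_open_tube tT Gy.
have E := pi_surface tT Gy.
have dz' : tdifferentiable Gamma nu zeta (pj (y, t), (y, t).2) by rewrite E.
have [_ ->] := lift_partial i Ay dz'.
by rewrite /lift_grad (level_surface tT Gy) mul0r subr0 (lift_surface _ tT Gy).
Qed.

(** The normal field extends to grad d, so summing over i gives H = - Lap d.
*)
Lemma tD_normal_field t y i : 0 <= t <= T -> Gamma t y ->
  tD i (fun q => nu q 0 i) (y, t) = D i (D i d) (y, t).
Proof.
move=> tT Gy; have Ay := surface_open_tube tT Gy.
apply: tD_surface => //.
  exists (grad (fun z => D i d (z, t)) y *m tangential_projection (nu (y, t))).
  exists (fun z => D i d (z, t)); split => //.
    by near=> z => Gz; rewrite /= (partial_level_surface).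
  by have [] := tame_slice_diff AA (tN i) Ay.
have H := tame_is_derive AA i (tN i) Ay; apply: near_eq_is_derive H.
have nA := rop_near_space AA Ay; apply: filterS nA => z Az /=.
by rewrite /lift_normal (partial_level).
Unshelve. all: by end_near. Qed.

(** The width is constant on the surface at each time. *)
Lemma tD_scaled zeta t y i : 0 <= t <= T -> Gamma t y ->
  tdifferentiable Gamma nu zeta (y, t) ->
  tD i (fun q => (g1 q - g0 q) * zeta q) (y, t) = (g1 (y, t) - g0 (y, t)) * tD i zeta (y, t).
Proof.
move=> tT Gy dz; have Ay := surface_open_tube tT Gy.
have gE z : Gamma t z -> g1 (z, t) - g0 (z, t) = g1 (y, t) - g0 (y, t).
  by move=> Gz; rewrite (dg0 tT Gz Gy) (dg1 tT Gz Gy).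
set a := g1 (y, t) - g0 (y, t) in gE *.
apply: tD_surface => //.
  have [G [h [hE dh _]]] := dz; rewrite /= in hE dh.
  exists (grad (fun z => a * h z) y *m tangential_projection (nu (y, t))).
  exists (fun z => a * h z); split => //; last exact: differentiableM.
  by near=> z => Gz; rewrite /= gE// (near hE z).
have E := pi_surface tT Gy.
have dz' : tdifferentiable Gamma nu zeta (pj (y, t), (y, t).2) by rewrite E.
have H := lift_partial i Ay dz'.
have H2 := is_deriveM (is_derive_cst a y (e_ i)) H.
have -> : a * tD i zeta (y, t) = cst a y *: lift_grad zeta i (y, t) + lift zeta (y, t) *: 0.
  rewrite scaler0 addr0 /lift_grad (level_surface tT Gy) mul0r subr0.
  by rewrite (lift_surface _ tT Gy).
apply: near_eq_is_derive H2.
have nA := rop_near_space AA Ay; apply: filterS nA => z Az /=.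
rewrite -[LHS]/(a * lift zeta (z, t)) /lift_normal /=; congr (_ * _).
by rewrite gE//; have [] := tubeE Az.
Unshelve. all: by end_near. Qed.

(** Product rule along the normal trajectory, on which the width is a function
of time alone. *)
Lemma dt_scaled eta t y : 0 < t <= T -> Gamma t y ->
  derivable_in `[0, T] (fun s => eta (normal_trajectory Gamma Phinu (y, t) s)) t ->
  normal_dt T Gamma Phinu (fun q => (g1 q - g0 q) * eta q) (y, t) =
  gap (y, t) * normal_dt T Gamma Phinu eta (y, t) + gap_dt (y, t) * eta (y, t).
Proof.
move=> /andP[t0 tT'] Gy de; have tT : 0 <= t <= T by rewrite ltW.
have Ay := surface_open_tube tT Gy.
have E := pi_surface tT Gy.
have [xi [v [xip xiv _ _ xiL]]] := normal_curve Ay; rewrite /= E in xip xiv xiL.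
have [_ Hg] := pjet_gap Ay xip xiv.
rewrite big1 ?addr0 in Hg; last by move=> i _; rewrite mulr0.
apply: (derive_in_val (ts_T ts) tT).
have de' : has_dq `[0, T] (fun s => eta (normal_trajectory Gamma Phinu (y, t) s)) t
   (normal_dt T Gamma Phinu eta (y, t)) := de.
have tE : normal_trajectory Gamma Phinu (y, t) t = (y, t).
  have [Y [_ YE YX]] := foot_on_flow Ay; rewrite /= E in YE YX.
  by rewrite /normal_trajectory /= -YX YE.
have := dqM Hg de'; rewrite /= xip tE; apply: dq_near_eq.
  by rewrite /= xip tE /gap !(lift_surface _ tT Gy).
near=> s.
have sT : (`[0, T]%classic : set R) s by near: s; exact: withinT.
rewrite /= in_itv /= in sT.
by rewrite /= /gap !xiL.
Unshelve. all: by end_near. Qed.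

(** Dividing by the width, which is constant in space, leaves gap_rate as the
only trace of it. *)
Lemma limit_equation f eta0 eta p :
  limit_classical_solution T k Gamma nu V Phinu (fun q => g1 q - g0 q) f eta0 eta ->
  A0 p -> 0 < p.2 ->
  f (pj p, p.2) = limit_residual eta p.
Proof.
case: p => x t ls Ap p0; have [Gy _] := tubeE Ap.
have tT := rop_time AA Ap; rewrite /= in p0 Gy tT.
have Ay := surface_open_tube tT Gy.
have [C1 Cdt _ CD1 _ CD2 _] := limit_sol_C21 ls.
have Sy : spread `]0, T] Gamma (pj (x, t), t).
  by split => //=; rewrite in_itv /= p0; case/andP: tT.
have bE := timelike_gap_rate Ap Ay erefl.
have gp := gap_gt0 Ay.
have := limit_sol_eq ls Sy.
rewrite dt_scaled//; last 2 first.
- by rewrite p0; case/andP: tT.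
- exact: Cdt.
rewrite (surface_velocity tT Gy) /mean_curvature /tdiv.
rewrite (eq_bigr (fun i => D i (D i d) (pj (x, t), t))); last first.
  by move=> i _; rewrite tD_normal_field.
rewrite [X in _ - k * X](_ : _ = gap (pj (x, t), t) * \sum_i tD i (tD i eta) (pj (x, t), t)); last first.
  rewrite mulr_sumr; apply: eq_bigr => i _.
  rewrite /gap !(lift_surface _ tT Gy) -tD_scaled//; last exact: CD2.
  by congr (tD i _ _); apply/funext => q; rewrite mxE.
rewrite /limit_residual bE /gap_rate {bE} /=.
have -> : lift eta (x, t) = eta (pj (x, t), t) by [].
have -> : g1 (pj (x, t), t) - g0 (pj (x, t), t) = gap (pj (x, t), t).
  by rewrite /gap !(lift_surface _ tT Gy).
have -> : lift (Dt d) (x, t) = Dt d (pj (x, t), t) by [].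
rewrite [X in _ - Dt d (pj (x, t), t) * X * _ - _](_ : _ = \sum_i D i (D i d) (pj (x, t), t)); last by apply: eq_bigr.
rewrite [X in _ = _ - k * X](_ : _ = \sum_i tD i (tD i eta) (pj (x, t), t)); last by apply: eq_bigr.
move: gp; move: (gap _) (gap_dt _) (f _) (eta _) (normal_dt _ _ _ _ _) (Dt d _) => a b F e nd m a0 E.
have an : a != 0 by rewrite gt_eqF.
by apply: (mulfI an); rewrite -E; field.
Qed.

(** * The thin domain and its lateral boundary *)

Section fixed_width.
Context {eps : R}.
Hypothesis epsE : 0 < eps < eps0.
Local Notation Om := (thin_domain Gamma nu g0 g1 eps).
Local Notation Q := (spread `]0, T] Om).
Local Notation Qbar := (spread `[0, T] (fun t => closure (Om t))).

(** Room below eps0 makes the inequality strict: the closed thin domain of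
thickness eps lies in the open tube. *)
Lemma width_strict x : 0 <= x -> (forall e, 0 < e < eps0 -> e * x <= delta) ->
  eps * x < delta.
Proof.
move=> x0 H; have d0 := delta_gt0; have /andP[e0 e1] := epsE.
have [->|xn] := eqVneq x 0; first by rewrite mulr0.
have xp : 0 < x by rewrite lt_def xn.
(* a larger admissible thickness, here the midpoint of eps and eps0 *)
apply: (@lt_le_trans _ _ ((eps + eps0) / 2 * x)).
  by rewrite ltr_pM2r// ltr_pdivlMr// mulrDr mulr1 ltrD2l.
apply: H; rewrite divr_gt0 ?addr_gt0// ?(lt_trans e0)//=.
by rewrite ltr_pdivrMr// mulrDr mulr1 ltrD2r.
Qed.

Lemma lift_width p : A0 p -> `|eps * G0 p| < delta /\ `|eps * G1 p| < delta.
Proof.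
move=> Ap; have [Gp _] := tubeE Ap.
have Sp : spread `[0, T] Gamma (pj p, p.2).
  by split; rewrite //= in_itv; exact: (rop_time AA Ap).
have /andP[e0 _] := epsE.
rewrite !normrM (gtr0_norm e0); split; apply: width_strict => // e eE.
  by have [] := thin_width_in_tube tw eE Sp.
by have [] := thin_width_in_tube tw eE Sp.
Qed.

Lemma thin_domainP t x : 0 <= t <= T ->
  Om t x <-> A0 (x, t) /\ eps * G0 (x, t) < d (x, t) < eps * G1 (x, t).
Proof.
move=> tT; split.
  move=> [y [r [Gy rE ->]]].
  have Ay := surface_open_tube tT Gy.
  have [w0 w1] := lift_width Ay.
  rewrite !(lift_surface)// in w0 w1.
  have rd : `|r| < delta.
    move: rE w0 w1; rewrite !ltr_norml => /andP[r0 r1] /andP[a1 a2] /andP[b1 b2].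
    by rewrite (lt_trans a1 r0) (lt_trans r1 b2).
  have Ax := normal_line_tube tT Gy rd.
  split => //; rewrite (normal_line_level)//.
  by rewrite /lift_normal (normal_line_proj).
move=> [Ax xE]; have [Gx E] := tubeE Ax.
by exists (pj (x, t)), (d (x, t)); split.
Qed.

Lemma thin_domain_near t x : 0 <= t <= T -> Om t x ->
  \forall q \near (x, t), 0 <= q.2 <= T -> Om q.2 q.1.
Proof.
move=> tT /thin_domainP-/(_ tT)[Ax /andP[x0 x1]].
have nA := rop_open AA Ax.
have cd := tame_cvg AA (level_tame) Ax.
have c0' := tame_cvg AA (lift_tame (thin_width_g0_smooth tw)) Ax.
have c1' := tame_cvg AA (lift_tame (thin_width_g1_smooth tw)) Ax.
set W := within _ _ in cd c0' c1'.
have FW : Filter W by exact: within_filter.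
have n0 : \forall q \near W, 0 < d q - eps * G0 q.
  apply: (cvgr_gt (d (x, t) - eps * G0 (x, t))); last by rewrite subr_gt0.
  by apply: cvgB => //; apply: cvgM => //; exact: cvg_cst.
have n1 : \forall q \near W, 0 < eps * G1 q - d q.
  apply: (cvgr_gt (eps * G1 (x, t) - d (x, t))); last by rewrite subr_gt0.
  by apply: cvgB => //; apply: cvgM => //; exact: cvg_cst.
have n2 : W (fun q => 0 < d q - eps * G0 q /\ 0 < eps * G1 q - d q) by exact: filterI.
rewrite /W /within /= in n2.
have {}n2 : nbhs (x, t) (fun q : space_time R n => q.2 \in `[0, T]%R ->
  0 < d q - eps * G0 q /\ 0 < eps * G1 q - d q) := n2.
apply: filterS (filterI nA n2) => q [Aq Hq] qT.
have [|H1 H2] := Hq; first by rewrite in_itv.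
apply/thin_domainP => //; rewrite -surjective_pairing; split; first exact: Aq.
by rewrite -subr_gt0 H1 -subr_gt0 H2.
Qed.

Lemma thin_domain_open t : 0 <= t <= T -> open (Om t).
Proof.
move=> tT; rewrite openE => x Ox; rewrite /interior.
have /nbhs_ballP[r /= r0 H] := thin_domain_near tT Ox.
apply/nbhs_ballP; exists r => //= z zr; apply: (H (z, t)) => //.
by split => //=; exact: ballxx.
Qed.

(** A uniform distance from the edge of the tube, which keeps limits of points
of the thin domain inside it. *)
Lemma tube_margin t : 0 <= t <= T -> exists2 m, m < delta &
  forall x, Om t x -> `|d (x, t)| <= m.
Proof.
move=> tT; have [y Gy] := surface_neq0 tT.
have Ay := surface_open_tube tT Gy.
have [w0 w1] := lift_width Ay.
exists (Num.max `|eps * G0 (y, t)| `|eps * G1 (y, t)|); first by rewrite gt_max w0.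
move=> x /thin_domainP-/(_ tT)[Ax].
rewrite (lift_timelike dg0 Ax Ay)// (lift_timelike dg1 Ax Ay)//.
move=> /andP[x0 x1]; rewrite ler_norml; apply/andP; split.
  rewrite lerNl (@le_trans _ _ (- (eps * G0 (y, t))))//; first by rewrite lerN2 ltW.
  by rewrite le_max -normrN ler_norm.
by rewrite (le_trans (ltW x1))// le_max ler_norm orbT.
Qed.

(** Limit points satisfy the weak inequalities by continuity; conversely,
moving along the normal towards the middle of the domain reaches its interior.
*)
Lemma closure_thin_domainP t (x : 'rV[R]_n) : 0 <= t <= T ->
  closure (Om t) x <-> A0 (x, t) /\ eps * G0 (x, t) <= d (x, t) <= eps * G1 (x, t).
Proof.
move=> tT; split.
  move=> cx; have Ax : A0 (x, t).
    have [m md Hm] := tube_margin tT.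
    have cz : enorm (x - z) @[z --> x] --> enorm (x - x).
      apply: (@enorm_cvg R n _ (nbhs x) _ (fun z => x - z) (x - x)).
      by apply: (@cvgB _ _ _ (nbhs x) _ (fun=> x) id); [exact: cvg_cst|exact: cvg_id].
    have nz : \forall z \near x, enorm (x - z) < delta - m.
      apply: (cvgr_lt _ cz); rewrite subrr /enorm -(scale0r 0) dotZl mul0r sqrtr0.
      by rewrite subr_gt0.
    have [z [Oz zx]] := cx _ nz.
    have [Az _] := proj1 (thin_domainP z tT) Oz.
    have [Gz zE] := tubeE Az.
    apply: (open_tubeP (y := pj (z, t))) => //=.
    rewrite -(subrKA z) (le_lt_trans (enormD _ _))//.
    have -> : z - pj (z, t) = d (z, t) *: nu (pj (z, t), t).
      by rewrite [X in X - _]zE addrAC subrr add0r.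
    rewrite enormZ (normal_unit tT Gz) mulr1 -ltrBrDr (lt_le_trans zx)//.
    by rewrite lerB// Hm.
  have cd := tame_slice_cvg (level_tame) Ax.
  have nA := rop_near_space AA Ax.
  split => //; apply/andP; split; rewrite leNgt; apply/negP => xl.
    have n1 : \forall z \near x, d (z, t) < eps * G0 (x, t).
      exact: (cvgr_lt _ cd).
    have [z [Oz [Az zl]]] := cx _ (filterI nA n1).
    have [_ /andP[zl' _]] := proj1 (thin_domainP z tT) Oz.
    by have := lt_trans zl' zl; rewrite (lift_timelike dg0 Ax Az)// ltxx.
  have n1 : \forall z \near x, eps * G1 (x, t) < d (z, t).
    exact: (cvgr_gt _ cd).
  have [z [Oz [Az zl]]] := cx _ (filterI nA n1).
  have [_ /andP[_ zl']] := proj1 (thin_domainP z tT) Oz.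
  by have := lt_trans zl zl'; rewrite (lift_timelike dg1 Ax Az)// ltxx.
move=> [Ax x01] B nB; have [Gx xE] := tubeE Ax.
set y := pj (x, t) in Gx xE; set r := d (x, t) in x01 xE.
have [w0 w1] := lift_width Ax.
have gap := lift_gap Ax; have cgt0 := thin_width_const_gt0 tw.
have /andP[e0 _] := epsE.
set a := eps * G0 (x, t) in x01 w0; set b := eps * G1 (x, t) in x01 w1.
have ab : a < b by rewrite /a /b ltr_pM2l// -subr_gt0 (lt_le_trans cgt0).
(* the normal segment from x to the middle of the domain *)
pose z (th : R) := y + (r + th * ((a + b) / 2 - r)) *: nu (y, t).
have cz : z th @[th --> 0^'+] --> x.
  have -> : x = z 0 by rewrite /z mul0r addr0 -xE.
  apply: cvg_at_right_filter.
  apply: cvgD; first exact: cvg_cst.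
  apply: cvgZ; last exact: cvg_cst.
  apply: cvgD; first exact: cvg_cst.
  by apply: cvgM; [exact: cvg_id|exact: cvg_cst].
have Bz : \forall th \near 0^'+, B (z th) by exact: cz.
have [th [[th0 th1] Bth]] := filter_ex (filterI (filterI (nbhs_right_gt (0 : R)) (nbhs_right_lt (@ltr01 R))) Bz).
exists (z th); split => //.
have ra : a < r + th * ((a + b) / 2 - r) < b.
  rewrite (_ : r + _ = (1 - th) * r + th * ((a + b) / 2)); last by ring.
  rewrite /= in th0 th1; move: x01 => /andP[x0 x1].
  apply/andP; split.
    have : (1 - th) * a <= (1 - th) * r by rewrite ler_wpM2l// subr_ge0 ltW.
    have : th * a < th * ((a + b) / 2) by rewrite ltr_pM2l//; lra.
    lra.
  have : (1 - th) * r <= (1 - th) * b by rewrite ler_wpM2l// subr_ge0 ltW.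
  have : th * ((a + b) / 2) < th * b by rewrite ltr_pM2l//; lra.
  lra.
exists y, (r + th * ((a + b) / 2 - r)); split => //.
Qed.

Lemma boundary_thin_domainP t (x : 'rV[R]_n) : 0 <= t <= T ->
  boundary (Om t) x <-> A0 (x, t) /\ (d (x, t) = eps * G0 (x, t) \/ d (x, t) = eps * G1 (x, t)).
Proof.
move=> tT; rewrite /boundary.
have -> : interior (Om t) = Om t.
  apply/seteqP; split; first exact: interior_subset.
  by move=> z Oz; exact: (open_nbhs_nbhs (conj (thin_domain_open tT) Oz)).
have /andP[e0 _] := epsE.
split.
  move=> [/(closure_thin_domainP _ tT)[Ax /andP[x0 x1]] nO]; split => //.
  have [xE|xn] := eqVneq (d (x, t)) (eps * G0 (x, t)); [by left|right].
  apply/eqP; apply: contra_notT nO => xn1; apply/thin_domainP => //; split => //.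
  by rewrite !lt_neqAle x0 x1 xn1 eq_sym xn.
move=> [Ax xE].
have gap := lift_gap Ax; have cgt0 := thin_width_const_gt0 tw.
have ab : eps * G0 (x, t) < eps * G1 (x, t).
  by rewrite ltr_pM2l// -subr_gt0 (lt_le_trans cgt0).
split.
  apply/closure_thin_domainP => //; split => //.
  by case: xE => ->; rewrite lexx (ltW ab).
move=> /(thin_domainP _ tT)[_ /andP[x0 x1]].
by case: xE x0 x1 => ->; rewrite ltxx.
Qed.

Definition normal_field (p : space_time R n) : 'rV[R]_n := \row_i D i d p.

Lemma normal_fieldE p : A0 p -> normal_field p = nu (pj p, p.2).
Proof. by move=> Ap; apply/rowP => i; rewrite mxE (partial_level). Qed.

(** Translation along the normal: the foot and the normal do not change and
the distance changes by r. *)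
Lemma normal_shift p (r : R) : A0 p -> `|d p + r| < delta ->
  let q := (p.1 + r *: normal_field p, p.2) in
  [/\ A0 q, d q = d p + r, normal_field q = normal_field p & pj q = pj p].
Proof.
move=> Ap rd q; have [Gy pE] := tubeE Ap; have pT := rop_time AA Ap.
have qE : q = (pj p + (d p + r) *: nu (pj p, p.2), p.2).
  by rewrite /q normal_fieldE// [X in (X + _, _)]pE scalerDl addrA.
have Aq : A0 q by rewrite qE; exact: (normal_line_tube pT Gy rd).
have jq : pj q = pj p by rewrite qE; exact: (normal_line_proj pT Gy rd).
split; [exact: Aq| | |exact: jq]; first by rewrite qE (normal_line_level pT Gy rd).
by rewrite (normal_fieldE Aq) (normal_fieldE Ap) jq.
Qed.

(** The normal derivative of d_t d vanishes by the eikonal equation. *)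
Lemma time_level_normal p q : A0 p -> A0 q -> p.2 = q.2 -> pj p = pj q ->
  Dt d p = Dt d q.
Proof.
suff H r : A0 r -> Dt d r = Dt d (pj r, r.2).
  move=> Ap Aq pq jpq; have Hp := H p Ap; have Hq := H q Aq.
  by rewrite jpq pq -Hq in Hp.
case: r => x t Ap; have tT := rop_time AA Ap; rewrite /= in tT *.
have [Gy xE] := tubeE Ap; rewrite /= in Gy xE.
set y := pj (x, t) in Gy xE *; set N := nu (y, t) in xE; pose r := d (x, t).
have rd : `|r| < delta by case: Ap.
have As s : 0 <= s <= 1 -> `|s * r| < delta /\ A0 (y + (s * r) *: N, t).
  move=> /andP[s0 s1]; have h : `|s * r| < delta.
    by rewrite (le_lt_trans _ rd)// normrM ger0_norm// ler_piMl.
  by split => //; exact: (normal_line_tube).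
have := @mvt_affine R (fun s => Dt d (y + s *: N, t))
  (fun s => \sum_i N 0 i * D i (Dt d) (y + s *: N, t)) r 0 0.
have H1 (s : R) : 0 <= s <= 1 -> is_derive (s * r) (1 : R) (fun s => Dt d (y + s *: N, t))
    (\sum_i N 0 i * D i (Dt d) (y + (s * r) *: N, t)).
  by move=> /As[_ As1]; apply: (tame_line).
have H2 (s : R) : 0 <= s <= 1 -> `|\sum_i N 0 i * D i (Dt d) (y + (s * r) *: N, t) - 0| <= 0.
  move=> /As[h As1]; rewrite subr0 normr_le0.
  rewrite -[X in _ == X](level_time_normal As1); apply/eqP; apply: eq_bigr => i _.
  by rewrite (normal_line_grad).
move=> /(_ H1 H2); rewrite mulr0 subr0 mul0r normr_le0 subr_eq0 scale0r addr0 /r -xE.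
by move=> /eqP.
Qed.

Lemma normal_field_unit p : A0 p -> dot (normal_field p) (normal_field p) = 1.
Proof.
by move=> Ap; rewrite -[RHS](eikonal Ap); apply: eq_bigr => i _; rewrite mxE.
Qed.

Lemma boundary_shift t x y : 0 <= t <= T -> boundary (Om t) x -> A0 (y, t) ->
  d (y, t) = d (x, t) -> boundary (Om t) y.
Proof.
move=> tT /(boundary_thin_domainP _ tT)[Ax xE] Ay yx.
apply/(boundary_thin_domainP _ tT); split => //.
by rewrite yx (cG0 Ay Ax erefl) (cG1 Ay Ax erefl).
Qed.

(** Level sets of d are orthogonal to grad d: the line x + s w, corrected
along the normal so as to stay on the level set, still has velocity w because
d varies along it to second order only. *)
Lemma boundary_tangent t x (w : 'rV[R]_n) : 0 <= t <= T -> boundary (Om t) x ->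
  dot w (normal_field (x, t)) = 0 -> tangent (boundary (Om t)) x w.
Proof.
move=> tT Bx w0; have [Ax _] := proj1 (boundary_thin_domainP _ tT) Bx.
have Ax0 : A0 (x + (0 : R) *: w, t) by rewrite scale0r addr0.
pose z (s : R) : 'rV[R]_n := x + s *: w.
exists (fun s => z s + (d (x, t) - d (z s, t)) *: normal_field (z s, t)); split.
- by rewrite /z scale0r addr0 subrr scale0r addr0.
- have cz : z s @[s --> (0 : R)] --> x + (0 : R) *: w.
    by apply: cvgD; [exact: cvg_cst|apply: cvgZ; [exact: cvg_id|exact: cvg_cst]].
  have nA : \forall u \near (x + (0 : R) *: w), A0 (u, t) := rop_near_space AA Ax0.
  have Hn := cz _ nA; apply: (@filterS _ (nbhs (0 : R)) _ _ _ _ Hn) => s As.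
  have sh := @normal_shift (z s, t) (d (x, t) - d (z s, t)) As.
  rewrite /= addrCA subrr addr0 in sh.
  have [|A1 d1 _ _] := sh; first by case: Ax.
  exact: boundary_shift Bx A1 d1.
- have dd := tame_line (level_tame) Ax0.
  have w0' : \sum_i w 0 i * D i d (x + 0 *: w, t) = 0.
    by rewrite scale0r addr0 -[RHS]w0; apply: eq_bigr => i _; rewrite mxE.
  rewrite w0' in dd.
  have dc l : is_derive (0 : R) (1 : R) (fun s => x 0 l + s * w 0 l + (d (x, t) - d (z s, t)) * D l d (z s, t)) (w 0 l).
    have dn := tame_line (tN l) Ax0.
    have d1 := is_deriveD (is_derive_cst (x 0 l) (0 : R) (1 : R)) (is_deriveM (is_derive_id (0 : R) (1 : R)) (is_derive_cst (w 0 l) (0 : R) (1 : R))).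
    have d2 := is_deriveM (is_deriveB (is_derive_cst (d (x, t)) (0 : R) (1 : R)) dd) dn.
    apply: (is_derive_eq (is_deriveD d1 d2)).
    rewrite -[(cst _ - _) 0]/(d (x, t) - d (x + 0 *: w, t)) scale0r addr0 !subrr !scale0r.
    by rewrite scaler0 !addr0 !add0r /GRing.scale /= /cst mulr1.
  have -> : w = \row_i w 0 i by apply/rowP => i; rewrite mxE.
  apply: is_derive_row => l; have := dc l.
  by congr (is_derive _ _ _ _); apply/funext => s; rewrite !mxE.
Qed.

(** The component of N orthogonal to grad d is tangent to the boundary, hence
orthogonal to N, hence zero. *)
Lemma normal_collinear t x N : 0 <= t <= T -> boundary (Om t) x ->
  outward_unit_normal (boundary (Om t)) (Om t) x N ->
  N = normal_field (x, t) \/ N = - normal_field (x, t).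
Proof.
move=> tT Bx [N1 Nt _]; have [Ax _] := proj1 (boundary_thin_domainP _ tT) Bx.
set N0 := normal_field (x, t); have N01 : dot N0 N0 = 1 := normal_field_unit Ax.
pose a := dot N N0; pose w := N - a *: N0.
have w0 : dot w N0 = 0 by rewrite /w dotBl dotZl N01 mulr1 subrr.
have Nw := Nt _ (boundary_tangent tT Bx w0).
have wE : w = 0.
  apply: dot_eq0; rewrite /w dotBl -/w Nw dotZl dotC w0 mulr0 subrr//.
have NE : N = a *: N0 by apply/eqP; rewrite -subr_eq0 -/w wE.
have : a ^+ 2 = 1.
  have := dot_unit N1; rewrite NE dotZl dotZr N01 mulr1 => <-.
  by rewrite expr2.
move/eqP; rewrite sqrf_eq1 => /orP[/eqP aE|/eqP aE]; [left|right];
by rewrite NE aE ?scale1r ?scaleN1r.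
Qed.

(** The inner component is m = 1 and the outer one m = -1, so that m *
normal_field points into the domain in both cases and the two components can
be treated by one computation. *)
Lemma boundary_cases t x : 0 <= t <= T -> boundary (Om t) x ->
  exists m : R, [/\ m ^+ 2 = 1, A0 (x, t),
    height eps (x, t) = (1 - m) / 2 * (eps * gap (x, t)) &
    exists2 s0, 0 < s0 & forall s, 0 < s < s0 ->
      `|d (x, t) + s * m| < delta /\
      Om t (x + (s * m) *: normal_field (x, t))].
Proof.
move=> tT Bx; have [Ax xE] := proj1 (boundary_thin_domainP _ tT) Bx.
have /andP[e0 _] := epsE.
have gp := gap_gt0 Ax; have egp : 0 < eps * gap (x, t) by rewrite mulr_gt0.
have dd : 0 < delta - `|d (x, t)| by rewrite subr_gt0; case: Ax.
pose s0 := Num.min (eps * gap (x, t)) (delta - `|d (x, t)|).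
have s00 : 0 < s0 by rewrite lt_min egp.
have H (m s : R) : m ^+ 2 = 1 -> 0 < s < s0 ->
    [/\ `|d (x, t) + s * m| < delta, 0 < s < eps * gap (x, t) &
        let z := x + (s * m) *: normal_field (x, t) in
        [/\ A0 (z, t), d (z, t) = d (x, t) + s * m, G0 (z, t) = G0 (x, t) &
            G1 (z, t) = G1 (x, t)]].
  move=> m1 /andP[sp]; rewrite lt_min => /andP[sg sd].
  have rd : `|d (x, t) + s * m| < delta.
    rewrite (le_lt_trans (ler_normD _ _))// normrM (gtr0_norm sp).
    have -> : `|m| = 1.
      by apply/eqP; rewrite -(eqrXn2 (n := 2))// real_normK ?num_real// m1 expr1n.
    by rewrite mulr1 -ltrBrDl.
  have [A1 d1 _ _] := normal_shift Ax rd; rewrite /= in A1 d1.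
  by split; rewrite ?sp//; split => //; [exact: cG0|exact: cG1].
case: xE => xE; [exists 1|exists (-1)]; split; rewrite ?sqrrN ?expr1n//.
- by rewrite /height xE !subrr !mul0r.
- exists s0 => // s ss; have [rd sg [A1 d1 E0 E1]] := H 1 s (expr1n _ _) ss.
  split => //; apply/(thin_domainP _ tT); split; first exact: A1.
  rewrite E0 E1 d1 xE; move: sg; rewrite /gap => /andP[sp sg].
  by apply/andP; split; lra.
- by rewrite /height xE /gap; field.
- exists s0 => // s ss.
  have m1 : (-1 : R) ^+ 2 = 1 by rewrite sqrrN expr1n.
  have [rd sg [A1 d1 E0 E1]] := H (-1) s m1 ss.
  split => //; apply/(thin_domainP _ tT); split; first exact: A1.
  rewrite E0 E1 d1 xE; move: sg; rewrite /gap => /andP[sp sg].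
  by apply/andP; split; lra.
Qed.

(** Of the two unit normals, m * normal_field points into the domain. *)
Lemma outward_normal_sign t x (m s0 : R) N : 0 <= t <= T -> boundary (Om t) x ->
  m ^+ 2 = 1 -> 0 < s0 ->
  (forall s, 0 < s < s0 -> Om t (x + (s * m) *: normal_field (x, t))) ->
  outward_unit_normal (boundary (Om t)) (Om t) x N ->
  N = - m *: normal_field (x, t).
Proof.
move=> tT Bx m1 s00 Hs oN; have NE := normal_collinear tT Bx oN.
have [_ _ No] := oN.
have nN : N != m *: normal_field (x, t).
  apply/eqP => Nm.
  have [s [[_ nc] [sp sl]]] := filter_ex (filterI No (filterI (nbhs_right_gt (0 : R)) (nbhs_right_lt s00))).
  apply: nc; apply: subset_closure; rewrite Nm scalerA; apply: Hs.
  by rewrite /= in sp sl; rewrite sp.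
have /orP[/eqP mE|/eqP mE] : (m == 1) || (m == -1) by rewrite -sqrf_eq1 m1.
  case: NE nN => ->; rewrite mE ?scale1r ?scaleN1r ?eqxx//.
by case: NE nN => ->; rewrite mE ?opprK ?scaleN1r ?scale1r ?eqxx.
Qed.

(** Normal velocity does not depend on the curve chosen in the boundary; the
curve used has the same foot as normal_curve and height 0 or eps times the
width. *)
Lemma boundary_velocity t x (m c' : R) : 0 <= t <= T -> A0 (x, t) -> m ^+ 2 = 1 ->
  height eps (x, t) = (1 - m) / 2 * (eps * gap (x, t)) ->
  normal_velocity `[0, T] (fun s => boundary (Om s)) x t (- m *: normal_field (x, t)) c' ->
  c' = - m * (gap_rate (x, t) * height eps (x, t) - slip eps (x, t)).
Proof.
move=> tT Ax m1 hE [_ vel]; have gp := gap_gt0 Ax.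
have [xi [v [xip xiv _ xiA _]]] := normal_curve Ax; rewrite /= in xip xiv xiA.
(* g0 if m = 1 and g1 if m = -1 *)
pose G q := G0 q + (1 - m) / 2 * gap q.
(* xi moved along the normal onto the boundary component of x *)
pose zeta s := xi s + (eps * G (xi s, s) - d (xi s, s)) *: normal_field (xi s, s).
have dE : d (x, t) = eps * G (x, t).
  by move: hE; rewrite /height /G => /eqP; rewrite subr_eq => /eqP ->; ring.
have HG : has_dq `[0, T] (fun s => eps * G (xi s, s) - d (xi s, s)) t
    (eps * (Dt G0 (x, t) + (1 - m) / 2 * gap_dt (x, t)) - 0).
  apply: dqB.
    apply: dqMl; apply: dqD.
      have [_ H] := @pjet_timelike xi v (x, t) Ax xip xiv G0 tG0 cG0.
      by move: H; rewrite big1 ?addr0// => i _; rewrite mulr0.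
    have [_ H] := pjet_gap Ax xip xiv.
    by apply: dqMl; move: H; rewrite big1 ?addr0// => i _; rewrite mulr0.
  apply: dq_near_eq (@dq_cst R R _ (d (x, t)) t); first by rewrite xip.
  near=> s; have sT : (`[0, T]%classic : set R) s by near: s; exact: withinT.
  by rewrite /= in_itv /= in sT; have [_ ->] := xiA s sT.
have HN : has_dq `[0, T] (fun s => normal_field (xi s, s)) t
    (\row_i (Dt (D i d) (x, t) + \sum_j v 0 j * D j (D i d) (x, t))).
  apply: dq_row => i; have := tame_curve AA (xi := xi) (t := t) (v := v) (tN i).
  by rewrite xip; apply.
have Hz := dqD xiv (dqZ HG HN).
have zB s : 0 <= s <= T -> boundary (Om s) (zeta s).
  move=> sT; have [As _] := xiA s sT.
  have [w0 w1] := lift_width As.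
  have mc : m = 1 \/ m = -1.
    by move: m1 => /eqP; rewrite sqrf_eq1 => /orP[/eqP ->|/eqP ->]; [left|right].
  have GE : G (xi s, s) = G0 (xi s, s) \/ G (xi s, s) = G1 (xi s, s).
    rewrite /G /gap; case: mc => ->; [left|right]; by field.
  have rd : `|d (xi s, s) + (eps * G (xi s, s) - d (xi s, s))| < delta.
    by rewrite addrC subrK; case: GE => ->.
  have [A1 d1 _ _] := normal_shift As rd; rewrite /= in A1 d1.
  apply/(boundary_thin_domainP _ sT); split; first exact: A1.
  rewrite d1 (addrC (d _)) subrK (cG0 A1 As erefl) (cG1 A1 As erefl).
  by case: GE => ->; [left|right].
have zt : zeta t = x by rewrite /zeta xip dE subrr scale0r addr0.
have vN : dot v (normal_field (x, t)) = - Dt d (x, t).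
  have := tame_curve AA (xi := xi) (t := t) (v := v) (level_tame).
  rewrite xip => /(_ Ax xiv) H1.
  have H2 : has_dq `[0, T] (fun s => d (xi s, s)) t 0.
    apply: dq_near_eq (@dq_cst R R _ (d (x, t)) t); first by rewrite xip.
    near=> s; have sT : (`[0, T]%classic : set R) s by near: s; exact: withinT.
    by rewrite /= in_itv /= in sT; have [_ ->] := xiA s sT.
  have := dq_unique (ts_T ts) tT H1 H2.
  have -> : \sum_i v 0 i * D i d (x, t) = dot v (normal_field (x, t)).
    by apply: eq_bigr => i _; rewrite mxE.
  by move=> /eqP; rewrite addrC addr_eq0 => /eqP.
rewrite (vel zeta _ zt (conj _ Hz)); last first.
  by move=> s; rewrite /= in_itv /=; exact: zB.
rewrite xip dE subrr scale0r add0r dotDl !dotZr dotZl vN (normal_field_unit Ax) mulr1.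
rewrite hE /gap_rate /slip.
have gn : gap (x, t) != 0 by rewrite gt_eqF.
move: (gap (x, t)) (gap_dt (x, t)) (Dt d (x, t)) (Dt G0 (x, t)) gn => x1 x2 x3 x4 gn.
by field.
Unshelve. all: by end_near. Qed.

Lemma QbarP p : Qbar p <-> A0 p /\ eps * G0 p <= d p <= eps * G1 p.
Proof.
case: p => x t; split.
  by move=> [/=]; rewrite in_itv /= => tT /(closure_thin_domainP _ tT).
move=> [Ap dp]; have tT := rop_time AA Ap; rewrite /= in tT.
split; first by rewrite /= in_itv.
by apply/(closure_thin_domainP _ tT).
Qed.

(** * Compactness and continuity on the closed thin domain *)

(** The closed thin domains at all times as one image of the product of the
initial surface, the time interval and the relative height in [0, 1]. *)
Definition thin_param (q : space_time R n * R) : space_time R n :=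
  tube_param (q.1, eps * (G0 (Phi q.1, q.1.2) + q.2 * gap (Phi q.1, q.1.2))).

Local Notation box := ((Gamma 0 `*` `[0, T]) `*` `[0, 1]%classic : set (space_time R n * R)).

Lemma thin_param_cvg (q : space_time R n * R) : box q -> thin_param x @[x --> within box (nbhs q)] --> thin_param q.
Proof.
move=> Bq; have [Gq _] := Bq.
have qT : 0 <= q.1.2 <= T by move: Gq => [_]; rewrite /= in_itv.
have GP : Gamma q.1.2 (Phi q.1).
  by rewrite [q.1]surjective_pairing; apply: (Phi_surface) => //; case: Gq.
have AP := surface_open_tube qT GP.
have FF : Filter (within box (nbhs q)) by exact: within_filter.
have c1 : x.1 @[x --> within box (nbhs q)] --> within (Gamma 0 `*` `[0, T]) (nbhs q.1).
  apply: cvg_to_within; last by move=> x [].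
  have cf : x.1 @[x --> nbhs q] --> nbhs q.1 by exact: cvg_fst.
  by apply: cvg_trans cf; apply: cvg_app; exact: cvg_within.
have cP := cvg_comp _ _ c1 (Phi_cvg Gq).
have ct : x.1.2 @[x --> within box (nbhs q)] --> q.1.2.
  apply: (cvg_comp _ _ c1); have cs : x.2 @[x --> nbhs q.1] --> nbhs q.1.2 by exact: cvg_snd.
  by apply: cvg_trans cs; apply: cvg_app; exact: cvg_within.
have ctame f : tame f -> f (Phi x.1, x.1.2) @[x --> within box (nbhs q)] --> f (Phi q.1, q.1.2).
  move=> tf; have cD := tame_cvg AA tf AP.
  apply: (cvg_comp _ _ _ cD); apply: cvg_to_within.
    exact: (cvg_pair cP ct).
  by move=> x [[]].
have cr : x.2 @[x --> within box (nbhs q)] --> q.2.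
  have cs : x.2 @[x --> nbhs q] --> nbhs q.2 by exact: cvg_snd.
  by apply: cvg_trans cs; apply: cvg_app; exact: cvg_within.
pose B' : set (space_time R n * R) := [set q | (Gamma 0 `*` `[0, T]) q.1].
pose u (x : space_time R n * R) := (x.1, eps * (G0 (Phi x.1, x.1.2) + x.2 * gap (Phi x.1, x.1.2))).
have cu : u x @[x --> within box (nbhs q)] --> within B' (nbhs (u q)).
  apply: cvg_to_within; last by move=> x [].
  have cu1 : x.1 @[x --> within box (nbhs q)] --> q.1.
    have cf : x.1 @[x --> nbhs q] --> nbhs q.1 by exact: cvg_fst.
    by apply: cvg_trans cf; apply: cvg_app; exact: cvg_within.
  have cu2 : eps * (G0 (Phi x.1, x.1.2) + x.2 * gap (Phi x.1, x.1.2)) @[x --> within box (nbhs q)] -->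
      eps * (G0 (Phi q.1, q.1.2) + q.2 * gap (Phi q.1, q.1.2)).
    apply: cvgM; first exact: cvg_cst.
    apply: cvgD; first exact: ctame.
    by apply: cvgM => //; apply: cvgB; exact: ctame.
  exact: (cvg_pair cu1 cu2).
have BB : B' `<=` [set q | (Gamma 0 `*` `[0, T]) q.1] by [].
have Bu : B' (u q) by [].
exact: (cvg_comp _ _ cu (tube_param_cvg BB Bu)).
Qed.

Lemma thin_param_image : thin_param @` box = Qbar.
Proof.
have /andP[e0 _] := epsE.
apply/seteqP; split => [_ [[[Y t] r] [[/= GY tT] r01] <-]|p].
  rewrite in_itv /= in tT; rewrite in_itv /= in r01.
  have Gy := Phi_surface GY tT; set y := Phi (Y, t) in Gy *.
  have Ay := surface_open_tube tT Gy.
  have gp := gap_gt0 Ay.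
  have [w0 w1] := lift_width Ay.
  have b0 : eps * G0 (y, t) <= eps * (G0 (y, t) + r * gap (y, t)).
    by case/andP: r01 => r0 _; rewrite ler_pM2l// lerDl mulr_ge0// ltW.
  have b1 : eps * (G0 (y, t) + r * gap (y, t)) <= eps * G1 (y, t).
    rewrite ler_pM2l// addrC -lerBrDr -/(gap (y, t)) ler_piMl ?(ltW gp)//.
    by case/andP: r01.
  set a := eps * (_ + _) in b0 b1.
  have ad : `|a| < delta.
    move: w0 w1; rewrite !ltr_norml => /andP[w0 _] /andP[_ w1].
    by rewrite (lt_le_trans w0 b0) (le_lt_trans b1 w1).
  have -> : thin_param (Y, t, r) = (y + a *: nu (y, t), t).
    rewrite /thin_param /tube_param /= -/y -/a; congr (_ + _ *: _, _).
    by apply/rowP => i; rewrite mxE (partial_level_surface).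
  apply/QbarP; have Az := normal_line_tube tT Gy ad; split => //.
  rewrite (normal_line_level tT Gy ad).
  by rewrite (cG0 Az Ay erefl) (cG1 Az Ay erefl) b0.
move=> /QbarP[Ap /andP[d0 d1]].
have [[[Y t] r] [/= GY tE rE pE]] := open_tube_param Ap.
have pT := rop_time AA Ap.
have tT : 0 <= t <= T by rewrite tE.
have Gy := Phi_surface GY tT.
have Ay := surface_open_tube tT Gy.
have gp := gap_gt0 Ap.
have gn : gap p != 0 by rewrite gt_eqF.
have en : eps != 0 by rewrite gt_eqF.
exists (Y, t, (d p / eps - G0 p) / gap p).
  split; first by split; rewrite //= in_itv.
  rewrite /= in_itv /=; apply/andP; split.
    by rewrite divr_ge0 ?(ltW gp)// subr_ge0 ler_pdivlMr// mulrC.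
  rewrite ler_pdivrMr// mul1r lerD2r ler_pdivrMr// mulrC.
  exact: d1.
rewrite -[RHS]pE /thin_param /=; congr (tube_param (_, _)).
have gE : gap (Phi (Y, t), t) = gap p by rewrite /gap (cG0 Ay Ap tE) (cG1 Ay Ap tE).
by rewrite (cG0 Ay Ap tE) gE rE; field; rewrite gn en.
Qed.

Lemma Qbar_compact : compact Qbar.
Proof.
rewrite -thin_param_image; apply: continuous_compact.
  by apply/subspace_continuousP => q Bq; exact: thin_param_cvg.
apply: compact_setX; last exact: segment_compact.
apply: compact_setX; last exact: segment_compact.
by have [] := moving_surface_closed (ts_surface ts) (t := 0); rewrite ?lexx ?ltW.
Qed.

Local Notation Fq p := (within Qbar (nbhs p)).

Lemma Qbar_tame f p : tame f -> Qbar p -> f q @[q --> Fq p] --> f p.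
Proof.
move=> tf /QbarP[Ap _]; have := tame_cvg AA tf Ap; apply: cvg_trans.
apply: cvg_app => P; rewrite /within /= => H.
have H' : nbhs p (fun q : space_time R n => (`[0, T]%classic : set R) q.2 -> P q) := H.
have G : nbhs p (fun q : space_time R n => Qbar q -> P q).
  by apply: (@filterS _ (nbhs p) _ _ _ _ H') => q Hq [qT _]; exact: Hq.
exact: G.
Qed.

Lemma Qbar_gap_rate p : Qbar p -> gap_rate q @[q --> Fq p] --> gap_rate p.
Proof.
move=> Qp; have [Ap _] := proj1 (QbarP p) Qp.
apply: cvgM; first by apply: cvgB; apply: Qbar_tame => //; exact: tame_time.
apply: cvgV; first by rewrite gt_eqF// (gap_gt0 Ap).
by apply: cvgB; exact: Qbar_tame.
Qed.

Lemma Qbar_height p : Qbar p -> height eps q @[q --> Fq p] --> height eps p.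
Proof.
move=> Qp; apply: cvgB; first exact: Qbar_tame (level_tame) Qp.
by apply: cvgM; [exact: cvg_cst|exact: Qbar_tame].
Qed.

Lemma Qbar_weight p : Qbar p -> weight eps q @[q --> Fq p] --> weight eps p.
Proof.
move=> Qp; have ch := Qbar_height Qp.
apply: cvgD.
  apply: cvgN; apply: cvgM => //; apply: cvgB; first exact: Qbar_tame.
  by apply: cvgM; [exact: cvg_cst|apply: Qbar_tame => //; exact: tame_time].
apply: cvgM; first exact: cvg_cst.
by apply: cvgM; [exact: Qbar_gap_rate|exact: cvgM].
Qed.

Lemma Qbar_barrier p : Qbar p -> barrier eps q @[q --> Fq p] --> barrier eps p.
Proof.
move=> Qp; have ch := Qbar_height Qp.
apply: cvgB; first exact: cvgM.
apply: cvgM; first exact: cvg_cst.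
by apply: cvgM => //; apply: cvgB; exact: Qbar_tame.
Qed.

Lemma Qbar_lift eta p : {within spread `[0, T] Gamma, continuous eta} -> Qbar p ->
  lift eta q @[q --> Fq p] --> lift eta p.
Proof.
move=> /subspace_continuousP ce Qp; have [Ap _] := proj1 (QbarP p) Qp.
have [Gp _] := tubeE Ap; have pT := rop_time AA Ap.
have Sp : spread `[0, T] Gamma (pj p, p.2) by split; rewrite //= in_itv.
have [U [h [oU Up Ch hE]]] := tube_proj_smooth (ts_tube ts) (rop_sub AA Ap).
have ch := class_C_cont (Ch 0%N) Up.
have FF : Filter (Fq p) by exact: within_filter.
have QA q : Qbar q -> A q by move=> /QbarP[Aq _]; exact: (rop_sub AA Aq).
have cp : pj q @[q --> Fq p] --> pj p.
  rewrite -(hE _ Up (QA _ Qp)).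
  have c1 : h q @[q --> Fq p] --> h p.
    by apply: cvg_trans ch; apply: cvg_app; exact: cvg_within.
  apply: cvg_trans c1; apply: near_eq_cvg; near=> q; apply: hE.
    by near: q; apply: cvg_within; exact: open_nbhs_nbhs.
  by apply: QA; near: q; exact: withinT.
have ct : q.2 @[q --> Fq p] --> p.2.
  have cs : q.2 @[q --> nbhs p] --> nbhs p.2 by exact: cvg_snd.
  by apply: cvg_trans cs; apply: cvg_app; exact: cvg_within.
apply: (cvg_comp _ _ _ (ce _ Sp)); apply: cvg_to_within.
  exact: (cvg_pair cp ct).
move=> q Qq; have [Aq _] := proj1 (QbarP q) Qq; have [Gq _] := tubeE Aq.
by split; rewrite //= in_itv; exact: (rop_time AA Aq).
Unshelve. all: by end_near. Qed.

(** * The solution in the thin domain *)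

Context {nuO : space_time R n -> 'rV[R]_n} {VO f rho : space_time R n -> R}
  {rho0 : 'rV[R]_n -> R}.
Hypothesis nuOE : forall x t, 0 < t <= T -> boundary (Om t) x ->
  outward_unit_normal (boundary (Om t)) (Om t) x (nuO (x, t)).
Hypothesis VOE : forall x t, 0 < t <= T -> boundary (Om t) x ->
  normal_velocity `[0, T] (fun s => boundary (Om s)) x t (nuO (x, t)) (VO (x, t)).
Hypothesis sol : thin_classical_solution T k Om nuO VO f rho0 rho.

Definition thin_dt (rho : space_time R n -> R) (p : space_time R n) : R :=
  derive_in [set s | Q (p.1, s)] (fun s => rho (p.1, s)) p.2.

Lemma thin_time p : Q p -> 0 < p.2 <= T.
Proof. by case; rewrite /= in_itv. Qed.

Lemma thin_near p : Q p -> \forall q \near p, 0 <= q.2 <= T -> Q q.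
Proof.
move=> Qp; have /andP[p0 pT] := thin_time Qp.
have pT' : 0 <= p.2 <= T by rewrite (ltW p0).
have n1 := thin_domain_near pT' Qp.2.
rewrite -surjective_pairing in n1.
have n2 : \forall q \near p, 0 < q.2.
  have c1 : q.2 @[q --> nbhs p] --> p.2 by exact: cvg_snd.
  exact: (cvgr_gt _ c1).
apply: filterS (filterI n1 n2) => q [H q0] qT; split; last exact: H.
by rewrite /= in_itv /= q0; case/andP: qT.
Qed.

Lemma thin_near_axis p i : Q p -> \forall s \near (0 : R), Q (p.1 + s *: e_ i, p.2).
Proof.
case: p => x t Qp; have /andP[p0 pT] := thin_time Qp; rewrite /=.
have c1 : (x + s *: e_ i, t) @[s --> (0 : R)] --> (x, t).
  have c1 : x + s *: e_ i @[s --> (0 : R)] --> x + (0 : R) *: e_ i.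
    by apply: cvgD; [exact: cvg_cst|apply: cvgZ; [exact: cvg_id|exact: cvg_cst]].
  by rewrite scale0r addr0 in c1; exact: (cvg_pair c1 (cvg_cst t)).
have Hn := c1 _ (thin_near Qp).
apply: (@filterS _ (nbhs (0 : R)) _ _ _ _ Hn) => s; apply => /=.
by rewrite /= in p0 pT; rewrite (ltW p0).
Qed.

Lemma thin_within p : Q p ->
  within [set q : space_time R n | (`[0, T]%classic : set R) q.2] (nbhs p) `=>` within Q (nbhs p).
Proof.
move=> Qp P; rewrite /within /= => H.
apply: filterS (filterI H (thin_near Qp)) => q [PQ QT] qT.
by apply: PQ; apply: QT; move: qT; rewrite /= in_itv.
Qed.

Lemma partial_rho p i : Q p ->
  is_derive p.1 (e_ i) (fun z => rho (z, p.2)) (D i rho p).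
Proof.
case: p => x t Qp; have := @thin_sol_D1 _ _ _ _ _ _ _ _ _ _ sol x t i Qp.
exact: derivableP.
Qed.

(** Continuity of the gradient inside is part of its continuity up to the
lateral boundary. *)
Lemma partial_rho_cvg p i : Q p -> D i rho q @[q --> within Q (nbhs p)] --> D i rho p.
Proof.
move=> Qp; have [Drho [cD DE _]] := thin_sol_bc sol.
have DE' q : Q q -> Drho q 0 i = D i rho q.
  by case: q => x t /DE ->; rewrite mxE.
have cD' : {within Q, continuous Drho} by apply: continuous_subspaceW cD => q; left.
move/subspace_continuousP: cD' => /(_ p Qp) cDp.
have := cvg_comp _ _ cDp (@coord_continuous R 1 n 0 i (Drho p)).
rewrite DE'//; apply: cvg_trans; apply: near_eq_cvg.
have FF : Filter (within Q (nbhs p)) by exact: within_filter.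
near=> q; rewrite /= DE'//; near: q; exact: withinT.
Unshelve. all: by end_near. Qed.

(** The time derivative of rho is known at fixed points of space only; the
chain rule along xi holds because the space derivatives are continuous. *)
Lemma pjet_rho (xi : R -> 'rV[R]_n) v p : Q p -> xi p.2 = p.1 ->
  has_dq `[0, T] xi p.2 v ->
  pjet T xi v p rho (fun i => D i rho p) (fun i => D i (D i rho) p) (thin_dt rho p).
Proof.
move=> Qp xip xiv; split=> [i|].
  exists (fun s => D i rho (p.1 + s *: e_ i, p.2)); split.
  - apply: filterS (thin_near_axis i Qp) => s Qs.
    have H := partial_rho i Qs.
    exact: (proj1 (is_derive_line (fun z => rho (z, p.2)) p.1 (e_ i) s _)).
  - by rewrite scale0r addr0 -surjective_pairing.
  - apply: (proj1 (is_derive_line (fun z => D i rho (z, p.2)) p.1 (e_ i) 0 _)).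
    rewrite scale0r addr0; case: p Qp {xip xiv} => x t Qp.
    have := @thin_sol_D2 _ _ _ _ _ _ _ _ _ _ sol x t i i Qp.
    exact: derivableP.
have Hd := @dq_curve R n `[0, T] rho (fun i q => D i rho q) xi p.2 v
  (\row_i D i rho p) (thin_dt rho p).
rewrite (eq_bigr (fun i => v 0 i * (\row_i D i rho p) 0 i)); last by move=> i _; rewrite mxE.
apply: Hd => //.
- rewrite xip -surjective_pairing /within /=; apply: filterS (thin_near Qp) => q Qq qT i.
  by apply: partial_rho; apply: Qq; move: qT; rewrite in_itv.
- move=> i; rewrite xip -surjective_pairing mxE.
  by move=> P HP; exact: (thin_within Qp (@partial_rho_cvg p i Qp P HP)).
- rewrite xip; apply: (@dq_sub R R _ [set s | Q (p.1, s)]).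
    have c1 : (p.1, s) @[s --> p.2] --> p.
      by case: (p) => x t; exact: (cvg_pair (cvg_cst x) (@cvg_id _ (nbhs t))).
    have Hn := c1 _ (thin_near Qp).
    apply: (@filterS _ (nbhs p.2) _ _ _ _ Hn) => s Qs sT.
    by apply: Qs; move: sT; rewrite /= in_itv.
  by case: p Qp {xip xiv} => x t Qp; exact: (thin_sol_dt sol Qp).
Qed.

Lemma thin_equation p : Q p -> thin_dt rho p - k * (\sum_i D i (D i rho) p) = f p.
Proof. by case: p => x t Qp; exact: (thin_sol_eq sol Qp). Qed.

(** Along a normal line slip, gap and gap_rate are constant and the height is
affine, so the weight and the barrier are quadratic polynomials. *)
Lemma shifted_values p q (r : R) : A0 p -> A0 q -> p.2 = q.2 -> pj p = pj q ->
  d q = d p + r ->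
  [/\ weight eps q = - ((height eps p + r) * slip eps p)
        + 2^-1 * (gap_rate p * ((height eps p + r) * (height eps p + r))),
      barrier eps q = (height eps p + r) * (height eps p + r)
        - eps * (gap p * (height eps p + r)) &
      forall eta, lift eta q = lift eta p].
Proof.
move=> Ap Aq pq jpq dq.
have hE : height eps q = height eps p + r.
  by rewrite /height dq (cG0 Ap Aq pq); ring.
have sE : slip eps q = slip eps p.
  rewrite /slip (time_level_normal Ap Aq pq jpq).
  by rewrite (timelike_time tG0 cG0 Ap Aq pq).
have gE : gap q = gap p by rewrite /gap (cG0 Ap Aq pq) (cG1 Ap Aq pq).
have bE := timelike_gap_rate Ap Aq pq.
split; first by rewrite /weight hE sE bE.
  by rewrite /barrier hE gE.
by move=> eta; rewrite /lift_normal jpq pq.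
Qed.

(** Partial derivatives that are continuous inside the domain give derivatives
in every direction. *)
Lemma rho_line_derive t x (v : 'rV[R]_n) (s : R) (Drho : space_time R n -> 'rV[R]_n) :
  (forall x t, Q (x, t) -> Drho (x, t) = grad (fun z => rho (z, t)) x) ->
  Q (x + s *: v, t) ->
  is_derive s (1 : R) (fun s => rho (x + s *: v, t)) (dot v (Drho (x + s *: v, t))).
Proof.
move=> DE Qs.
have H : is_diff (x + s *: v) (fun z => rho (z, t)) (fun w => \sum_i w 0 i * Drho (x + s *: v, t) 0 i).
  apply: (@is_diff_partial R n (fun z => rho (z, t)) (fun i z => D i rho (z, t))).
    have c1 := @cvg_slice R n (x + s *: v) t.
    have Hn := c1 _ (thin_near Qs).
    have := thin_time Qs; rewrite /= => /andP[t0 tT].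
    apply: (@filterS _ (nbhs (x + s *: v)) _ _ _ _ Hn) => z Qz i.
    have Qz' : Q (z, t) by apply: Qz; rewrite /= (ltW t0).
    exact: (partial_rho i Qz').
  move=> i; have -> : Drho (x + s *: v, t) 0 i = D i rho (x + s *: v, t).
    by rewrite DE// mxE.
  have H1 := partial_rho_cvg (i := i) Qs.
  have H2 : (z, t) @[z --> x + s *: v] --> within Q (nbhs (x + s *: v, t)).
    move=> P; rewrite /within /= => HP.
    have nI : nbhs (x + s *: v, t) (fun q : space_time R n => (Q q -> P q) /\ (0 <= q.2 <= T -> Q q)).
      have HP' : nbhs (x + s *: v, t) (fun q : space_time R n => Q q -> P q) := HP.
      exact: (filterI HP' (thin_near Qs)).
    have Hn := @cvg_slice R n (x + s *: v) t _ nI.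
    have := thin_time Qs; rewrite /= => /andP[t0 tT].
    have G : nbhs (x + s *: v) (fun z => P (z, t)).
      apply: (@filterS _ (nbhs (x + s *: v)) _ _ _ _ Hn) => z [Pz Qz].
      by apply: Pz; apply: Qz; rewrite /= (ltW t0).
    exact: G.
  exact: (cvg_comp _ _ H2 H1).
have [fd fE] := H.
apply: (proj1 (is_derive_line (fun z => rho (z, t)) x v s _)).
split; first exact: diff_derivable.
by rewrite deriveE// fE.
Qed.

(** Along the inward normal the derivative of F tends to kap * eps * gap > 0:
the Robin condition and the weight make the derivative of the conjugated
solution tend to 0, lifted functions are constant, and - barrier has positive
inward derivative. The gradient of rho on the boundary being a limit from
inside, F is differentiated at interior points only. *)
Lemma lateral_increase t x (eta : space_time R n -> R) (lam sg kap : R) :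
  let F q := expR (- lam * q.2) * (sg * (rho q * expR (weight eps q / k) - lift eta q))
    - kap * barrier eps q in
  0 < kap -> 0 < t <= T -> boundary (Om t) x -> exists2 z, Om t z & F (x, t) < F (z, t).
Proof.
move=> F kap0 tT Bx; have /andP[t0 tT'] := tT; have tT0 : 0 <= t <= T by rewrite ltW.
have [m [m1 Ax hE [s0 s00 Hs]]] := boundary_cases tT0 Bx.
have nE : nuO (x, t) = - m *: normal_field (x, t).
  apply: (outward_normal_sign tT0 Bx m1 s00); last exact: nuOE.
  by move=> s /Hs[].
have := VOE tT Bx; rewrite nE => Hv.
have vE := boundary_velocity tT0 Ax m1 hE Hv.
have [Drho [cD DE BC]] := thin_sol_bc sol.
have Sb : spread `]0, T] (fun t => boundary (Om t)) (x, t) by split => //=; rewrite in_itv.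
have mn : m != 0 by rewrite -sqrf_eq0 m1 oner_eq0.
have kn : k != 0 by rewrite gt_eqF.
(* the boundary condition is invariant under a common change of sign of the
normal and of the velocity, so it holds in the direction grad d *)
have robin : dot (normal_field (x, t)) (Drho (x, t)) +
    k^-1 * (gap_rate (x, t) * height eps (x, t) - slip eps (x, t)) * rho (x, t) = 0.
  have := BC _ Sb; rewrite nE vE dotZl => H; apply: (mulfI mn).
  rewrite mulr0 -[RHS]oppr0 -H.
  by move: (dot _ _) (gap_rate _ * _ - _) (rho _) => y1 y2 y3; ring.
set h := height eps (x, t) in robin hE.
set tau := slip eps (x, t) in robin; set b := gap_rate (x, t) in robin.
set g := gap (x, t) in hE; set a := lift eta (x, t); set e := expR (- lam * t).
pose v := m *: normal_field (x, t); pose z (s : R) := x + s *: v.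
have zE s : z s = x + (s * m) *: normal_field (x, t) by rewrite /z /v scalerA.
pose q (s : R) := - ((h + s * m) * tau) + 2^-1 * (b * ((h + s * m) * (h + s * m))).
pose be (s : R) := (h + s * m) * (h + s * m) - eps * (g * (h + s * m)).
(* F along the inward normal, the weight q and the barrier be being explicit
polynomials *)
pose psi (s : R) := e * (sg * (rho (z s, t) * expR (q s / k) - a)) - kap * be s.
have Qz s : 0 < s < s0 -> Q (z s, t).
  by move=> /Hs[_ Oz]; split; rewrite ?zE//= in_itv.
have FE s : 0 <= s < s0 -> F (z s, t) = psi s.
  move=> /andP[s0' sl].
  have rd : `|d (x, t) + s * m| < delta.
    have [->|sn] := eqVneq s 0; first by rewrite mul0r addr0; case: Ax.
    have sp : 0 < s < s0 by rewrite lt_def sn s0' sl.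
    by have [] := Hs s sp.
  have [Az dz _ jz] := normal_shift Ax rd; rewrite /= -zE in Az dz jz.
  have [wE bE lE] := shifted_values Ax Az erefl (esym jz) dz.
  by rewrite /F /= wE bE lE.
pose q1 (s : R) := m * (b * (h + s * m) - tau).
pose psi1 (s : R) := e * (sg * (dot v (Drho (z s, t)) * expR (q s / k)
   + rho (z s, t) * (expR (q s / k) * (q1 s / k)))) - kap * (m * (2 * (h + s * m) - eps * g)).
have did s : is_derive s (1 : R) (fun s : R => h + s * m) m.
  have := is_deriveD (is_derive_cst h s (1 : R)) (is_deriveM (is_derive_id s (1 : R)) (is_derive_cst m s (1 : R))).
  move=> H; apply: (is_derive_eq H).
  by rewrite scaler0 !add0r /GRing.scale /= /cst mulr1.
have dq s : is_derive s (1 : R) q (q1 s).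
  have H1 := is_deriveM (did s) (is_derive_cst tau s (1 : R)).
  have H2 := is_deriveM (is_derive_cst b s (1 : R)) (is_deriveM (did s) (did s)).
  have H3 := is_deriveD (is_deriveN H1) (is_deriveM (is_derive_cst (2^-1 : R) s (1 : R)) H2).
  apply: (is_derive_eq H3); rewrite /q1 /cst /GRing.scale /=.
  rewrite -[((fun s : R => h + s * m) * (fun s : R => h + s * m)) s]/((h + s * m) * (h + s * m)).
  by field.
have dbe s : is_derive s (1 : R) be (m * (2 * (h + s * m) - eps * g)).
  have H1 := is_deriveM (did s) (did s).
  have H2 := is_deriveM (is_derive_cst eps s (1 : R)) (is_deriveM (is_derive_cst g s (1 : R)) (did s)).
  apply: (is_derive_eq (is_deriveB H1 H2)); rewrite /cst /GRing.scale /=.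
  by ring.
have dE s : is_derive s (1 : R) (fun s => expR (q s / k)) (expR (q s / k) * (q1 s / k)).
  have H1 := is_deriveM (dq s) (is_derive_cst (k^-1) s (1 : R)).
  pose qk (s : R) := q s / k.
  have H2 : is_derive s (1 : R) qk (q1 s / k).
    by apply: (is_derive_eq H1); rewrite /cst /GRing.scale /= mulr0 add0r mulrC.
  apply: (is_derive_eq (is_derive1_comp (is_derive_expR (qk s)) H2)).
  by rewrite mulrC.
have dpsi s : 0 < s < s0 -> is_derive s (1 : R) psi (psi1 s).
  move=> /Qz Qs; have dr := rho_line_derive DE Qs.
  have H1 := is_deriveB (is_deriveM dr (dE s)) (is_derive_cst a s (1 : R)).
  have H2 := is_deriveM (is_derive_cst e s (1 : R)) (is_deriveM (is_derive_cst sg s (1 : R)) H1).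
  have H3 := is_deriveB H2 (is_deriveM (is_derive_cst kap s (1 : R)) (dbe s)).
  apply: (is_derive_eq H3); rewrite /psi1 /cst /GRing.scale /= -/(z s).
  by ring.
have cz : (z s, t) @[s --> (0 : R)^'+] --> (x, t).
  have cz1 : z s @[s --> (0 : R)^'+] --> x.
    have -> : x = z 0 by rewrite /z scale0r addr0.
    apply: cvg_at_right_filter; apply: cvgD; first exact: cvg_cst.
    by apply: cvgZ; [exact: cvg_id|exact: cvg_cst].
  exact: (cvg_pair cz1 (cvg_cst t)).
have nz : \forall s \near (0 : R)^'+, 0 < s < s0.
  by near=> s; apply/andP; split; near: s; [exact: nbhs_right_gt|exact: nbhs_right_lt].
have crho : rho (z s, t) @[s --> (0 : R)^'+] --> rho (x, t).
  move: (thin_sol_cont sol) => /subspace_continuousP /(_ (x, t)) H.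
  have Cx : spread `[0, T] (fun t => closure (Om t)) (x, t).
    by split; [rewrite /= in_itv|case: Bx].
  apply: (cvg_comp _ _ _ (H Cx)) => P; rewrite /within /= => HP.
  have n1 : \forall s \near (0 : R)^'+, spread `[0, T] (fun t => closure (Om t)) (z s, t) -> P (z s, t).
    exact: (cz _ HP).
  have G : \forall s \near (0 : R)^'+, P (z s, t).
    near=> s; have ss : 0 < s < s0 by near: s.
    have [_ Oz] := Qz s ss; apply: (near n1 s) => //.
    by split => /=; [rewrite in_itv|exact: subset_closure].
  exact: G.
have cDr : Drho (z s, t) @[s --> (0 : R)^'+] --> Drho (x, t).
  move: cD => /subspace_continuousP /(_ (x, t) (or_intror Sb)) H.
  apply: (cvg_comp _ _ _ H) => P; rewrite /within /= => HP.
  have n1 : \forall s \near (0 : R)^'+, (Q `|` spread `]0, T] (fun t => boundary (Om t))) (z s, t) -> P (z s, t).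
    exact: (cz _ HP).
  have G : \forall s \near (0 : R)^'+, P (z s, t).
    near=> s; have ss : 0 < s < s0 by near: s.
    by have Qs := Qz s ss; apply: (near n1 s) => //; left.
  exact: G.
have clin : h + s * m @[s --> (0 : R)^'+] --> h.
  rewrite -[X in _ --> X]addr0 -[X in _ + X](mul0r m); apply: cvg_at_right_filter.
  by apply: cvgD; [exact: cvg_cst|apply: cvgM; [exact: cvg_id|exact: cvg_cst]].
have dcv (u : R -> R) (u1 : R) : is_derive (0 : R) (1 : R) u u1 -> u s @[s --> (0 : R)^'+] --> u 0.
  move=> [du _]; apply: cvg_at_right_filter; apply: differentiable_continuous.
  exact/derivable1_diffP.
have cE : expR (q s / k) @[s --> (0 : R)^'+] --> expR (q 0 / k).
  exact: (dcv _ _ (dE 0)).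
have cdot : dot v (Drho (z s, t)) @[s --> (0 : R)^'+] --> dot v (Drho (x, t)).
  apply: cvg_sum_ord => i; apply: cvgM; first exact: cvg_cst.
  exact: (cvg_comp _ _ cDr (@coord_continuous R 1 n 0 i (Drho (x, t)))).
have cpsi : psi s @[s --> (0 : R)^'+] --> psi 0.
  have z0 : z 0 = x by rewrite /z scale0r addr0.
  rewrite /psi z0; apply: cvgB.
    apply: cvgM; first exact: cvg_cst.
    apply: cvgM; first exact: cvg_cst.
    by apply: cvgB; [exact: cvgM|exact: cvg_cst].
  apply: cvgM; first exact: cvg_cst.
  exact: (dcv _ _ (dbe 0)).
have c1 : psi1 s @[s --> (0 : R)^'+] --> kap * (eps * g).
  have -> : kap * (eps * g) = e * (sg * (dot v (Drho (x, t)) * expR (q 0 / k)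
      + rho (x, t) * (expR (q 0 / k) * (m * (b * h - tau) / k)))) - kap * (m * (2 * h - eps * g)).
    have -> : dot v (Drho (x, t)) = - (m * (k^-1 * (b * h - tau) * rho (x, t))).
      rewrite /v dotZl; move/eqP: robin; rewrite addr_eq0 => /eqP ->.
      by rewrite mulrN.
    transitivity (kap * (m ^+ 2 * (eps * g))); first by rewrite m1 mul1r.
    by rewrite hE; field.
  apply: cvgB.
    apply: cvgM; first exact: cvg_cst.
    apply: cvgM; first exact: cvg_cst.
    apply: cvgD; first exact: cvgM.
    apply: cvgM => //; apply: cvgM => //.
    apply: cvgM; last exact: cvg_cst.
    apply: cvgM; first exact: cvg_cst.
    by apply: cvgB; [apply: cvgM => //; exact: cvg_cst|exact: cvg_cst].
  apply: cvgM; first exact: cvg_cst.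
  apply: cvgM; first exact: cvg_cst.
  by apply: cvgB; [apply: cvgM => //; exact: cvg_cst|exact: cvg_cst].
have gp : 0 < kap * (eps * g).
  have /andP[e0 _] := epsE.
  by rewrite mulr_gt0// mulr_gt0// (gap_gt0 Ax).
have n1 : \forall s \near (0 : R)^'+, 0 < psi1 s by exact: (cvgr_gt _ c1).
have n2 : \forall s \near (0 : R)^'+, 0 < psi1 s /\ 0 < s < s0.
  by near=> s; split; near: s.
move: n2; rewrite near_withinE => /nbhs_ballP[r /= r0 Hr].
have Hr' s : 0 < s < r -> 0 < psi1 s /\ 0 < s < s0.
  move=> /andP[sp sr]; apply: Hr => //.
  by rewrite /ball /= sub0r normrN gtr0_norm.
have hr : 0 < r / 2 < r by rewrite divr_gt0//= ltr_pdivrMr// ltr_pMr ?ltr1n.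
have := @increase_right R psi psi1 r r0 (fun s sr => dpsi s (Hr' s sr).2) cpsi
  (fun s sr => (Hr' s sr).1) (r / 2) hr.
have [_ hs] := Hr' _ hr.
exists (z (r / 2)); first by have [] := Qz _ hs.
have x0 : x = z 0 by rewrite /z scale0r addr0.
have F0 : F (x, t) = psi 0 by rewrite [in LHS]x0 FE// lexx s00.
have F1 : F (z (r / 2), t) = psi (r / 2) by apply: FE; move: hs => /andP[/ltW -> ->].
by rewrite F0 F1.
Unshelve. all: by end_near. Qed.

Context {fl eta : space_time R n -> R} {eta0 : 'rV[R]_n -> R}.
Hypothesis lim : limit_classical_solution T k Gamma nu V Phinu (fun p => g1 p - g0 p) fl eta0 eta.

(** * The maximum principle *)

Definition discrepancy (p : space_time R n) : R :=
  rho p * expR (weight eps p / k) - lift eta p.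
(** The factor sg = 1 or -1 handles both signs of the discrepancy. *)
Definition comparison (lam sg kap : R) (p : space_time R n) : R :=
  expR (- lam * p.2) * (sg * discrepancy p) - kap * barrier eps p.
Definition potential (p : space_time R n) : R :=
  weight_potential k (fun j => weight_grad eps j p) (fun j => weight_second eps j p)
    (weight_dt eps p).
Definition barrier_operator (p : space_time R n) : R :=
  barrier_dt eps p - k * (\sum_j barrier_second eps j p)
  + 2 * (\sum_j weight_grad eps j p * barrier_grad eps j p).

Lemma Q_Qbar p : Q p -> Qbar p.
Proof.
move=> Qp; have /andP[p0 pT] := thin_time Qp; split; last by apply: subset_closure; case: Qp.
by rewrite /= in_itv /= (ltW p0).
Qed.

Lemma comparison_continuous (lam sg kap : R) : {within Qbar, continuous (comparison lam sg kap)}.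
Proof.
apply/subspace_continuousP => p Qp.
have FF : Filter (within Qbar (nbhs p)) by exact: within_filter.
have ct : q.2 @[q --> within Qbar (nbhs p)] --> p.2.
  have cs : q.2 @[q --> nbhs p] --> nbhs p.2 by exact: cvg_snd.
  by apply: cvg_trans cs; apply: cvg_app; exact: cvg_within.
have cr : rho q @[q --> within Qbar (nbhs p)] --> rho p.
  by move: (thin_sol_cont sol) => /subspace_continuousP; apply.
have cx (u : space_time R n -> R) : u q @[q --> within Qbar (nbhs p)] --> u p ->
    expR (u q) @[q --> within Qbar (nbhs p)] --> expR (u p).
  by move=> cu; exact: (cvg_comp _ _ cu (@continuous_expR R (u p))).
apply: cvgB; last first.
  by apply: cvgM; [exact: cvg_cst|exact: (Qbar_barrier)].
apply: cvgM.
  by apply: (cx (fun q => - lam * q.2)); apply: cvgM => //; exact: cvg_cst.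
apply: cvgM; first exact: cvg_cst.
apply: cvgB; last first.
  by apply: (Qbar_lift) => //; exact: (limit_sol_cont lim).
apply: cvgM => //; apply: (cx (fun q => weight eps q / k)).
by apply: cvgM; [exact: (Qbar_weight)|exact: cvg_cst].
Qed.

(** All four functions have jets along normal_curve, which stays in the domain
for times near that of p. *)
Lemma interior_inequality p (lam sg kap : R) : Q p ->
  (forall q, Qbar q -> comparison lam sg kap q <= comparison lam sg kap p) ->
  (lam + potential p) * (expR (- lam * p.2) * (sg * discrepancy p)) <=
  expR (- lam * p.2) * (sg * (f p * expR (weight eps p / k) - lifted_operator eps eta p))
   - kap * barrier_operator p.
Proof.
move=> Qp pmax; have pt := thin_time Qp; have /andP[p0 pT] := pt.
have [Ap _] := proj1 (QbarP p) (Q_Qbar Qp).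
have [Gy _] := tubeE Ap.
have Sy : spread `]0, T] Gamma (pj p, p.2) by split; rewrite //= in_itv.
have [xi [v [xip xiv vE xiA xiL]]] := normal_curve Ap.
have C21 := limit_sol_C21 lim.
have Jr := pjet_rho Qp xip xiv.
have Jw := pjet_weight eps Ap xip xiv.
have Jb := pjet_barrier eps Ap xip xiv.
have He : has_dq `[0, T] (fun s => lift eta (xi s, s)) p.2
    (normal_dt T Gamma Phinu eta (pj p, p.2)).
  have H := C21_dt C21 Sy; have {}H : has_dq `[0, T] (fun s => eta (normal_trajectory Gamma Phinu (pj p, p.2) s)) p.2
    (normal_dt T Gamma Phinu eta (pj p, p.2)) := H.
  apply: dq_near_eq H; first by rewrite xiL// (ltW p0).
  near=> s; have sT : (`[0, T]%classic : set R) s by near: s; exact: withinT.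
  by rewrite /= in_itv /= in sT; rewrite xiL.
have Je := pjet_lift (xi := xi) v Ap p0 (C21_D1 C21) (fun j q => C21_D2 C21 j (p:=q)) He.
have m1 i : \forall s \near (0 : R), comparison lam sg kap (p.1 + s *: e_ i, p.2) <= comparison lam sg kap p.
  by apply: filterS (thin_near_axis i Qp) => s /Q_Qbar; exact: pmax.
have m2 : \forall s \near within `[0, T] (nbhs p.2), comparison lam sg kap (xi s, s) <= comparison lam sg kap p.
  have Hn := thin_near Qp.
  have cx : (xi s, s) @[s --> within `[0, T] (dnbhs p.2)] --> (xi p.2, p.2).
    exact: (cvg_pair (dq_cvg xiv) (@within_dnbhs_cvg R `[0, T] p.2)).
  rewrite xip -surjective_pairing in cx.
  have Hx := cx _ Hn; rewrite /within /= in Hx *.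
  have {}Hx : nbhs p.2 (fun s => s != p.2 -> (`[0, T]%classic : set R) s -> 0 <= s <= T -> Q (xi s, s)) := Hx.
  apply: (@filterS _ (nbhs p.2) _ _ _ _ Hx) => s Hs sT.
  have [->|sp] := eqVneq s p.2; first by rewrite xip -surjective_pairing.
  by apply: pmax; apply: Q_Qbar; apply: Hs.
have := max_inequality xip k0 pt Jr Jw Je Jb (thin_equation Qp) m1 m2.
rewrite /discrepancy /potential /barrier_operator.
have -> : \sum_i v 0 i * lift_grad eta i p =
    \sum_i trajectory_velocity i p * lift_grad eta i p.
  by apply: eq_bigr => i _; rewrite vE.
by [].
Unshelve. all: by end_near. Qed.

(** The maximum over the closed domain is at t = 0, where the initial data
bound it, or inside, where lam + potential >= 1. *)
Lemma one_sided_estimate (lam sg kap B Cb Cb' : R) : 0 < kap -> `|sg| = 1 -> 0 <= lam -> 0 <= B ->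
  (forall p, Qbar p -> `|potential p| + 1 <= lam) ->
  (forall p, Qbar p -> `|barrier eps p| <= Cb) ->
  (forall p, Qbar p -> `|barrier_operator p| <= Cb') ->
  (forall p, Q p -> `|f p * expR (weight eps p / k) - lifted_operator eps eta p| <= B) ->
  (forall x, closure (Om 0) x -> `|discrepancy (x, 0)| <= B) ->
  forall p, Qbar p -> expR (- lam * p.2) * (sg * discrepancy p) <= B + kap * (2 * Cb + Cb').
Proof.
move=> kap0 sg1 lam0 B0 Hlam HCb HCb' HB H0 p Qp.
have [q qQ qmax] := compact_EVT_max (ex_intro _ p Qp) (Qbar_compact)
  (comparison_continuous (lam:=lam) (sg:=sg) (kap:=kap)).
have Qq : Qbar q by rewrite inE in qQ.
have {}qmax r : Qbar r -> comparison lam sg kap r <= comparison lam sg kap q.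
  by move=> Qr; apply: qmax; rewrite inE.
have sgb (e x : R) : 0 <= e <= 1 -> `|x| <= B -> e * (sg * x) <= B.
  move=> /andP[e0 e1] xB; rewrite (le_trans (ler_norm _))// !normrM sg1 mul1r (ger0_norm e0).
  by rewrite (le_trans _ xB)// ler_piMl.
have e01 : 0 <= expR (- lam * q.2) <= 1.
  rewrite expR_ge0 /= -expR0 ler_expR mulNr oppr_le0 mulr_ge0//.
  by case: Qq; rewrite /= in_itv /= => /andP[].
have nb r : Qbar r -> - (kap * barrier eps r) <= kap * Cb /\ kap * barrier eps r <= kap * Cb.
  move=> Qr; have := HCb r Qr; rewrite ler_norml => /andP[b1 b2].
  by rewrite -mulrN !ler_pM2l// lerNl b1 b2.
have Cb'0 : 0 <= kap * Cb' by rewrite mulr_ge0 ?(ltW kap0)// (le_trans _ (HCb' p Qp)).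
(* comparing with the maximum costs the barrier twice *)
suff Hq : expR (- lam * q.2) * (sg * discrepancy q) <= B + kap * Cb'.
  have := qmax p Qp; rewrite /comparison => h.
  have [_ h1] := nb p Qp; have [h2 _] := nb q Qq.
  move: h h1 h2 Hq; move: (_ * (sg * discrepancy p)) (_ * (sg * discrepancy q)) (kap * barrier _ _) (kap * barrier _ _) => x1 x2 x3 x4.
  rewrite mulrDr mulrCA; move: (kap * Cb) (kap * Cb') => x5 x6; lra.
have [Aq /andP[dq0 dq1]] := proj1 (QbarP q) Qq.
have qT := rop_time AA Aq.
case: q qQ qmax Qq e01 Aq dq0 dq1 qT => x t qQ qmax Qq e01 Aq dq0 dq1 /= tT.
have [t0|tz] := eqVneq t 0.
  rewrite t0 in e01 Qq *; rewrite (le_trans (sgb _ _ e01 (H0 x _)))//; last by rewrite lerDl.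
  by case: Qq.
have tp : 0 < t <= T by case/andP: tT => t0 ->; rewrite lt_def tz t0.
have [Ox|nOx] := pselect (Om t x); last first.
  have Bx : boundary (Om t) x.
    split; first by case: Qq.
    by move=> /interior_subset.
  have [z Oz Fz] := lateral_increase eta lam sg kap0 tp Bx.
  have Qz : Qbar (z, t) by apply: Q_Qbar; split => //=; rewrite in_itv.
  by have := qmax _ Qz; rewrite leNgt Fz.
have QQ : Q (x, t) by split => //=; rewrite in_itv.
have := interior_inequality QQ qmax; rewrite /=.
have hl := Hlam _ Qq; have hb := HCb' _ Qq; have hf := HB _ QQ.
set E := expR _ * _; move=> hI.
have [E0|E0] := leP E 0; first by rewrite (le_trans E0)// addr_ge0.
have c1 : 1 <= lam + potential (x, t).
  have : - potential (x, t) <= `|potential (x, t)| by rewrite -normrN ler_norm.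
  lra.
have EE : E <= (lam + potential (x, t)) * E by rewrite ler_peMl// ltW.
rewrite (le_trans EE)// (le_trans hI)// lerD//; first exact: sgb.
rewrite -mulrN ler_pM2l// (le_trans _ hb)// -normrN ler_norm//.
Qed.

(** The factor kap of the barrier is arbitrary and disappears in the limit. *)
Lemma two_sided_estimate (lam B Cb Cb' : R) : 0 <= lam -> 0 <= B ->
  (forall p, Qbar p -> `|potential p| + 1 <= lam) ->
  (forall p, Qbar p -> `|barrier eps p| <= Cb) ->
  (forall p, Qbar p -> `|barrier_operator p| <= Cb') ->
  (forall p, Q p -> `|f p * expR (weight eps p / k) - lifted_operator eps eta p| <= B) ->
  (forall x, closure (Om 0) x -> `|discrepancy (x, 0)| <= B) ->
  forall p, Qbar p -> `|discrepancy p| <= expR (lam * T) * B.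
Proof.
move=> lam0 B0 H1 H2 H3 H4 H5 p Qp.
have H sg : `|sg| = 1 -> expR (- lam * p.2) * (sg * discrepancy p) <= B.
  move=> sg1; apply/ler_addgt0Pr => e e0.
  have Cb0 : 0 <= 2 * Cb + Cb'.
    by rewrite addr_ge0 ?mulr_ge0//; [exact: le_trans (H2 p Qp)|exact: le_trans (H3 p Qp)].
  have C1 : 0 < 2 * Cb + Cb' + 1 by rewrite ltr_pwDr.
  have kap0 : 0 < e / (2 * Cb + Cb' + 1) by rewrite divr_gt0.
  rewrite (le_trans (one_sided_estimate kap0 sg1 lam0 B0 H1 H2 H3 H4 H5 Qp))//.
  by rewrite lerD2l mulrAC ler_pdivrMr// ler_pM2l// lerDl ler01.
have pT : p.2 <= T by case: Qp; rewrite /= in_itv /= => /andP[].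
have Hn : expR (- lam * p.2) * `|discrepancy p| <= B.
  have [d0|d0] := leP 0 (discrepancy p).
    by rewrite ger0_norm// -[X in _ * X]mul1r; apply: H; rewrite normr1.
  by rewrite ltr0_norm// -[X in _ * X]mulN1r; apply: H; rewrite normrN1.
have -> : `|discrepancy p| = expR (lam * p.2) * (expR (- lam * p.2) * `|discrepancy p|).
  by rewrite mulrA -expRD mulNr subrr expR0 mul1r.
rewrite (@le_trans _ _ (expR (lam * p.2) * B))//; first by rewrite ler_wpM2l ?expR_ge0.
by rewrite ler_wpM2r// ler_expR ler_wpM2l.
Qed.

End fixed_width.

Local Notation S := (spread `]0, T] Gamma).

(** * The estimate uniform in the thickness *)

Definition bounded_by_C21 (eta : space_time R n -> R) (N2 : R) : Prop :=
  forall q, S q -> [/\ `|eta q| <= N2, `|normal_dt T Gamma Phinu eta q| <= N2,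
    forall j, `|tD j eta q| <= N2 & forall j l, `|tD j (tD l eta) q| <= N2].

(** The initial condition holds inside the domain only and extends to its
closure by continuity of both sides. *)
Lemma initial_closure eps f rho0 rho nuO VO :
  let Om := thin_domain Gamma nu g0 g1 eps in
  thin_classical_solution T k Om nuO VO f rho0 rho ->
  {within closure (Om 0), continuous rho0} ->
  forall x, closure (Om 0) x -> rho (x, 0) = rho0 x.
Proof.
move=> Om sol c0' x cx.
have PF : ProperFilter (within (Om 0) (nbhs x)) by exact: within_nbhs_proper.
have h1 : rho (z, 0) @[z --> within (Om 0) (nbhs x)] --> rho (x, 0).
  move: (thin_sol_cont sol) => /subspace_continuousP /(_ (x, 0)) H.
  have Cx : spread `[0, T] (fun t => closure (Om t)) (x, 0).
    by split => //=; rewrite in_itv /= lexx ltW.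
  apply: (cvg_comp _ _ _ (H Cx)) => P; rewrite /within /= => HP.
  have {}HP : nbhs (x, (0 : R)) (fun q : space_time R n => spread `[0, T] (fun t => closure (Om t)) q -> P q) := HP.
  have Hn := @cvg_slice R n x 0 _ HP.
  have G : nbhs x (fun z => Om 0 z -> P (z, 0)).
    apply: (@filterS _ (nbhs x) _ _ _ _ Hn) => z Pz Oz; apply: Pz.
    by split; [rewrite /= in_itv /= lexx ltW|exact: subset_closure].
  exact: G.
have h2 : rho (z, 0) @[z --> within (Om 0) (nbhs x)] --> rho0 x.
  move: c0' => /subspace_continuousP /(_ x cx) H.
  have H2 : rho0 z @[z --> within (Om 0) (nbhs x)] --> rho0 x.
    apply: cvg_trans H; apply: cvg_app => P; rewrite /within /= => HP.
    have {}HP : nbhs x (fun z => closure (Om 0) z -> P z) := HP.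
    have G : nbhs x (fun z => Om 0 z -> P z).
      by apply: (@filterS _ (nbhs x) _ _ _ _ HP) => z Pz Oz; apply: Pz; exact: subset_closure.
    exact: G.
  apply: cvg_trans H2; apply: near_eq_cvg; near=> z.
  by apply/esym/(thin_sol_init sol); near: z; exact: withinT.
exact: (cvg_unique _ h1 h2).
Unshelve. all: by end_near. Qed.

(** The weight is O(eps), so passing between rho and the conjugated solution
costs eps times the size of eta-bar. The source of the comparison is (f -
f-bar) exp(phi / k), plus f-bar (exp(phi / k) - 1), plus the consistency
error, the last two being O(eps) times the norm of eta. *)
Lemma uniform_estimate : exists2 C : R, 0 < C & forall eps : R, 0 < eps < eps0 ->
  let Om := thin_domain Gamma nu g0 g1 eps in
  let Q := spread `]0, T] Om in
  forall nuO VO f rho0 rho fl eta0 eta,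
  (forall x t, 0 < t <= T -> boundary (Om t) x ->
     outward_unit_normal (boundary (Om t)) (Om t) x (nuO (x, t))) ->
  (forall x t, 0 < t <= T -> boundary (Om t) x ->
     normal_velocity `[0, T] (fun s => boundary (Om s)) x t (nuO (x, t)) (VO (x, t))) ->
  {within closure (Om 0), continuous rho0} ->
  thin_classical_solution T k Om nuO VO f rho0 rho ->
  limit_classical_solution T k Gamma nu V Phinu (fun p => g1 p - g0 p) fl eta0 eta ->
  forall M F N1 N2 : R, 0 <= M -> 0 <= F -> 0 <= N1 -> 0 <= N2 ->
  (forall x, closure (Om 0) x -> `|rho0 x - eta0 (pj (x, 0))| <= M) ->
  (forall p, Q p -> `|f p - fl (pj p, p.2)| <= F) ->
  (forall y, Gamma 0 y -> `|eta0 y| <= N1) ->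
  bounded_by_C21 eta N2 ->
  forall p, spread `[0, T] (fun t => closure (Om t)) p ->
  `|rho p - eta (pj p, p.2)| <= C * (M + F) + eps * C * (N1 + N2).
Proof.
have [Cw Cw0 HCw] := weight_small.
have [Cp Cp0 HCp] := potential_bd.
have [Cb Cb0 HCb] := barrier_bd.
have [Cb' Cb'0 HCb'] := barrier_operator_bd.
have [Cc Cc0 HCc] := consistency_error.
have [Cr Cr0 HCr] := residual_domN.
pose a := Cw / k; have a0 : 0 <= a by rewrite divr_ge0// ltW.
pose Ea := expR a; have Ea1 : 1 <= Ea by rewrite -expR0 ler_expR.
have Ea0 : 0 <= Ea by rewrite (le_trans _ Ea1).
pose lam := Cp + 1; have lam0 : 0 <= lam by rewrite addr_ge0.
pose K := expR (lam * T); have K0 : 0 <= K by exact: expR_ge0.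
pose B1 := Ea + (Cr * (a * Ea) + Cc) + a * Ea.
have aE0 : 0 <= a * Ea by rewrite mulr_ge0.
have cr0 : 0 <= Cr * (a * Ea) + Cc by rewrite addr_ge0// mulr_ge0.
have B10 : 0 <= B1 by apply: addr_ge0 => //; apply: addr_ge0.
exists (Ea * (K * B1) + a * Ea + 1).
  by rewrite ltr_wpDl// addr_ge0// mulr_ge0// mulr_ge0.
move=> eps epsE Om Q nuO VO f rho0 rho fl eta0 eta nuOE VOE c0' sol lim M F N1 N2
  M0 F0 N10 N20 HM HF HN1 HN2.
have /andP[e0 e1] := epsE.
have el1 : eps <= 1 by rewrite (le_trans (ltW e1))//; have /andP[_ /ltW] := thin_width_eps0 tw.
pose ix (p : space_time R n) : ((R * space_time R n) * ((space_time R n -> R) * R))%type := ((eps, p), (eta, N2)).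
have QP := QbarP epsE.
have tix p : spread `[0, T] (fun t => closure (Om t)) p ->
    thin_index (ix p).
  by move=> /QP[Ap dp]; split.
have wE p : spread `[0, T] (fun t => closure (Om t)) p -> `|weight eps p / k| <= a * eps.
  move=> /tix/HCw /= h; rewrite normrM normfV (gtr0_norm k0) /a mulrAC.
  by rewrite ler_pM2r ?invr_gt0.
have wEa p : spread `[0, T] (fun t => closure (Om t)) p -> `|weight eps p / k| <= a.
  by move=> /wE/le_trans; apply; rewrite ler_piMr.
have Eb p : spread `[0, T] (fun t => closure (Om t)) p ->
   [/\ expR (weight eps p / k) <= Ea, expR (- (weight eps p / k)) <= Ea,
       `|expR (weight eps p / k) - 1| <= eps * (a * Ea) &
       `|expR (- (weight eps p / k)) - 1| <= eps * (a * Ea)].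
  move=> Qp; have h1 := wE p Qp; have h2 := wEa p Qp.
  have ee : expR (a * eps) <= Ea by rewrite ler_expR ler_piMr.
  have h3 : a * eps * expR (a * eps) <= eps * (a * Ea).
    by rewrite mulrCA mulrA ler_wpM2l// mulr_ge0// ltW.
  split; rewrite ?ler_expR.
  - by rewrite (le_trans (ler_norm _)).
  - by rewrite (le_trans (ler_norm _))// normrN.
  - exact: le_trans (expR_sub1 h1) h3.
  - by apply: le_trans (expR_sub1 _) h3; rewrite normrN.
(* bounds at once the source inside and the discrepancy at t = 0 *)
pose B := Ea * (M + F) + eps * ((Cr * (a * Ea) + Cc) * N2) + eps * (a * Ea * N1).
have pe := ltW e0.
have B0 : 0 <= B.
  apply: addr_ge0; first apply: addr_ge0.
  - by apply: mulr_ge0 => //; exact: addr_ge0.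
  - by apply: mulr_ge0 => //; exact: mulr_ge0.
  - by apply: mulr_ge0 => //; exact: mulr_ge0.
have QQ p : Q p -> spread `[0, T] (fun t => closure (Om t)) p by exact: (@Q_Qbar).
have surf p : A0 p -> 0 < p.2 -> S (pj p, p.2).
  move=> Ap p0; have [Gp _] := tubeE Ap; split => //=.
  by rewrite in_itv /= p0; have /andP[] := rop_time AA Ap.
have lix p : Q p -> limit_index (ix p).
  move=> Qp; have /andP[p0 _] := thin_time Qp; have [Ap _] := proj1 (QP p) (QQ p Qp).
  have [b1 b2 b3 b4] := HN2 _ (surf p Ap p0).
  have C21 := limit_sol_C21 lim.
  split => //=; first exact: tix (QQ p Qp).
  by move=> q Sq; split; [exact: (C21_D1 C21)|move=> j; exact: (C21_D2 C21)].
have bet p : spread `[0, T] (fun t => closure (Om t)) p -> `|lift eta p| <= N1 + N2.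
  move=> Qp; have [Ap _] := proj1 (QP p) Qp.
  have [Gp _] := tubeE Ap; have /andP[p0 pT] := rop_time AA Ap.
  have [pz|pn] := eqVneq p.2 0.
    rewrite /lift_normal pz (limit_sol_init lim); last by rewrite -pz.
    by rewrite (@le_trans _ _ N1)// ?lerDl//; apply: HN1; rewrite -pz.
  have pp : 0 < p.2 by rewrite lt_def pn p0.
  have [b1 _ _ _] := HN2 _ (surf p Ap pp).
  by rewrite (le_trans b1)// lerDr.
have init x : closure (Om 0) x -> `|discrepancy (eps:=eps) (rho:=rho) (eta:=eta) (x, 0)| <= B.
  move=> cx; have Qx : spread `[0, T] (fun t => closure (Om t)) (x, 0).
    by split => //=; rewrite in_itv /= lexx ltW.
  have [Ax _] := proj1 (QP _) Qx; have [Gx _] := tubeE Ax.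
  have [E1 _ E3 _] := Eb _ Qx.
  rewrite /discrepancy (initial_closure sol c0' cx) /lift_normal (limit_sol_init lim Gx).
  set E := expR _ in E1 E3 *.
  have -> : rho0 x * E - eta0 (pj (x, 0)) = (rho0 x - eta0 (pj (x, 0))) * E + eta0 (pj (x, 0)) * (E - 1) by ring.
  rewrite (le_trans (ler_normD _ _))// !normrM.
  have h1 : `|rho0 x - eta0 (pj (x, 0))| * `|E| <= M * Ea.
    by rewrite ler_pM// ?HM// ger0_norm// expR_ge0.
  have h2 : `|eta0 (pj (x, 0))| * `|E - 1| <= N1 * (eps * (a * Ea)) by rewrite ler_pM// HN1.
  rewrite (le_trans (lerD h1 h2))// /B.
  have h3 : 0 <= Ea * F by rewrite mulr_ge0.
  have h4 : 0 <= eps * ((Cr * (a * Ea) + Cc) * N2) by apply: mulr_ge0 => //; exact: mulr_ge0.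
  move: h3 h4; move: (eps * ((Cr * (a * Ea) + Cc) * N2)) => y1 h3 h4.
  have -> : N1 * (eps * (a * Ea)) = eps * (a * Ea * N1) by ring.
  rewrite mulrDr (mulrC M); move: (eps * _) (Ea * F) (Ea * M) h3 => y2 y3 y4; lra.
have inter p : Q p -> `|f p * expR (weight eps p / k) - lifted_operator eps eta p| <= B.
  move=> Qp; have Qbp := QQ p Qp; have [Ap _] := proj1 (QP _) Qbp.
  have /andP[p0 _] := thin_time Qp.
  have [E1 _ E3 _] := Eb _ Qbp.
  have hc := HCc _ (lix p Qp); have hr := HCr _ (lix p Qp); rewrite /= in hc hr.
  have fE := limit_equation lim Ap p0.
  have hF := HF p Qp; rewrite fE in hF.
  move: hc hr hF; set Lop := lifted_operator _ _ _; set fb := limit_residual _ _ => hc hr hF.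
  set E := expR _ in E1 E3 *.
  have -> : f p * E - Lop = (f p - fb) * E + fb * (E - 1) - (Lop - fb) by ring.
  rewrite (le_trans (ler_normB _ _))// (@le_trans _ _ (F * Ea + Cr * N2 * (eps * (a * Ea)) + Cc * (eps * N2)))//.
    rewrite lerD// (le_trans (ler_normD _ _))// !normrM lerD//.
      by rewrite ler_pM// ger0_norm// expR_ge0.
    by rewrite ler_pM.
  have h3 : 0 <= Ea * M by rewrite mulr_ge0.
  have h4 : 0 <= eps * (a * Ea * N1) by apply: mulr_ge0 => //; exact: mulr_ge0.
  rewrite /B; move: h3 h4; move: (eps * (a * Ea * N1)) => y1 h3 h4.
  have -> : F * Ea + Cr * N2 * (eps * (a * Ea)) + Cc * (eps * N2) = F * Ea + eps * ((Cr * (a * Ea) + Cc) * N2) by ring.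
  rewrite mulrDr (mulrC F); move: (eps * (_ * N2)) (Ea * F) (Ea * M) h3 => y2 y3 y4; lra.
move=> p Qp.
have main := two_sided_estimate epsE nuOE VOE sol lim lam0 B0 _ _ _ inter init Qp.
have {main} main : `|discrepancy (eps:=eps) (rho:=rho) (eta:=eta) p| <= K * B.
  apply: (main Cb Cb') => q Qq.
  - by rewrite lerD2r; have := HCp _ (tix q Qq); rewrite mulr1.
  - by have := HCb _ (tix q Qq); rewrite mulr1.
  - by have := HCb' _ (tix q Qq); rewrite mulr1.
have [_ E2 _ E4] := Eb _ Qp.
have he := bet p Qp.
move: main; rewrite /discrepancy => main.
set w := weight eps p / k in E2 E4 main.
have EE : expR w * expR (- w) = 1 by rewrite -expRD subrr expR0.
have -> : rho p - eta (pj p, p.2) = (rho p * expR w - lift eta p) * expR (- w) + lift eta p * (expR (- w) - 1).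
  transitivity (rho p * (expR w * expR (- w)) - lift eta p); first by rewrite EE mulr1.
  by ring.
rewrite (le_trans (ler_normD _ _))// !normrM.
have h1 : `|rho p * expR w - lift eta p| * `|expR (- w)| <= K * B * Ea.
  by rewrite ler_pM// ger0_norm// expR_ge0.
have h2 : `|lift eta p| * `|expR (- w) - 1| <= (N1 + N2) * (eps * (a * Ea)).
  by rewrite ler_pM.
rewrite (le_trans (lerD h1 h2))//.
have hB : B <= B1 * (M + F) + eps * (B1 * (N1 + N2)).
  rewrite /B /B1.
  have mf : 0 <= M + F by exact: addr_ge0.
  have x1 : 0 <= (Cr * (a * Ea) + Cc) * (M + F) by rewrite mulr_ge0.
  have x2 : 0 <= a * Ea * (M + F) by rewrite mulr_ge0.
  have x3 : 0 <= eps * (Ea * (N1 + N2)) by do 2 apply: mulr_ge0 => //; exact: addr_ge0.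
  have x4 : 0 <= eps * ((Cr * (a * Ea) + Cc) * N1) by do 2 apply: mulr_ge0 => //.
  have x5 : 0 <= eps * (a * Ea * N2) by do 2 apply: mulr_ge0 => //.
  rewrite -subr_ge0 (_ : _ - _ = (Cr * (a * Ea) + Cc) * (M + F) + a * Ea * (M + F) +
    eps * (Ea * (N1 + N2)) + eps * ((Cr * (a * Ea) + Cc) * N1) + eps * (a * Ea * N2)); last by ring.
  by rewrite !addr_ge0.
have hB' : K * B * Ea <= Ea * (K * B1) * (M + F) + eps * (Ea * (K * B1)) * (N1 + N2).
  have := ler_wpM2l (mulr_ge0 K0 Ea0) hB.
  have -> : K * Ea * B = K * B * Ea by ring.
  have -> : K * Ea * (B1 * (M + F) + eps * (B1 * (N1 + N2))) = Ea * (K * B1) * (M + F) + eps * (Ea * (K * B1)) * (N1 + N2) by ring.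
  by [].
rewrite (le_trans (lerD hB' (lexx _)))//.
have y1 : 0 <= (a * Ea + 1) * (M + F) by rewrite mulr_ge0 ?addr_ge0.
have y2 : 0 <= eps * (N1 + N2) by rewrite mulr_ge0 ?addr_ge0// ltW.
rewrite -subr_ge0 (_ : _ - _ = (a * Ea + 1) * (M + F) + eps * (N1 + N2)); last by ring.
by rewrite addr_ge0.
Qed.

End moving_surface_tube.

(** * Sup norms and conclusion *)

(** Each sup norm is a term of a sum of nonnegative extended reals, hence
finite and bounded by it. *)
Lemma bound_C21 {R : realType} {n : nat} (T : R) (Gamma : R -> set 'rV[R]_n)
    (nu Phinu : space_time R n -> 'rV[R]_n) (eta : space_time R n -> R) :
  spread `]0, T] Gamma !=set0 -> norm_C21 T Gamma nu Phinu eta \is a fin_num ->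
  bounded_by_C21 (T:=T) (Gamma:=Gamma) (nu:=nu) (Phinu:=Phinu) eta
    (fine (norm_C21 T Gamma nu Phinu eta)).
Proof.
set S := spread `]0, T] Gamma => S0 Nf q Sq.
have sp (f : space_time R n -> R) : (0 <= sup_norm S f)%E by exact: sup_norm_ge0.
set s0 := sup_norm S eta; set s1 := sup_norm S (normal_dt T Gamma Phinu eta).
pose s2 := (\sum_(i < n) sup_norm S (tD Gamma nu i eta))%E.
pose s3 := (\sum_(i < n) \sum_(j < n) sup_norm S (tD Gamma nu i (tD Gamma nu j eta)))%E.
have NE : norm_C21 T Gamma nu Phinu eta = (s0 + s1 + s2 + s3)%E by [].
have p0 : (0 <= s0)%E by exact: sp.
have p1 : (0 <= s1)%E by exact: sp.
have p2 : (0 <= s2)%E by apply: sume_ge0 => i _; exact: sp.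
have p3 : (0 <= s3)%E by apply: sume_ge0 => i _; apply: sume_ge0 => j _; exact: sp.
split => [||j|j l]; apply: le_sup_norm Nf Sq; rewrite NE.
- by rewrite -!addeA leeDl// !adde_ge0.
- by rewrite (addeC s0) -!addeA leeDl// !adde_ge0.
- apply: (@le_trans _ _ s2).
    by rewrite /s2 (bigD1 j)//= leeDl// sume_ge0.
  by rewrite (addeC _ s2) -addeA leeDl// !adde_ge0.
- apply: (@le_trans _ _ s3); last by rewrite addeC leeDl// !adde_ge0.
  rewrite /s3 (bigD1 j)//= (bigD1 l)//= -addeA leeDl//.
  by rewrite adde_ge0 ?sume_ge0// => i _; exact: sume_ge0.
Qed.

Theorem theorem1p1 (R : realType) (n : nat) (T : R)
    (Gamma : R -> set 'rV[R]_n) (nu : 'rV[R]_n * R -> 'rV[R]_n)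
    (Phi : 'rV[R]_n * R -> 'rV[R]_n) (V : 'rV[R]_n * R -> R)
    (Phinu : 'rV[R]_n * R -> 'rV[R]_n)
    (delta c0 : R) (pi : 'rV[R]_n * R -> 'rV[R]_n)
    (eps0 c : R) (g0 g1 : 'rV[R]_n * R -> R) (kd : R) :
  (2 <= n)%N -> 0 < T ->
  moving_surface T Gamma nu Phi ->
  surface_normal_velocity T Gamma nu Phi V ->
  normal_flow T Gamma nu V Phinu ->
  tubular_neighborhood T Gamma nu delta c0 pi ->
  thin_width T Gamma delta eps0 c g0 g1 ->
  0 < kd ->
  depends_only_on_time T Gamma g0 ->
  depends_only_on_time T Gamma g1 ->
  exists cT : R, 0 < cT /\
    forall eps : R, 0 < eps < eps0 ->
    let Om := thin_domain Gamma nu g0 g1 eps in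
    let Q := spread `]0, T] Om in
    let Qbar := spread `[0, T] (fun t => closure (Om t)) in
    let S := spread `]0, T] Gamma in
    let g := fun p => g1 p - g0 p in
    forall (nueps : 'rV[R]_n * R -> 'rV[R]_n) (Veps : 'rV[R]_n * R -> R),
    (forall x t, 0 < t <= T -> boundary (Om t) x ->
       outward_unit_normal (boundary (Om t)) (Om t) x (nueps (x, t))) ->
    (forall x t, 0 < t <= T -> boundary (Om t) x ->
       normal_velocity `[0, T] (fun s => boundary (Om s)) x t
         (nueps (x, t)) (Veps (x, t))) ->
    forall (rho0 : 'rV[R]_n -> R) (feps : 'rV[R]_n * R -> R)
           (eta0 : 'rV[R]_n -> R) (f : 'rV[R]_n * R -> R),
    {within closure (Om 0), continuous rho0} ->
    {within Q, continuous feps} ->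
    {within Gamma 0, continuous eta0} ->
    {within S, continuous f} ->
    forall rho eta : 'rV[R]_n * R -> R,
    thin_classical_solution T kd Om nueps Veps feps rho0 rho ->
    limit_classical_solution T kd Gamma nu V Phinu g f eta0 eta ->
    let bound : \bar R :=
      (cT%:E * (sup_norm (closure (Om 0%R)) (fun x => (rho0 x - eta0 (pi (x, 0)))%R)
                + sup_norm Q (fun p => (feps p - f (pi p, p.2))%R))
       + (eps * cT)%:E * (sup_norm (Gamma 0%R) eta0
                          + norm_C21 T Gamma nu Phinu eta))%E in
    bound \is a fin_num ->
    (sup_norm Qbar (fun p => (rho p - eta (pi p, p.2))%R) <= bound)%E.
Proof.
move=> _ T0 ms _ nf tn tw kd0 dg0 dg1.
have ts : tube_setting T Gamma nu Phi V Phinu delta c0 pi by split.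
have [C C0 H] := uniform_estimate ts tw dg0 dg1 kd0.
exists C; split => // eps epsE Om Q Qbar S g nueps Veps nuE VE rho0 feps eta0 f
  crho0 _ _ _ rho eta sol lim bound bfin.
have /andP[e0 _] := epsE.
have Gne t : 0 <= t <= T -> Gamma t !=set0 by exact: (surface_neq0 ts).
(* sup norms over nonempty sets are nonnegative, as the bounds are required to
be *)
have One t : 0 <= t <= T -> Om t !=set0.
  move=> tT; have [y Gy] := Gne t tT.
  exists (y + (eps * ((g0 (y, t) + g1 (y, t)) / 2)) *: nu (y, t)).
  exists y, (eps * ((g0 (y, t) + g1 (y, t)) / 2)); split => //.
  have Sy : spread `[0, T] Gamma (y, t) by split; rewrite //= in_itv.
  have gp : 0 < g1 (y, t) - g0 (y, t).
    exact: lt_le_trans (thin_width_const_gt0 tw) (thin_width_lb tw Sy).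
  by rewrite !ltr_pM2l//; apply/andP; split; lra.
have T00 : 0 <= (0 : R) <= T by rewrite lexx ltW.
have TTT : 0 <= T <= T by rewrite lexx ltW.
have Cne : closure (Om 0) !=set0 by have [x Ox] := One _ T00; exists x; exact: subset_closure.
have Qne : Q !=set0.
  by have [x Ox] := One _ TTT; exists (x, T); split; rewrite //= in_itv /= T0 lexx.
have Sne : S !=set0.
  by have [x Ox] := Gne _ TTT; exists (x, T); split; rewrite //= in_itv /= T0 lexx.
move: (bfin); rewrite /bound fin_numD => /andP[/(fin_num_pmul C0) h1 /(fin_num_pmul (mulr_gt0 e0 C0)) h2].
move: h1; rewrite fin_numD => /andP[Mf Ff].
move: h2; rewrite fin_numD => /andP[N1f N2f].
have b21 := bound_C21 Sne N2f.
have nn (x : \bar R) : (0 <= x)%E -> 0 <= fine x := @fine_ge0 R x.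
apply: ge_ereal_sup => _ [p Qp <-].
have := H eps epsE nueps Veps feps rho0 rho f eta0 eta nuE VE crho0 sol lim
  _ _ _ _ (nn _ (sup_norm_ge0 _ Cne)) (nn _ (sup_norm_ge0 _ Qne))
  (nn _ (sup_norm_ge0 _ (Gne _ T00))) _ (fun x => le_sup_norm (lexx _) Mf)
  (fun q => le_sup_norm (lexx _) Ff) (fun y => le_sup_norm (lexx _) N1f) b21 p Qp.
have N20 : 0 <= fine (norm_C21 T Gamma nu Phinu eta).
  by have [q Sq] := Sne; have [b _ _ _] := b21 q Sq; exact: le_trans b.
move=> /(_ N20); rewrite -lee_fin => /le_trans; apply.
by rewrite /bound EFinD !EFinM !EFinD !fineK// lexx.
Qed.
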